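(* Consider the regularized min-max bilevel problem and Algorithm MORMA-SOBA described in the context, under the assumptions stated there. Then there exist positive constants $c_1,c_2,c_3,\tau_x,\tau_\lambda>0$ such that if $\alpha_k\equiv\Theta(1/\sqrt{nK})$ (constant in $k$), $\beta_k=c_1\alpha_k$, $\gamma_k=c_2\alpha_k$, $\theta_k=c_3\alpha_k$ and $\mu_\lambda<1$, then the iterates of the algorithm satisfy $$\frac1K\sum_{k=0}^{K}\mathbb E\left[\left\|\frac1{\tau_x}\Big(x^k-\Pi_{\mathcal X}\big(x^k-\tau_x\nabla\Psi_{\mu_\lambda}(x^k)\big)\Big)\right\|^2\right]=\mathcal O\left(\frac{n^2}{\mu_\lambda^2\sqrt K}\right),$$ where $\Psi_{\mu_\lambda}(x):=\max_{\lambda\in\Delta_n}\Phi_{\mu_\lambda}(x,\lambda)$. That is, when $x^R$ is selected uniformly at random from $\{x^1,\dots,x^K\}$, the sample complexity (total number of calls to stochastic oracles) of finding an $\epsilon$-stationary point, i.e. guaranteeing $\mathbb E\big[\|\frac1{\tau_x}(x^R-\Pi_{\mathcal X}(x^R-\tau_x\nabla\Psi_{\mu_\lambda}(x^R)))\|^2\big]\le\epsilon$, is $\mathcal O(n^5\mu_\lambda^{-4}\epsilon^{-2})$.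
   Context: Problem: for $1\le i\le n$ let $f_i,g_i:\mathbb R^{d_x}\times\mathbb R^{d_{y_i}}\to\mathbb R$, $y_i^*(x)=\arg\min_{y}g_i(x,y)$, $\Phi_i(x)=f_i(x,y_i^*(x))$. $\mathcal X$ is either $\mathbb R^{d_x}$ or a nonempty convex compact subset of it; $\Delta_n=\{\lambda\in\mathbb R^n:\lambda_i\ge0,\sum_i\lambda_i=1\}$; $\mathbf 1_n$ is the all-ones vector; $\Pi$ denotes orthogonal projection; $\|\cdot\|$ is the Euclidean norm (operator norm for matrices). For $\mu_\lambda>0$ the problem is $\min_{x\in\mathcal X}\max_{\lambda\in\Delta_n}\Phi_{\mu_\lambda}(x,\lambda)$ with $\Phi_{\mu_\lambda}(x,\lambda)=\sum_{i=1}^n\lambda_i\Phi_i(x)-\frac{\mu_\lambda}2\|\lambda-\frac{\mathbf 1_n}n\|^2$. Assumptions on functions, for every $i$: (a) $f_i$ is differentiable, $g_i$ twice differentiable, and $\nabla f_i,\nabla g_i,\nabla^2g_i$ are Lipschitz with constants $L_{\nabla f},L_{\nabla g},L_{\nabla^2g}$; (b) $g_i(x,\cdot)$ is $\mu_g$-strongly convex for every $x$, $\mu_g>0$; (c) $\|\nabla_2f_i(x,y_i^*(x))\|\le L_f$ for all $x\in\mathcal X$; (d) $|\Phi_i(x)|\le b_\Phi$, $\|\nabla\Phi_i(x)\|\le L_\Phi$, and $|f_i(x,y)-f_i(x,\tilde y)|\le L_f\|y-\tilde y\|$ for all $x,y,\tilde y$. Algorithm MORMA-SOBA: input (deterministic)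 $x^0\in\mathcal X$, $\lambda^0\in\Delta_n$, $y_i^0,z_i^0\in\mathbb R^{d_{y_i}}$, $h_x^0=0$, $h_\lambda^0=0$, parameters $\tau_x,\tau_\lambda>0$ and positive stepsizes $\alpha_k,\beta_k,\gamma_k,\theta_k$. At each iteration $k=0,1,\dots$: $x^{k+1}=x^k+\alpha_k(\Pi_{\mathcal X}(x^k-\tau_xh_x^k)-x^k)$; $\lambda^{k+1}=\lambda^k+\alpha_k(\Pi_{\Delta_n}(\lambda^k+\tau_\lambda h_\lambda^k)-\lambda^k)$; for each $i$: $y_i^{k+1}=y_i^k-\beta_kv_i^{k+1}$, $z_i^{k+1}=z_i^k-\gamma_k(H_i^{k+1}z_i^k-u_{y,i}^{k+1})$; $h_x^{k+1}=(1-\theta_k)h_x^k+\theta_k\sum_{i=1}^n\lambda_i^k(u_{x,i}^{k+1}-J_i^{k+1}z_i^k)$; $h_\lambda^{k+1}=(1-\theta_k)h_\lambda^k+\theta_k\big(s^{k+1}-\mu_\lambda(\lambda^k-\frac{\mathbf 1_n}n)\big)$. Oracle assumptions: let $\mathscr F_k$ be the sigma-algebra generated by all iterates with superscript at most $k$. Conditionally on $\mathscr F_k$, all of $u_{x,i}^{k+1},u_{y,i}^{k+1},v_i^{k+1},H_i^{k+1},J_i^{k+1}$ ($1\le i\le n$) and $s^{k+1}=(s_1^{k+1},\dots,s_n^{k+1})^\top$ are independent; they are unbiased estimators of $\nabla_1f_i(x^k,y_i^k)$, $\nabla_2f_i(x^k,y_i^k)$, $\nabla_2g_i(x^k,y_i^k)$,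 $\nabla_{22}^2g_i(x^k,y_i^k)$, $\nabla_{12}^2g_i(x^k,y_i^k)\in\mathbb R^{d_x\times d_{y_i}}$, and (for $s_i^{k+1}$) $f_i(x^k,y_i^k)$, with conditional variances bounded by $\sigma_{f,1}^2,\sigma_{f,2}^2,\sigma_{g,1}^2,\sigma_{g,2}^2,\sigma_{g,2}^2,\sigma_{f,0}^2$ respectively. The constants $c_1,c_2,c_3,\tau_x,\tau_\lambda$ may depend on $n$, $\mu_\lambda$ and the problem constants but not on $K$. The $\mathcal O$ notation hides constants that do not depend on $n,\mu_\lambda,K,\epsilon$. *)

(* Defs.v *)
(* Vectors of R^d are row vectors 'rV[R]_d, and a point (x, y) of R^dx * R^dy is
   the concatenation row_mx x y. *)
From HB Require Import structures.
From mathcomp Require Import all_boot all_order all_algebra.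
From mathcomp Require Import all_classical all_reals all_analysis.

Set Implicit Arguments.
Unset Strict Implicit.
Unset Printing Implicit Defensive.

Import Order.TTheory GRing.Theory Num.Theory.
Import numFieldNormedType.Exports.

Local Open Scope classical_set_scope.
Local Open Scope ring_scope.

(* The library norm `|v| on 'rV[R]_d is the sup norm; it is only used here
   through the topology it induces (differentiability, compactness). *)
Definition enorm (R : realType) d (v : 'rV[R]_d) : R :=
  Num.sqrt (\sum_(j < d) v 0 j ^+ 2).

(* The matrix-vector product A v, for a row vector v. *)
Definition mxapp (R : realType) m n (A : 'M[R]_(m, n)) (v : 'rV[R]_n) :
  'rV[R]_m := v *m A^T.

Definition opnorm (R : realType) m n (A : 'M[R]_(m, n)) : R :=
  sup [set enorm (mxapp A v) | v in [set v : 'rV[R]_n | enorm v <= 1]].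

Definition grad (R : realType) d (h : 'rV[R]_d -> R) (p : 'rV[R]_d) :
  'rV[R]_d := \row_j 'D_(delta_mx 0 j) h p.

(* The entry (i, j) is the derivative along e_i of the j-th partial
   derivative. *)
Definition hess (R : realType) d (h : 'rV[R]_d -> R) (p : 'rV[R]_d) :
  'M[R]_d := 'J (grad h) p.

Definition elipschitz (R : realType) d e (L : R)
    (h : 'rV[R]_d -> 'rV[R]_e) : Prop :=
  forall p q, enorm (h p - h q) <= L * enorm (p - q).

Definition strongly_convex (R : realType) d (mu : R) (h : 'rV[R]_d -> R) :
  Prop := forall (y y' : 'rV[R]_d) (t : R), 0 <= t <= 1 ->
    h (t *: y + (1 - t) *: y') <=
    t * h y + (1 - t) * h y' - mu / 2 * (t * (1 - t)) * enorm (y - y') ^+ 2.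

Definition argmin (R : realType) d (h : 'rV[R]_d -> R) : 'rV[R]_d :=
  xget 0 [set y | forall y', h y <= h y'].

Definition proj (R : realType) d (X : set 'rV[R]_d) (x : 'rV[R]_d) :
  'rV[R]_d :=
  xget x [set p | X p /\ forall q, X q -> enorm (x - p) <= enorm (x - q)].

Definition simplex (R : realType) n : set 'rV[R]_n :=
  [set l | (forall i, 0 <= l 0 i) /\ \sum_(i < n) l 0 i = 1].
Arguments simplex R n : clear implicits.

Definition unif (R : realType) n : 'rV[R]_n := const_mx n%:R^-1.

Record constants (R : realType) := Constants {
  L_df : R;  L_dg : R;  L_d2g : R;
  mu_g : R;
  L_f : R;
  b_Phi : R;  L_Phi : R;
  sigma_f0 : R;  sigma_f1 : R;  sigma_f2 : R;
  sigma_g1 : R;  sigma_g2 : R }.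

Definition valid_constants (R : realType) (c : constants R) : Prop :=
  [/\ 0 <= L_df c, 0 <= L_dg c, 0 <= L_d2g c & 0 < mu_g c] /\
  [/\ 0 <= L_f c, 0 <= b_Phi c & 0 <= L_Phi c] /\
  [/\ 0 <= sigma_f0 c, 0 <= sigma_f1 c, 0 <= sigma_f2 c,
      0 <= sigma_g1 c & 0 <= sigma_g2 c].

Record bilevel (R : realType) (n : nat) := Bilevel {
  dimx : nat;
  dimy : 'I_n -> nat;
  upper : forall i, 'rV[R]_(dimx + dimy i) -> R;
  lower : forall i, 'rV[R]_(dimx + dimy i) -> R;
  feas : set 'rV[R]_dimx }.
Arguments upper {R n} b i p : rename.
Arguments lower {R n} b i p : rename.
Arguments feas {R n} b _ : rename.

Section Bilevel.
Context {R : realType} {n : nat} (pb : bilevel R n).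

Definition ystar (i : 'I_n) (x : 'rV[R]_(dimx pb)) : 'rV[R]_(dimy pb i) :=
  argmin (fun y => lower pb i (row_mx x y)).

Definition Phi (i : 'I_n) (x : 'rV[R]_(dimx pb)) : R :=
  upper pb i (row_mx x (ystar i x)).

Definition upper_d1 i x (y : 'rV[R]_(dimy pb i)) : 'rV[R]_(dimx pb) :=
  lsubmx (grad (upper pb i) (row_mx x y)).

Definition upper_d2 i x (y : 'rV[R]_(dimy pb i)) : 'rV[R]_(dimy pb i) :=
  rsubmx (grad (upper pb i) (row_mx x y)).

Definition lower_d2 i x (y : 'rV[R]_(dimy pb i)) : 'rV[R]_(dimy pb i) :=
  rsubmx (grad (lower pb i) (row_mx x y)).

Definition lower_d22 i x (y : 'rV[R]_(dimy pb i)) : 'M[R]_(dimy pb i) :=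
  drsubmx (hess (lower pb i) (row_mx x y)).

Definition lower_d12 i x (y : 'rV[R]_(dimy pb i)) :
  'M[R]_(dimx pb, dimy pb i) := ursubmx (hess (lower pb i) (row_mx x y)).

Definition Phi_reg (mu : R) (x : 'rV[R]_(dimx pb)) (l : 'rV[R]_n) : R :=
  \sum_(i < n) l 0 i * Phi i x - mu / 2 * enorm (l - unif R n) ^+ 2.

Definition Psi_reg (mu : R) (x : 'rV[R]_(dimx pb)) : R :=
  sup [set Phi_reg mu x l | l in simplex R n].

Definition grad_map (mu tau : R) (x : 'rV[R]_(dimx pb)) : 'rV[R]_(dimx pb) :=
  tau^-1 *: (x - proj (feas pb) (x - tau *: grad (Psi_reg mu) x)).

Definition feasible_set_ok : Prop :=
  feas pb = setT \/
  [/\ feas pb !=set0,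
      convex_set (feas pb : set (convex_lmodType 'rV[R]_(dimx pb))) &
      compact (feas pb)].

Record bilevel_assumptions (c : constants R) : Prop := BilevelAssumptions {
  upper_diff : forall i p, differentiable (upper pb i) p;
  lower_diff : forall i p, differentiable (lower pb i) p;
  lower_diff2 : forall i p, differentiable (grad (lower pb i)) p;
  upper_grad_lip : forall i, elipschitz (L_df c) (grad (upper pb i));
  lower_grad_lip : forall i, elipschitz (L_dg c) (grad (lower pb i));
  lower_hess_lip : forall i p q,
    opnorm (hess (lower pb i) p - hess (lower pb i) q)
      <= L_d2g c * enorm (p - q);
  lower_strongly_convex : forall i x,
    strongly_convex (mu_g c) (fun y => lower pb i (row_mx x y));
  upper_grad2_bound : forall i x, feas pb x ->
    enorm (upper_d2 x (ystar i x)) <= L_f c;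
  Phi_bound : forall i x, `|Phi i x| <= b_Phi c;
  Phi_grad_bound : forall i x, enorm (grad (Phi i) x) <= L_Phi c;
  upper_lip2 : forall i x (y y' : 'rV[R]_(dimy pb i)),
    `|upper pb i (row_mx x y) - upper pb i (row_mx x y')|
      <= L_f c * enorm (y - y') }.

End Bilevel.

(* The nat argument is the superscript; the oracle answers used at iteration k
   have superscript k.+1. *)
Record execution (R : realType) (n : nat) (pb : bilevel R n) (T : Type) :=
  Execution {
  it_x : nat -> T -> 'rV[R]_(dimx pb);
  it_l : nat -> T -> 'rV[R]_n;
  it_y : forall i : 'I_n, nat -> T -> 'rV[R]_(dimy pb i);
  it_z : forall i : 'I_n, nat -> T -> 'rV[R]_(dimy pb i);
  it_hx : nat -> T -> 'rV[R]_(dimx pb);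
  it_hl : nat -> T -> 'rV[R]_n;
  or_ux : 'I_n -> nat -> T -> 'rV[R]_(dimx pb);
  or_uy : forall i : 'I_n, nat -> T -> 'rV[R]_(dimy pb i);
  or_v : forall i : 'I_n, nat -> T -> 'rV[R]_(dimy pb i);
  or_H : forall i : 'I_n, nat -> T -> 'M[R]_(dimy pb i);
  or_J : forall i : 'I_n, nat -> T -> 'M[R]_(dimx pb, dimy pb i);
  or_s : nat -> T -> 'rV[R]_n }.

Section Algorithm.
Context {R : realType} {n : nat} {pb : bilevel R n} {T : Type}.
Variable e : execution pb T.

Record morma_soba_init (x0 : 'rV[R]_(dimx pb)) (l0 : 'rV[R]_n)
    (y0 z0 : forall i, 'rV[R]_(dimy pb i)) : Prop := MormaSobaInit {
  x0_feas : feas pb x0;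
  l0_simplex : simplex R n l0;
  init_x : forall w, it_x e 0 w = x0;
  init_l : forall w, it_l e 0 w = l0;
  init_y : forall i w, it_y e i 0 w = y0 i;
  init_z : forall i w, it_z e i 0 w = z0 i;
  init_hx : forall w, it_hx e 0 w = 0;
  init_hl : forall w, it_hl e 0 w = 0 }.

Record morma_soba_step (mu tau_x tau_l : R) (alpha beta gamma theta : nat -> R)
    (k : nat) (w : T) : Prop := MormaSobaStep {
  step_x : it_x e k.+1 w = it_x e k w + alpha k *:
    (proj (feas pb) (it_x e k w - tau_x *: it_hx e k w) - it_x e k w);
  step_l : it_l e k.+1 w = it_l e k w + alpha k *:
    (proj (simplex R n) (it_l e k w + tau_l *: it_hl e k w) - it_l e k w);
  step_y : forall i, it_y e i k.+1 w = it_y e i k w - beta k *: or_v e i k.+1 w;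
  step_z : forall i, it_z e i k.+1 w = it_z e i k w - gamma k *:
    (mxapp (or_H e i k.+1 w) (it_z e i k w) - or_uy e i k.+1 w);
  step_hx : it_hx e k.+1 w = (1 - theta k) *: it_hx e k w + theta k *:
    (\sum_(i < n) it_l e k w 0 i *:
       (or_ux e i k.+1 w - mxapp (or_J e i k.+1 w) (it_z e i k w)));
  step_hl : it_hl e k.+1 w = (1 - theta k) *: it_hl e k w + theta k *:
    (or_s e k.+1 w - mu *: (it_l e k w - unif R n)) }.

(* One sample for each of u_x, u_y, v, H, J and s per objective and
   iteration; x^K requires the iterations 0, ..., K-1. *)
Definition oracle_calls (m K : nat) : nat :=
  (\sum_(0 <= k < K) \sum_(i < m) 6)%N.

End Algorithm.

Definition sigma_mx (R : realType) (T : Type) m n (X : T -> 'M[R]_(m, n)) :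
  set (set T) :=
  <<s [set A | exists i j,
         preimage_set_system setT (fun w => X w i j) measurable A] >>.

Section Conditional.
Context {d : measure_display} {T : measurableType d} {R : realType}.
Variable P : probability T R.
Implicit Types (G : set (set T)) (X Y Z : T -> R).

(* Y is a version of E[X | G], for a sub-sigma-algebra G. *)
Definition is_cond_exp G X Y : Prop :=
  [/\ P.-integrable setT (EFin \o X),
      P.-integrable setT (EFin \o Y),
      preimage_set_system setT Y measurable `<=` G &
      forall A, G A ->
        (\int[P]_(w in A) (Y w)%:E = \int[P]_(w in A) (X w)%:E)%E].

Definition cond_unbiased G m n (X M : T -> 'M[R]_(m, n)) : Prop :=
  forall i j, is_cond_exp G (fun w => X w i j) (fun w => M w i j).

(* E[Z^2 | G] <= s^2 almost surely; with Z the norm of X - E[X | G] this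
   bounds the conditional variance of X. *)
Definition cond_sq_le G Z (s : R) : Prop :=
  exists V : T -> R, is_cond_exp G (fun w => Z w ^+ 2) V /\
    {ae P, forall w, V w <= s ^+ 2}.

(* Choosing A j = setT shows that the full product rule contains the rule for
   every subfamily. *)
Definition cond_indep G (I : finType) (S : I -> set (set T)) : Prop :=
  forall A : I -> set T, (forall j, S j (A j)) ->
  exists p : I -> T -> R, (forall j, is_cond_exp G \1_(A j) (p j)) /\
    is_cond_exp G \1_(\bigcap_j A j) (fun w => \prod_j p j w).

Context {n : nat} {pb : bilevel R n}.
Variable e : execution pb T.

Definition history (k : nat) : set (set T) :=
  <<s \bigcup_(j in [set j | (j <= k)%N])
        (sigma_mx (it_x e j) `|` sigma_mx (it_l e j) `|`
         (\bigcup_i (sigma_mx (it_y e i j) `|` sigma_mx (it_z e i j))) `|`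
         sigma_mx (it_hx e j) `|` sigma_mx (it_hl e j)) >>.

(* There are 5n + 1 oracle answers: s^{k+1} counts once, as a vector.  The
   default set0 of nth is never reached. *)
Definition oracle_sigma (k : nat) (j : ('I_n * 'I_5) + unit) : set (set T) :=
  match j with
  | inl (i, c) => nth set0 [:: sigma_mx (or_ux e i k.+1);
                               sigma_mx (or_uy e i k.+1);
                               sigma_mx (or_v e i k.+1);
                               sigma_mx (or_H e i k.+1);
                               sigma_mx (or_J e i k.+1)] c
  | inr _ => sigma_mx (or_s e k.+1)
  end.

Record oracle_assumptions (c : constants R) (k : nat) : Prop :=
  OracleAssumptions {
  oracle_measurable : forall j, oracle_sigma k j `<=` measurable;
  oracle_indep : cond_indep (history k) (oracle_sigma k);
  ux_unbiased : forall i, cond_unbiased (history k) (or_ux e i k.+1)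
    (fun w => upper_d1 (it_x e k w) (it_y e i k w));
  uy_unbiased : forall i, cond_unbiased (history k) (or_uy e i k.+1)
    (fun w => upper_d2 (it_x e k w) (it_y e i k w));
  v_unbiased : forall i, cond_unbiased (history k) (or_v e i k.+1)
    (fun w => lower_d2 (it_x e k w) (it_y e i k w));
  H_unbiased : forall i, cond_unbiased (history k) (or_H e i k.+1)
    (fun w => lower_d22 (it_x e k w) (it_y e i k w));
  J_unbiased : forall i, cond_unbiased (history k) (or_J e i k.+1)
    (fun w => lower_d12 (it_x e k w) (it_y e i k w));
  s_unbiased : cond_unbiased (history k) (or_s e k.+1)
    (fun w => \row_i upper pb i (row_mx (it_x e k w) (it_y e i k w)));
  ux_var : forall i, cond_sq_le (history k)
    (fun w => enorm (or_ux e i k.+1 w - upper_d1 (it_x e k w) (it_y e i k w)))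
    (sigma_f1 c);
  uy_var : forall i, cond_sq_le (history k)
    (fun w => enorm (or_uy e i k.+1 w - upper_d2 (it_x e k w) (it_y e i k w)))
    (sigma_f2 c);
  v_var : forall i, cond_sq_le (history k)
    (fun w => enorm (or_v e i k.+1 w - lower_d2 (it_x e k w) (it_y e i k w)))
    (sigma_g1 c);
  H_var : forall i, cond_sq_le (history k)
    (fun w => opnorm (or_H e i k.+1 w - lower_d22 (it_x e k w) (it_y e i k w)))
    (sigma_g2 c);
  J_var : forall i, cond_sq_le (history k)
    (fun w => opnorm (or_J e i k.+1 w - lower_d12 (it_x e k w) (it_y e i k w)))
    (sigma_g2 c);
  s_var : forall i, cond_sq_le (history k)
    (fun w => or_s e k.+1 w 0 i -
              upper pb i (row_mx (it_x e k w) (it_y e i k w)))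
    (sigma_f0 c) }.

(* The start is deterministic, with |y_i^0 - y_i^*(x^0)| <= D and |z_i^0| <= D
   (every start satisfies this for some D). *)
Record valid_execution (c : constants R) (D mu tau_x tau_l : R)
    (alpha beta gamma theta : nat -> R) : Prop := ValidExecution {
  exec_problem : feasible_set_ok pb /\ bilevel_assumptions pb c;
  exec_init : exists x0 l0 y0 z0, morma_soba_init e x0 l0 y0 z0 /\
    forall i, enorm (y0 i - ystar i x0) <= D /\ enorm (z0 i) <= D;
  exec_pos : forall k, [/\ 0 < alpha k, 0 < beta k, 0 < gamma k & 0 < theta k];
  exec_step : forall k w,
    morma_soba_step e mu tau_x tau_l alpha beta gamma theta k w;
  exec_oracle : forall k, oracle_assumptions c k }.

Definition uniform_index (K : nat) (r : T -> nat) : Prop :=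
  forall k, let E := [set w | r w = k] in
  [/\ measurable E,
      P E = (if (1 <= k <= K)%N then (K%:R^-1)%:E else 0%E) &
      forall A, history K A -> P (A `&` E) = (P A * P E)%E].

End Conditional.

(* Main.v *)
Require Import Defs.
From HB Require Import structures.
From mathcomp Require Import all_boot all_order all_algebra.
From mathcomp Require Import all_classical all_reals all_analysis.
From mathcomp Require Import measurable_realfun ring lra.

Set Implicit Arguments.
Unset Strict Implicit.
Unset Printing Implicit Defensive.

Import Order.TTheory GRing.Theory Num.Theory.
Import numFieldNormedType.Exports.

Local Open Scope classical_set_scope.
Local Open Scope ring_scope.

(* [all_analysis] also exports a constant [proj]. *)
Local Notation proj := Defs.proj.

(* A Lyapunov argument.  The objective Psi has a quadratic upper bound, with
   gradient at x the lstar(x)-mixture of the hypergradients nabla Phi_i(x); the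
   latter follow from the optimality condition of ystar(x) and the adjoint state
   zstar(x), which solves nabla_22 g z = nabla_2 f.  The squared errors of y, z,
   h_x, h_lambda and lambda, relative to ystar, zstar, the two gradients of Phi_mu
   and lstar, contract at rate c alpha, up to noise of order alpha^2, errors of the
   other sequences, and the squared length of the step of x, which the decrease of
   Psi absorbs.  With weights of order at most n / mu_lambda^2 and tau_x of order
   mu_lambda / n, the weighted sum of Psi and of these errors decreases by a
   multiple of alpha times the squared gradient map, up to alpha^2; telescoping
   gives the rate, and averaging over a random index independent of the history
   gives the complexity. *)

(** * Euclidean vectors and matrices *)

(** The powers of [n] are set by the averaging rate [s]. The gradients tracked by [h_x] and
    [h_lambda] move at each iteration by a squared amount of order at most [n alpha^2] times the
    squared steps of [x] and [lambda], and Young's inequality divides this by [s]. With [beta =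
    gamma = theta = s = 8 M sqrt n alpha] the quotient is a small fraction of [s], which the
    contraction absorbs; the noise, of order [s^2 n], then yields [n^2] in the rate. With
    [tau_lambda = 1 / mu_lambda] an exact [h_lambda] would project [lambda] directly onto [lstar],
    so the error of [lambda] is driven by that of [h_lambda] alone.

    Integrability is an obstacle of its own: the oracles only have conditional second moments, and
    [z] multiplies matrix noise without being bounded. Square integrability is therefore carried by
    induction along the run, and history-measurable weights are pulled out of conditional moments by
    truncation.

    One constant [M] of the problem dominates every coefficient of the recursions, so that the
    dependence on [n] and [mu_lambda] stays explicit. *)

Definition dot (R : realType) d (u v : 'rV[R]_d) : R :=
  \sum_(j < d) u 0 j * v 0 j.

Section Euclid.
Context {R : realType}.

Section Dot.
Context {d : nat}.
Implicit Types (u v w : 'rV[R]_d) (a b : R).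

Lemma dotC u v : dot u v = dot v u.
Proof. by apply: eq_bigr => j _; rewrite mulrC. Qed.

Lemma dotDl u v w : dot (u + v) w = dot u w + dot v w.
Proof. by rewrite -big_split; apply: eq_bigr => j _; rewrite mxE mulrDl. Qed.

Lemma dotZl a u w : dot (a *: u) w = a * dot u w.
Proof. by rewrite mulr_sumr; apply: eq_bigr => j _; rewrite mxE mulrA. Qed.

Lemma dotDr u v w : dot w (u + v) = dot w u + dot w v.
Proof. by rewrite !(dotC w) dotDl. Qed.

Lemma dotZr a u w : dot w (a *: u) = a * dot w u.
Proof. by rewrite !(dotC w) dotZl. Qed.

Lemma dotNl u w : dot (- u) w = - dot u w.
Proof. by rewrite -scaleN1r dotZl mulN1r. Qed.

Lemma dotNr u w : dot w (- u) = - dot w u.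
Proof. by rewrite !(dotC w) dotNl. Qed.

Lemma dotBl u v w : dot (u - v) w = dot u w - dot v w.
Proof. by rewrite dotDl dotNl. Qed.

Lemma dotBr u v w : dot w (u - v) = dot w u - dot w v.
Proof. by rewrite dotDr dotNr. Qed.

Lemma dot0l w : dot 0 w = 0.
Proof. by rewrite -(scale0r (0 : 'rV_d)) dotZl mul0r. Qed.

Lemma dot0r w : dot w 0 = 0.
Proof. by rewrite dotC dot0l. Qed.

Definition dotE := (dotDl, dotDr, dotNl, dotNr, dotZl, dotZr, dot0l, dot0r).

Lemma dot_suml (I : Type) (r : seq I) (P : pred I) (F : I -> 'rV[R]_d) w :
  dot (\sum_(i <- r | P i) F i) w = \sum_(i <- r | P i) dot (F i) w.
Proof. by elim/big_rec2: _ => [|i a b _ <-]; rewrite ?dotDl ?dot0l. Qed.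

Lemma dot_ge0 u : 0 <= dot u u.
Proof. by apply: sumr_ge0 => j _; rewrite -expr2 sqr_ge0. Qed.

Lemma dot_delta u j : dot u (delta_mx 0 j) = u 0 j.
Proof.
rewrite /dot (bigD1 j)//= mxE !eqxx mulr1 big1 ?addr0// => i ij.
by rewrite mxE (negbTE ij) andbF mulr0.
Qed.

Lemma dot_eq0 u : dot u u = 0 -> u = 0.
Proof.
move/eqP; rewrite psumr_eq0 => [/allP h|j _]; last by rewrite -expr2 sqr_ge0.
apply/rowP => j; rewrite mxE; apply/eqP.
by have := h j (mem_index_enum _); rewrite /= mulf_eq0 orbb.
Qed.

Lemma enorm_sqr u : enorm u ^+ 2 = dot u u.
Proof.
rewrite /enorm sqr_sqrtr; last by apply: sumr_ge0 => j _; rewrite sqr_ge0.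
by apply: eq_bigr => j _; rewrite expr2.
Qed.

Lemma enorm_ge0 u : 0 <= enorm u.
Proof. exact: sqrtr_ge0. Qed.

Lemma enorm0 : enorm (0 : 'rV[R]_d) = 0.
Proof. by apply/eqP; rewrite -(@sqrf_eq0 R) enorm_sqr dot0l. Qed.

Lemma enorm_eq0 u : enorm u = 0 -> u = 0.
Proof. by move=> h; apply: dot_eq0; rewrite -enorm_sqr h expr0n. Qed.

Lemma enormZ a u : enorm (a *: u) = `|a| * enorm u.
Proof.
apply/eqP; rewrite -(@eqrXn2 _ 2) ?mulr_ge0 ?enorm_ge0//.
by rewrite exprMn !enorm_sqr dotZl dotZr -normrX ger0_norm ?sqr_ge0// expr2 mulrA.
Qed.

Lemma enormN u : enorm (- u) = enorm u.
Proof. by rewrite -scaleN1r enormZ normrN1 mul1r. Qed.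

Lemma enormBC u v : enorm (u - v) = enorm (v - u).
Proof. by rewrite -enormN opprB. Qed.

Lemma dot_sqr_le u v : dot u v ^+ 2 <= dot u u * dot v v.
Proof.
have [v0|v0] := eqVneq (dot v v) 0.
  by rewrite (dot_eq0 v0) !dot0r mulr0 expr0n.
have vp : 0 < dot v v by rewrite lt_def v0 dot_ge0.
have := dot_ge0 (dot v v *: u - dot u v *: v).
rewrite !dotE (dotC v u) => h.
have : 0 <= dot v v * (dot u u * dot v v - dot u v ^+ 2) by lra.
by rewrite pmulr_rge0// subr_ge0.
Qed.

Lemma cauchy_schwarz u v : `|dot u v| <= enorm u * enorm v.
Proof.
rewrite -(@ler_pXn2r _ 2) ?nnegrE ?mulr_ge0 ?enorm_ge0//.
by rewrite exprMn !enorm_sqr -normrX ger0_norm ?sqr_ge0// dot_sqr_le.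
Qed.

Lemma dot_le u v : dot u v <= enorm u * enorm v.
Proof. exact: le_trans (ler_norm _) (cauchy_schwarz u v). Qed.

Lemma enorm_sqrD u v :
  enorm (u + v) ^+ 2 = enorm u ^+ 2 + 2 * dot u v + enorm v ^+ 2.
Proof. by rewrite !enorm_sqr !dotE (dotC v u); ring. Qed.

Lemma enorm_sqrB u v :
  enorm (u - v) ^+ 2 = enorm u ^+ 2 - 2 * dot u v + enorm v ^+ 2.
Proof. by rewrite !enorm_sqr !dotE (dotC v u); ring. Qed.

Lemma enormD u v : enorm (u + v) <= enorm u + enorm v.
Proof.
rewrite -(@ler_pXn2r _ 2) ?nnegrE ?addr_ge0 ?enorm_ge0//.
by rewrite enorm_sqrD; have := dot_le u v; lra.
Qed.

Lemma enormB u v : enorm (u - v) <= enorm u + enorm v.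
Proof. by rewrite -(enormN v) enormD. Qed.

Lemma enormB_trans w u v : enorm (u - v) <= enorm (u - w) + enorm (w - v).
Proof. by rewrite -[u - v](subrKA w) enormD. Qed.

Lemma enorm_sum (I : Type) (r : seq I) (P : pred I) (F : I -> 'rV[R]_d) :
  enorm (\sum_(i <- r | P i) F i) <= \sum_(i <- r | P i) enorm (F i).
Proof.
elim/big_ind2: _ => [|x a y b xa yb|//]; first by rewrite enorm0.
exact: le_trans (enormD _ _) (lerD xa yb).
Qed.

Lemma dot_young e u v : 0 < e ->
  2 * dot u v <= e * enorm u ^+ 2 + e^-1 * enorm v ^+ 2.
Proof.
move=> e0; have := sqr_ge0 (enorm (e *: u - v)).
rewrite enorm_sqrB dotZl enormZ exprMn -normrX ger0_norm ?sqr_ge0// => h.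
have : e * (2 * dot u v) <= e * (e * enorm u ^+ 2 + e^-1 * enorm v ^+ 2).
  by rewrite mulrDr [e * (e^-1 * _)]mulrA divff ?gt_eqF// ; lra.
by rewrite ler_pM2l.
Qed.

Lemma enorm_sqr_young e u v : 0 < e ->
  enorm (u + v) ^+ 2 <= (1 + e) * enorm u ^+ 2 + (1 + e^-1) * enorm v ^+ 2.
Proof. by move=> e0; rewrite enorm_sqrD; have := dot_young u v e0; lra. Qed.

Lemma enorm_sqrD_le u v :
  enorm (u + v) ^+ 2 <= 2 * enorm u ^+ 2 + 2 * enorm v ^+ 2.
Proof. by have := enorm_sqr_young u v ltr01; rewrite invr1. Qed.

Lemma enorm_sqr_convex t u v : 0 <= t <= 1 ->
  enorm ((1 - t) *: u + t *: v) ^+ 2 <=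
    (1 - t) * enorm u ^+ 2 + t * enorm v ^+ 2.
Proof.
move=> /andP[t0 t1]; have := sqr_ge0 (enorm (u - v)).
rewrite enorm_sqrB => h.
rewrite enorm_sqrD dotZl dotZr !enormZ !exprMn !real_normK ?num_real//.
by have : 0 <= t * (1 - t) * (enorm u ^+ 2 - 2 * dot u v + enorm v ^+ 2);
  [rewrite mulr_ge0 ?mulr_ge0// subr_ge0 | lra].
Qed.

Lemma enorm_coord u j : `|u 0 j| <= enorm u.
Proof.
rewrite -(@ler_pXn2r _ 2) ?nnegrE ?enorm_ge0// -normrX ger0_norm ?sqr_ge0//.
rewrite enorm_sqr /dot (bigD1 j)//= -expr2 lerDl.
by apply: sumr_ge0 => i _; rewrite -expr2 sqr_ge0.
Qed.

Lemma enorm_sqr_sum u : enorm u ^+ 2 = \sum_j u 0 j ^+ 2.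
Proof. by rewrite enorm_sqr; apply: eq_bigr => j _; rewrite expr2. Qed.

Lemma enorm_le_sum u : enorm u <= \sum_j `|u 0 j|.
Proof.
have -> : u = \sum_j u 0 j *: delta_mx 0 j by rewrite [LHS]matrix_sum_delta big_ord1.
apply: le_trans (enorm_sum _ _ _) _; apply: ler_sum => j _.
rewrite enormZ summxE (bigD1 j)//= !mxE !eqxx mulr1 big1 => [|i ij].
  have -> : enorm (delta_mx 0 j : 'rV[R]_d) = 1.
    apply/eqP; rewrite -(@eqrXn2 _ 2) ?enorm_ge0// enorm_sqr dot_delta.
    by rewrite mxE !eqxx expr1n.
  by rewrite mulr1 addr0.
by rewrite !mxE (eq_sym j) (negbTE ij) mulr0.
Qed.

Lemma sqr_sum_le (F : 'I_d -> R) :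
  (\sum_j F j) ^+ 2 <= d%:R * \sum_j F j ^+ 2.
Proof.
have := dot_sqr_le (\row_j F j) (const_mx 1).
have -> : dot (\row_j F j) (const_mx 1) = \sum_j F j.
  by apply: eq_bigr => j _; rewrite !mxE mulr1.
have -> : dot (\row_j F j) (\row_j F j) = \sum_j F j ^+ 2.
  by apply: eq_bigr => j _; rewrite !mxE expr2.
have -> : dot (const_mx 1 : 'rV[R]_d) (const_mx 1) = d%:R.
  rewrite /dot (eq_bigr (fun=> 1)) ?sumr_const ?card_ord// => j _.
  by rewrite mxE mulr1.
by rewrite mulrC.
Qed.

(** Jensen's inequality, read off from the nonnegativity of the weighted variance around the mean
    [m]. *)
Lemma enorm_sqr_simplex n (l : 'rV[R]_n) (F : 'I_n -> 'rV[R]_d) :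
  simplex R n l ->
  enorm (\sum_i l 0 i *: F i) ^+ 2 <= \sum_i l 0 i * enorm (F i) ^+ 2.
Proof.
move=> [l0 l1]; set m := \sum_i _.
have : 0 <= \sum_i l 0 i * enorm (F i - m) ^+ 2.
  by apply: sumr_ge0 => i _; rewrite mulr_ge0// sqr_ge0.
have dm : dot m m = \sum_i l 0 i * dot (F i) m.
  by rewrite {1}/m dot_suml; apply: eq_bigr => i _; rewrite dotZl.
have -> : \sum_i l 0 i * enorm (F i - m) ^+ 2 = \sum_i l 0 i * enorm (F i) ^+ 2 -
    2 * dot m m + (\sum_i l 0 i) * dot m m.
  rewrite {1}dm mulr_sumr mulr_suml -sumrB -big_split.
  by apply: eq_bigr => i _; rewrite enorm_sqrB (enorm_sqr m) /=; ring.
by rewrite l1 -(enorm_sqr m); lra.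
Qed.

End Dot.

(** Meant for differences of weights, to which Jensen's inequality does not apply: passing through
    the sum of the [|l 0 i|] costs the factor [n]. *)
Lemma enorm_sum_coord d n (l : 'rV[R]_n) (F : 'I_n -> 'rV[R]_d) M :
  0 <= M -> (forall i, enorm (F i) <= M) ->
  enorm (\sum_i l 0 i *: F i) ^+ 2 <= n%:R * M ^+ 2 * enorm l ^+ 2.
Proof.
move=> M0 FM; have h : enorm (\sum_i l 0 i *: F i) <= \sum_i `|l 0 i| * M.
  apply: le_trans (enorm_sum _ _ _) _; apply: ler_sum => i _.
  by rewrite enormZ ler_wpM2l.
apply: le_trans (_ : (\sum_i `|l 0 i| * M) ^+ 2 <= _).
  rewrite ler_pXn2r ?nnegrE ?enorm_ge0//.
  by apply: sumr_ge0 => i _; rewrite mulr_ge0.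
rewrite -mulr_suml exprMn [leRHS]mulrAC ler_wpM2r ?sqr_ge0//.
apply: le_trans (sqr_sum_le _) _; rewrite enorm_sqr_sum.
by under eq_bigr do rewrite real_normK ?num_real//.
Qed.

Lemma dot_row_mx d1 d2 (a b : 'rV[R]_d1) (u v : 'rV[R]_d2) :
  dot (row_mx a u) (row_mx b v) = dot a b + dot u v.
Proof.
rewrite /dot big_split_ord /=; congr (_ + _).
  by apply: eq_bigr => j _; rewrite !row_mxEl.
by apply: eq_bigr => j _; rewrite !row_mxEr.
Qed.

Lemma enorm_row_mx d1 d2 (a : 'rV[R]_d1) (u : 'rV[R]_d2) :
  enorm (row_mx a u) ^+ 2 = enorm a ^+ 2 + enorm u ^+ 2.
Proof. by rewrite !enorm_sqr dot_row_mx. Qed.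

Lemma enorm_row_mx_le d1 d2 (a : 'rV[R]_d1) (u : 'rV[R]_d2) :
  enorm (row_mx a u) <= enorm a + enorm u.
Proof.
rewrite -(@ler_pXn2r _ 2) ?nnegrE ?addr_ge0 ?enorm_ge0// enorm_row_mx.
by have := mulr_ge0 (enorm_ge0 a) (enorm_ge0 u); lra.
Qed.

Lemma enorm_row_mx0l d1 d2 (u : 'rV[R]_d2) :
  enorm (row_mx (0 : 'rV[R]_d1) u) = enorm u.
Proof.
apply/eqP; rewrite -(@eqrXn2 _ 2) ?enorm_ge0// enorm_row_mx enorm0.
by rewrite expr0n add0r.
Qed.

Lemma enorm_row_mx0r d1 d2 (a : 'rV[R]_d1) :
  enorm (row_mx a (0 : 'rV[R]_d2)) = enorm a.
Proof.
apply/eqP; rewrite -(@eqrXn2 _ 2) ?enorm_ge0// enorm_row_mx enorm0.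
by rewrite expr0n addr0.
Qed.

Lemma enorm_lsubmx d1 d2 (u : 'rV[R]_(d1 + d2)) : enorm (lsubmx u) <= enorm u.
Proof.
rewrite -(@ler_pXn2r _ 2) ?nnegrE ?enorm_ge0// -{2}(hsubmxK u) enorm_row_mx.
by rewrite lerDl sqr_ge0.
Qed.

Lemma enorm_rsubmx d1 d2 (u : 'rV[R]_(d1 + d2)) : enorm (rsubmx u) <= enorm u.
Proof.
rewrite -(@ler_pXn2r _ 2) ?nnegrE ?enorm_ge0// -{2}(hsubmxK u) enorm_row_mx.
by rewrite lerDr sqr_ge0.
Qed.

Section Opnorm.
Context {m n : nat}.
Implicit Types (A B : 'M[R]_(m, n)) (v w : 'rV[R]_n) (u : 'rV[R]_m).

Lemma mxappDr A v w : mxapp A (v + w) = mxapp A v + mxapp A w.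
Proof. exact: mulmxDl. Qed.

Lemma mxappZr A a v : mxapp A (a *: v) = a *: mxapp A v.
Proof. by rewrite /mxapp -scalemxAl. Qed.

Lemma mxappDl A B v : mxapp (A + B) v = mxapp A v + mxapp B v.
Proof. by rewrite /mxapp linearD mulmxDr. Qed.

Lemma mxappNl A v : mxapp (- A) v = - mxapp A v.
Proof. by rewrite /mxapp linearN mulmxN. Qed.

Lemma mxappNr A v : mxapp A (- v) = - mxapp A v.
Proof. by rewrite /mxapp mulNmx. Qed.

Lemma mxappBl A B v : mxapp (A - B) v = mxapp A v - mxapp B v.
Proof. by rewrite mxappDl mxappNl. Qed.

Lemma mxappBr A v w : mxapp A (v - w) = mxapp A v - mxapp A w.
Proof. by rewrite mxappDr mxappNr. Qed.

Lemma mxappE A v i : mxapp A v 0 i = \sum_j v 0 j * A i j.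
Proof. by rewrite mxE; apply: eq_bigr => j _; rewrite mxE. Qed.

Lemma dot_mxapp A v u : dot (mxapp A v) u = dot v (u *m A).
Proof.
rewrite /dot; under eq_bigr do rewrite mxappE mulr_suml.
rewrite exchange_big; apply: eq_bigr => j _ /=.
rewrite mxE mulr_sumr; apply: eq_bigr => i _.
by rewrite -mulrA [A i j * _]mulrC.
Qed.

(** A crude bound, which shows that the set defining [opnorm] is bounded and hence that its [sup] is
    a true supremum. *)
Definition mxsum A : R := \sum_i \sum_j `|A i j|.

Lemma mxapp_le_sum A v : enorm (mxapp A v) <= mxsum A * enorm v.
Proof.
apply: le_trans (enorm_le_sum _) _; rewrite mulr_suml; apply: ler_sum => i _.
rewrite mxappE mulr_suml; apply: le_trans (ler_norm_sum _ _ _) _.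
by apply: ler_sum => j _; rewrite normrM mulrC ler_wpM2l// enorm_coord.
Qed.

Lemma opnorm_has_sup A :
  has_sup [set enorm (mxapp A v) | v in [set v : 'rV[R]_n | enorm v <= 1]].
Proof.
split; first by exists (enorm (mxapp A 0)), 0 => //=; rewrite enorm0.
have A0 : 0 <= mxsum A by apply: sumr_ge0 => i _; apply: sumr_ge0 => j _.
exists (mxsum A) => _ [v /= v1 <-].
by apply: le_trans (mxapp_le_sum A v) _; rewrite ler_piMr.
Qed.

Lemma opnorm_ge0 A : 0 <= opnorm A.
Proof.
apply: le_trans (enorm_ge0 (mxapp A 0)) _.
by apply: sup_upper_bound (opnorm_has_sup A) _ _; exists 0; rewrite //= enorm0.
Qed.

Lemma mxapp_le A v : enorm (mxapp A v) <= opnorm A * enorm v.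
Proof.
have [v0|v0] := eqVneq (enorm v) 0.
  by rewrite v0 (enorm_eq0 v0) /mxapp mul0mx enorm0 mulr0.
have vp : 0 < enorm v by rewrite lt_def v0 enorm_ge0.
rewrite -ler_pdivrMr//.
have -> : enorm (mxapp A v) / enorm v = enorm (mxapp A ((enorm v)^-1 *: v)).
  by rewrite mxappZr enormZ ger0_norm ?invr_ge0 ?enorm_ge0// mulrC.
apply: sup_upper_bound (opnorm_has_sup A) _ _.
exists ((enorm v)^-1 *: v) => //=.
by rewrite enormZ ger0_norm ?invr_ge0 ?enorm_ge0// mulVf.
Qed.

(** A matrix and its transpose have the same norm: [enorm (u *m A) ^+ 2] is the pairing of
    [mxapp A (u *m A)] with [u]. *)
Lemma opnorm_tr_le A u : enorm (u *m A) <= opnorm A * enorm u.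
Proof.
have [v0|v0] := eqVneq (enorm (u *m A)) 0.
  by rewrite v0 mulr_ge0 ?opnorm_ge0 ?enorm_ge0.
have vp : 0 < enorm (u *m A) by rewrite lt_def v0 enorm_ge0.
rewrite -(ler_pM2r vp) -expr2 enorm_sqr -dot_mxapp.
apply: le_trans (dot_le _ _) _; rewrite [leRHS]mulrAC.
by rewrite ler_wpM2r ?enorm_ge0// mxapp_le.
Qed.

Lemma opnorm_coord A i j : `|A i j| <= opnorm A.
Proof.
have -> : A i j = mxapp A (delta_mx 0 j) 0 i.
  rewrite mxappE (bigD1 j)//= mxE !eqxx mul1r big1 ?addr0// => k kj.
  by rewrite mxE (negbTE kj) andbF mul0r.
apply: le_trans (enorm_coord _ _) _; apply: le_trans (mxapp_le _ _) _.
have -> : enorm (delta_mx 0 j : 'rV[R]_n) = 1.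
  apply/eqP; rewrite -(@eqrXn2 _ 2) ?enorm_ge0// enorm_sqr dot_delta.
  by rewrite mxE !eqxx expr1n.
by rewrite mulr1.
Qed.

End Opnorm.
End Euclid.

(** * Smooth and strongly convex functions *)

Section Calculus.
Context {R : realType}.

(** Division by [t] and [t -> 0]. First-order conditions below are all obtained this way, from
    finite increments with a quadratic remainder. *)
Lemma ler_scale_limit (a b C : R) :
  (forall t, 0 < t -> t < 1 -> t * a <= t * b + C * t ^+ 2) -> a <= b.
Proof.
move=> h; apply/ler_addgt0Pr => e e0.
pose t := Num.min (2^-1) (e / (`|C| + 1)).
have C1 : 0 < `|C| + 1 by rewrite ltr_wpDl.
have t0 : 0 < t by rewrite lt_min divr_gt0// invr_gt0 ltr0n.
have t1 : t < 1 by rewrite gt_min; apply/orP; left; lra.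
have te : t * (`|C| + 1) <= e by rewrite -ler_pdivlMr// ge_min lexx orbT.
have := h t t0 t1; rewrite expr2 mulrCA -mulrDr ler_pM2l// => /le_trans; apply.
rewrite lerD2l; apply: le_trans te; rewrite mulrC ler_pM2l//.
by apply: le_trans (ler_norm _) _; rewrite lerDl.
Qed.

Lemma norm_le_enorm d (v : 'rV[R]_d) : `|v| <= enorm v.
Proof.
rewrite [leLHS]/Num.norm /= mx_normrE; apply/bigmax_leP.
split; first exact: enorm_ge0.
by move=> [i j] _ /=; rewrite (ord1 i) enorm_coord.
Qed.

Lemma enorm_le_norm d (v : 'rV[R]_d) : enorm v <= d%:R * `|v|.
Proof.
apply: le_trans (enorm_le_sum v) _.
have -> : d%:R * `|v| = \sum_(j < d) `|v|.
  by rewrite sumr_const card_ord mulr_natl.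
apply: ler_sum => j _.
rewrite [leRHS]/Num.norm /= mx_normrE; apply/bigmax_geP; right.
by exists (ord0, j).
Qed.

Lemma lipschitz_continuous d (f : 'rV[R]_d -> R) (L : R) :
  (forall p q, `|f p - f q| <= L * enorm (p - q)) -> continuous f.
Proof.
move=> h p; apply/(@cvgrPdist_lt _ _ _ (nbhs p)) => e e0.
have M0 : 0 < `|L| * d%:R + 1 by rewrite ltr_wpDl// mulr_ge0.
have := nbhsx_ballx p (e / (`|L| * d%:R + 1)) (divr_gt0 e0 M0).
apply: filterS => q; rewrite -ball_normE /= ltr_pdivlMr// => pq.
apply: le_lt_trans pq; apply: le_trans (h p q) _.
apply: le_trans (_ : `|L| * enorm (p - q) <= _).
  by rewrite ler_wpM2r ?enorm_ge0// ler_norm.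
apply: le_trans (_ : `|L| * (d%:R * `|p - q|) <= _).
  by rewrite ler_wpM2l// enorm_le_norm.
by rewrite mulrA mulrDr mulr1 [leRHS]addrC mulrC lerDr.
Qed.

Lemma enorm_distl d (u v : 'rV[R]_d) : `|enorm u - enorm v| <= enorm (u - v).
Proof.
rewrite ler_norml; apply/andP; split.
  by have := enormD (v - u) u; rewrite subrK enormBC; lra.
by have := enormD (u - v) v; rewrite subrK; lra.
Qed.

Lemma enorm_continuous d : continuous (@enorm R d).
Proof.
by apply: (@lipschitz_continuous _ _ 1) => p q; rewrite mul1r enorm_distl.
Qed.

Lemma dot_continuous d (w : 'rV[R]_d) : continuous (dot w).
Proof.
apply: (@lipschitz_continuous _ _ (enorm w)) => p q.
by rewrite -dotBr cauchy_schwarz.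
Qed.

Lemma elipschitz_coord_continuous d e (G : 'rV[R]_d -> 'rV[R]_e) L j :
  elipschitz L G -> continuous (fun p => G p 0 j).
Proof.
move=> h; apply: (@lipschitz_continuous _ _ L) => p q.
by apply: le_trans (h p q); have := enorm_coord (G p - G q) j; rewrite !mxE.
Qed.

Lemma diff_dot d (f : 'rV[R]_d -> R) p v : differentiable f p ->
  'd f p v = dot (grad f p) v.
Proof.
move=> df; rewrite [v in LHS]matrix_sum_delta big_ord1 linear_sum.
by apply: eq_bigr => j _; rewrite linearZ mxE deriveE// mulrC.
Qed.

Lemma is_derive_line d (f : 'rV[R]_d -> R) p v (t : R) :
  differentiable f (p + t *: v) ->
  is_derive t 1 (fun s => f (p + s *: v)) (dot (grad f (p + t *: v)) v).
Proof.
move=> df; have dv := deriveE v df.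
have E : (fun h => h^-1 *: (f (p + (h *: 1 + t) *: v) - f (p + t *: v))) =
  (fun h => h^-1 *: (f (h *: v + (p + t *: v)) - f (p + t *: v))).
  apply/funext => h; congr (_ *: (f _ - _)).
  by rewrite [h *: 1]mulr1 scalerDl addrCA.
split; first by rewrite /derivable /= E; exact: diff_derivable.
by rewrite /derive /= E -diff_dot// -dv.
Qed.

Lemma is_derive_line_dot d e (G : 'rV[R]_d -> 'rV[R]_e) w p v (t : R) :
  differentiable G (p + t *: v) ->
  is_derive t 1 (fun s => dot w (G (p + s *: v)))
    (dot w (v *m 'J G (p + t *: v))).
Proof.
move=> df; have dv := deriveEjacobian v df.
have dG : derivable G (p + t *: v) v by exact: diff_derivable.
have E : (fun h => h^-1 *:
    (dot w (G (p + (h *: 1 + t) *: v)) - dot w (G (p + t *: v)))) =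
  (fun h => dot w (h^-1 *: (G (h *: v + (p + t *: v)) - G (p + t *: v)))).
  apply/funext => h; rewrite dotZr dotBr [RHS]/=; congr (_ * (dot w (G _) - _)).
  by rewrite [h *: 1]mulr1 scalerDl addrCA.
have C : (fun h => dot w (h^-1 *: (G (h *: v + (p + t *: v)) - G (p + t *: v))))
    @ 0^' --> dot w ('D_v G (p + t *: v)).
  by apply: continuous_cvg; [exact: dot_continuous | exact: dG].
split; first by rewrite /derivable /= E; apply/cvg_ex; eexists; exact: C.
by rewrite /derive /= E -dv; exact: cvg_lim C.
Qed.

Lemma MVT01 (f df : R -> R) : (forall t, is_derive t (1 : R) f (df t)) ->
  exists t, 0 <= t <= 1 /\ f 1 - f 0 = df t.
Proof.
move=> h; have cf : {within `[0, 1], continuous f}.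
  apply: continuous_subspaceT => x.
  by apply: differentiable_continuous; apply/derivable1_diffP; exact: ex_derive.
have [t] := MVT_segment ler01 (fun x _ => h x) cf.
by rewrite subr0 mulr1 in_itv /= => t01 ->; exists t.
Qed.

Lemma scale_sub_norm d (p v : 'rV[R]_d) t : 0 <= t <= 1 ->
  enorm (p + t *: v - p) <= enorm v.
Proof.
move=> /andP[t0 t1]; rewrite addrAC subrr add0r enormZ ger0_norm//.
by rewrite ler_piMl// enorm_ge0.
Qed.

(** The mean value theorem replaces the integral of the gradient along the segment, at the price of
    [L] instead of [L / 2]. *)
Lemma first_order_bound d (f : 'rV[R]_d -> R) L :
  (forall p, differentiable f p) -> elipschitz L (grad f) -> 0 <= L ->
  forall p v, `|f (p + v) - f p - dot (grad f p) v| <= L * enorm v ^+ 2.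
Proof.
move=> df lip L0 p v.
have [t [t01]] := MVT01 (fun t => is_derive_line (df (p + t *: v))).
rewrite scale1r scale0r addr0 => ->; rewrite -dotBl.
apply: le_trans (cauchy_schwarz _ _) _; rewrite expr2 mulrA.
rewrite ler_wpM2r ?enorm_ge0//; apply: le_trans (lip _ _) _.
by rewrite ler_wpM2l// scale_sub_norm.
Qed.

(** The remainder is tested against a fixed [w], which makes the function on the segment real-valued
    and the mean value theorem applicable. *)
Lemma first_order_bound_dot d e (G : 'rV[R]_d -> 'rV[R]_e) L :
  (forall p, differentiable G p) ->
  (forall p q, opnorm ('J G p - 'J G q) <= L * enorm (p - q)) -> 0 <= L ->
  forall w p v, `|dot w (G (p + v) - G p - v *m 'J G p)|
    <= L * enorm w * enorm v ^+ 2.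
Proof.
move=> dG lip L0 w p v.
have [t [t01]] := MVT01 (fun t => is_derive_line_dot w (dG (p + t *: v))).
rewrite scale1r scale0r addr0 => h; rewrite !dotBr h -dotBr -mulmxBr.
apply: le_trans (cauchy_schwarz _ _) _.
rewrite mulrAC mulrC ler_wpM2r ?enorm_ge0//.
apply: le_trans (opnorm_tr_le _ _) _; rewrite expr2 mulrA.
rewrite ler_wpM2r ?enorm_ge0//; apply: le_trans (lip _ _) _.
by rewrite ler_wpM2l// scale_sub_norm.
Qed.

(** Serves functions such as [Phi] and [reg_max], whose definitions through a minimizer or a
    supremum give no derivative: a two-sided quadratic bound determines one. *)
Lemma derive_quadratic d (f : 'rV[R]_d -> R) C x g :
  (forall v, `|f (x + v) - f x - dot g v| <= C * enorm v ^+ 2) ->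
  forall v, (fun h => h^-1 *: (f (h *: v + x) - f x)) @ 0^' --> dot g v.
Proof.
move=> hf v; apply/cvgrPdist_lt => e e0; apply/nbhs_ballP.
have M0 : 0 < `|C| * enorm v ^+ 2 + 1 by rewrite ltr_wpDl// mulr_ge0// sqr_ge0.
exists (e / (`|C| * enorm v ^+ 2 + 1)); first by rewrite /= divr_gt0.
move=> h; rewrite -ball_normE /= sub0r normrN ltr_pdivlMr// => he h0.
apply: le_lt_trans he; have hp : 0 < `|h| by rewrite normr_gt0.
rewrite -(ler_pM2l hp) -normrM mulrBr -[_ *: _]/(_ * _) mulrA divff// mul1r.
rewrite distrC (addrC (h *: v)) -dotZr; apply: le_trans (hf _) _.
rewrite enormZ exprMn [leRHS]mulrA -expr2 mulrCA ler_wpM2l ?sqr_ge0//.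
by rewrite -[leLHS]addr0 lerD// ler_wpM2r ?sqr_ge0// ler_norm.
Qed.

Arguments derive_quadratic {d f C x g} hf v.

Lemma grad_quadratic d (f : 'rV[R]_d -> R) C x g :
  (forall v, `|f (x + v) - f x - dot g v| <= C * enorm v ^+ 2) ->
  grad f x = g.
Proof.
move=> hf; apply/rowP => j; rewrite mxE -[RHS](dot_delta g j).
apply: cvg_lim => //; exact: (derive_quadratic hf (delta_mx 0 j)).
Qed.

(** The quadratic bound at every point of the segment makes the restriction to it differentiable,
    and the mean value theorem concludes. *)
Lemma lipschitz_quadratic d (f : 'rV[R]_d -> R) C (g : 'rV[R]_d -> 'rV[R]_d) M :
  (forall x v, `|f (x + v) - f x - dot (g x) v| <= C * enorm v ^+ 2) ->
  (forall x, enorm (g x) <= M) ->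
  forall p q, `|f p - f q| <= M * enorm (p - q).
Proof.
move=> hf gM p q; set v := p - q.
have /MVT01[t [_]] : forall t, is_derive t (1 : R) (fun t => f (q + t *: v))
    (dot (g (q + t *: v)) v).
  move=> t; have c := derive_quadratic (hf (q + t *: v)) v.
  have E : (fun h => h^-1 *: (f (q + (h *: 1 + t) *: v) - f (q + t *: v))) =
    (fun h => h^-1 *: (f (h *: v + (q + t *: v)) - f (q + t *: v))).
    apply/funext => h; congr (_ *: (f _ - _)).
    by rewrite [h *: 1]mulr1 scalerDl addrCA.
  split; first by rewrite /derivable /= E; apply/cvg_ex; eexists; exact: c.
  by rewrite /derive /= E; exact: cvg_lim c.
rewrite scale1r scale0r addr0 subrKC => ->.
by apply: le_trans (cauchy_schwarz _ _) _; rewrite ler_wpM2r ?enorm_ge0.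
Qed.

Section Jacobian.
Context {d e : nat} (G : 'rV[R]_d -> 'rV[R]_e) (L L' : R).
Hypothesis dG : forall p, differentiable G p.
Hypothesis lipJ : forall p q, opnorm ('J G p - 'J G q) <= L' * enorm (p - q).
Hypothesis L'0 : 0 <= L'.

Lemma jacobian_dot_le p v w b :
  (forall t, 0 < t -> t < 1 -> dot w (G (p + t *: v) - G p) <= t * b) ->
  dot w (v *m 'J G p) <= b.
Proof.
move=> h; apply: (@ler_scale_limit _ _ (L' * enorm w * enorm v ^+ 2)) => t t0 t1.
have := first_order_bound_dot dG lipJ L'0 w p (t *: v).
rewrite dotBr -scalemxAl dotZr enormZ exprMn real_normK ?num_real// ler_norml.
by have := h t t0 t1; lra.
Qed.

Lemma jacobian_dot_ge p v w b :
  (forall t, 0 < t -> t < 1 -> t * b <= dot w (G (p + t *: v) - G p)) ->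
  b <= dot w (v *m 'J G p).
Proof.
move=> h; rewrite -lerN2 -dotNl; apply: jacobian_dot_le => t t0 t1.
by rewrite dotNl mulrN lerN2 h.
Qed.

(** [jacobian_dot_le] with [w] the vector [v *m 'J G p] itself. *)
Lemma jacobian_le p v : elipschitz L G -> enorm (v *m 'J G p) <= L * enorm v.
Proof.
move=> lip; have [v0|v0] := eqVneq (enorm (v *m 'J G p)) 0.
  by rewrite v0; apply: le_trans (enorm_ge0 (G (p + v) - G p)) _;
    apply: le_trans (lip _ _) _; rewrite addrAC subrr add0r.
have vp : 0 < enorm (v *m 'J G p) by rewrite lt_def v0 enorm_ge0.
rewrite -(ler_pM2l vp) -[leLHS]expr2 enorm_sqr.
apply: jacobian_dot_le => t t0 t1; apply: le_trans (dot_le _ _) _.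
rewrite mulrCA ler_pM2l//; apply: le_trans (lip _ _) _.
by rewrite addrAC subrr add0r enormZ gtr0_norm// mulrCA.
Qed.

End Jacobian.

Section StronglyConvex.
Context {d : nat} (h : 'rV[R]_d -> R) (dh : 'rV[R]_d -> 'rV[R]_d) (mu C : R).
Hypothesis mu0 : 0 < mu.
Hypothesis sc : strongly_convex mu h.
Hypothesis hdh : forall y v, `|h (y + v) - h y - dot (dh y) v| <= C * enorm v ^+ 2.

(** The convexity inequality at [t y' + (1 - t) y], compared with the quadratic expansion at [y] and
    divided by [t]. *)
Lemma strongly_convex_lower y y' :
  h y + dot (dh y) (y' - y) + mu / 2 * enorm (y' - y) ^+ 2 <= h y'.
Proof.
set v := y' - y; suff : dot (dh y) v <= h y' - h y - mu / 2 * enorm v ^+ 2 by lra.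
apply: (@ler_scale_limit _ _ ((C + mu / 2) * enorm v ^+ 2)) => t t0 t1.
have := hdh y (t *: v); rewrite dotZr enormZ exprMn real_normK ?num_real//.
have -> : y + t *: v = t *: y' + (1 - t) *: y.
  by rewrite scalerBr scalerBl scale1r addrCA.
have := @sc y' y t; rewrite (ltW t0) (ltW t1) -/v => /(_ isT).
rewrite ler_norml => h1 /andP[h2 _]; lra.
Qed.

Lemma strongly_monotone y y' :
  mu * enorm (y - y') ^+ 2 <= dot (dh y - dh y') (y - y').
Proof.
have := strongly_convex_lower y y'; have := strongly_convex_lower y' y.
by rewrite (enormBC y' y) -(opprB y y') dotNr dotBl; lra.
Qed.

(** Outside the ball of radius [2 |dh 0| / mu] the quadratic growth beats the linear term and [h] is
    at least [h 0]; a minimum over this compact ball is thus global. *)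
Lemma strongly_convex_min : continuous h -> exists y, forall y', h y <= h y'.
Proof.
move=> ch; pose r := 2 * enorm (dh 0) / mu.
have r0 : 0 <= r by rewrite !mulr_ge0 ?invr_ge0 ?enorm_ge0// ltW.
pose A := [set y : 'rV[R]_d | enorm y <= r].
have cA : compact A.
  apply: bounded_closed_compact.
    exists r; split; first exact: num_real.
    move=> s rs y /= yr; apply: le_trans (norm_le_enorm y) _.
    exact: le_trans yr (ltW rs).
  have -> : A = (@enorm R d) @^-1` [set x | x <= r] by [].
  by apply: closed_comp; [move=> x _; exact: enorm_continuous | exact: closed_le].
have [|||y yA hy] := @EVT_min_rV R d h A.
- by exists 0; rewrite /A /= enorm0.
- exact: cA.
- exact: continuous_subspaceT.
exists y => y'; have [y'r|y'r] := leP (enorm y') r; first by apply: hy; rewrite inE.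
have : h y <= h 0 by apply: hy; rewrite inE /A /= enorm0.
move=> /le_trans; apply; have := strongly_convex_lower 0 y'; rewrite subr0.
have := cauchy_schwarz (dh 0) y'; rewrite ler_norml => /andP[c1 _].
have : enorm (dh 0) * 2 <= mu * enorm y'.
  by move: (ltW y'r); rewrite /r ler_pdivrMr//; lra.
move=> /(ler_wpM2r (enorm_ge0 y')); rewrite expr2; lra.
Qed.

(** Compare with a step [t] from [y] against [dh y], and let [t] tend to 0. *)
Lemma min_stationary y : (forall y', h y <= h y') -> dh y = 0.
Proof.
move=> hy; apply: dot_eq0; apply/eqP; rewrite eq_le dot_ge0 andbT.
apply: (@ler_scale_limit _ _ (C * dot (dh y) (dh y))) => t t0 t1.
have := hdh y (- t *: dh y); rewrite dotZr enormZ exprMn.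
rewrite real_normK ?num_real// sqrrN enorm_sqr ler_norml.
by have := hy (y - t *: dh y); rewrite -scaleNr; lra.
Qed.

End StronglyConvex.
End Calculus.

(** * Projections *)

Section Projection.
Context {R : realType}.

Lemma enorm_sqr_le d e (u : 'rV[R]_d) (v : 'rV[R]_e) :
  (enorm u ^+ 2 <= enorm v ^+ 2) = (enorm u <= enorm v).
Proof. by rewrite ler_pXn2r ?nnegrE ?enorm_ge0. Qed.

Section Convex.
Context {d : nat} (X : set 'rV[R]_d).
Implicit Types x y p q : 'rV[R]_d.
Hypothesis Xconv : forall p q t, X p -> X q -> 0 <= t <= 1 ->
  X (p + t *: (q - p)).
Hypothesis Xnear : forall x, exists p,
  X p /\ forall q, X q -> enorm (x - p) <= enorm (x - q).

Lemma projP x : X (proj X x) /\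
  forall q, X q -> enorm (x - proj X x) <= enorm (x - q).
Proof.
rewrite /proj; case: xgetP => [p _ //|h].
by have [p hp] := Xnear x; case: (h p).
Qed.

(** Moving from the projection towards [q] stays in [X] and cannot come closer to [x]; the
    first-order part of this is the variational inequality. *)
Lemma proj_obtuse x q : X q -> dot (x - proj X x) (q - proj X x) <= 0.
Proof.
move=> Xq; have [Xp hp] := projP x; set p := proj X x in Xp hp *.
apply: (@ler_scale_limit _ _ _ (2^-1 * enorm (q - p) ^+ 2)) => t t0 t1.
have t01 : 0 <= t <= 1 by rewrite !ltW.
have := hp _ (Xconv Xp Xq t01).
rewrite -enorm_sqr_le opprD addrA (enorm_sqrB (x - p)).
by rewrite dotZr enormZ exprMn real_normK ?num_real//; lra.
Qed.

(** The sum of the two variational inequalities, each tested at the other projection, followed by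
    Cauchy-Schwarz. *)
Lemma proj_nonexpansive x y : enorm (proj X x - proj X y) <= enorm (x - y).
Proof.
set p := proj X x; set q := proj X y.
have h1 : dot (x - p) (q - p) <= 0 by apply: proj_obtuse; case: (projP y).
have h2 : dot (y - q) (p - q) <= 0 by apply: proj_obtuse; case: (projP x).
have [p0|p0] := eqVneq (enorm (p - q)) 0; first by rewrite p0 enorm_ge0.
have pp : 0 < enorm (p - q) by rewrite lt_def p0 enorm_ge0.
rewrite -(ler_pM2r pp) -[leLHS]expr2.
apply: le_trans (dot_le _ _); move: h1 h2; rewrite enorm_sqrB.
by rewrite !enorm_sqr !dotE !(dotC q p) ?(dotC p x) ?(dotC q x)
  ?(dotC p y) ?(dotC q y); lra.
Qed.

Lemma proj_id x : X x -> proj X x = x.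
Proof.
move=> Xx; apply/esym/eqP; rewrite -subr_eq0; apply/eqP/dot_eq0/eqP.
by rewrite eq_le dot_ge0 proj_obtuse.
Qed.

End Convex.

Lemma compact_nearest d (X : set 'rV[R]_d) : X !=set0 -> compact X ->
  forall x, exists p, X p /\ forall q, X q -> enorm (x - p) <= enorm (x - q).
Proof.
move=> X0 cX x.
have [|p pX hp] := @EVT_min_rV R d (fun q => enorm (x - q)) X X0 cX.
  apply: continuous_subspaceT; apply: (@lipschitz_continuous _ _ _ 1) => p q.
  apply: le_trans (enorm_distl _ _) _.
  by rewrite opprB addrC subrKA mul1r enormBC.
by exists p; split=> [|q qX]; [rewrite inE in pX | apply: hp; rewrite inE].
Qed.

Section Simplex.
Context {n : nat}.
Hypothesis n0 : (0 < n)%N.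

Lemma simplex_unif : simplex R n (unif R n).
Proof.
split=> [i|]; first by rewrite mxE invr_ge0.
under eq_bigr do rewrite mxE.
by rewrite sumr_const card_ord -(mulr_natl (_^-1)) divff// pnatr_eq0 -lt0n.
Qed.

Lemma simplex_convex p q t : simplex R n p -> simplex R n q -> 0 <= t <= 1 ->
  simplex R n (p + t *: (q - p)).
Proof.
move=> [p0 p1] [q0 q1] /andP[t0 t1]; split=> [i|].
  have := mulr_ge0 t0 (q0 i); have : 0 <= (1 - t) * p 0 i.
    by rewrite mulr_ge0// subr_ge0.
  by rewrite !mxE; lra.
under eq_bigr do rewrite !mxE mulrBr.
by rewrite big_split sumrB /= -!mulr_sumr p1 q1; lra.
Qed.

Lemma simplex_enorm l : simplex R n l -> enorm l ^+ 2 <= 1.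
Proof.
move=> [l0 l1]; rewrite -l1 enorm_sqr_sum; apply: ler_sum => j _.
rewrite expr2 ler_piMr// -l1 (bigD1 j)//= lerDl.
by apply: sumr_ge0 => i _.
Qed.

Lemma simplex_dist l l' : simplex R n l -> simplex R n l' ->
  enorm (l - l') ^+ 2 <= 4.
Proof.
move=> /simplex_enorm h /simplex_enorm h'.
by have := enorm_sqrD_le l (- l'); rewrite enormN; lra.
Qed.

Lemma simplex_nearest x : exists p, simplex R n p /\
  forall q, simplex R n q -> enorm (x - p) <= enorm (x - q).
Proof.
apply: compact_nearest; first by exists (unif R n); exact: simplex_unif.
apply: bounded_closed_compact.
  exists 1; split; first exact: num_real.
  move=> s s1 l /simplex_enorm l1; apply: le_trans (norm_le_enorm l) _.
  apply: le_trans (ltW s1).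
  by rewrite -(@ler_pXn2r _ 2) ?nnegrE ?enorm_ge0// expr1n.
have -> : simplex R n = \bigcap_i [set l : 'rV[R]_n | 0 <= l 0 i] `&`
    [set l | dot l (const_mx 1) = 1].
  have E l : dot l (const_mx 1) = \sum_(i < n) l 0 i.
    by apply: eq_bigr => j _; rewrite mxE mulr1.
  apply/seteqP; split=> [l [l0 l1]|l [l0 l1]].
    by split => [i _|]; [exact: l0 | rewrite /= E].
  by split => [i|]; [exact: l0 | rewrite -E].
apply: closedI.
  apply: closed_bigI => i _.
  have -> : [set l : 'rV[R]_n | 0 <= l 0 i] =
      (fun l : 'rV[R]_n => l 0 i) @^-1` [set x | 0 <= x] by [].
  by apply: closed_comp; [move=> y _; exact: coord_continuous | exact: closed_ge].
have -> : [set l : 'rV[R]_n | dot l (const_mx 1) = 1] =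
    (dot (const_mx 1)) @^-1` [set 1].
  by apply/seteqP; split => l /=; rewrite dotC.
apply: closed_comp; [move=> y _; exact: dot_continuous | exact: closed_eq].
Qed.

End Simplex.

Section Feasible.
Context {n : nat} (pb : bilevel R n).
Hypothesis ok : feasible_set_ok pb.

Lemma feas_convex p q t : feas pb p -> feas pb q -> 0 <= t <= 1 ->
  feas pb (p + t *: (q - p)).
Proof.
case: ok => [->//|[_ cX _]] Xp Xq /andP[t0 t1].
have := @cX q p (Itv01 t0 t1); rewrite !inE => /(_ Xq Xp).
by rewrite /conv /= scalerBr scalerBl scale1r addrCA.
Qed.

Lemma feas_nearest x : exists p, feas pb p /\
  forall q, feas pb q -> enorm (x - p) <= enorm (x - q).
Proof.
case: ok => [->|[X0 _ cX]]; last exact: compact_nearest.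
by exists x; split => // q _; rewrite subrr enorm0 enorm_ge0.
Qed.

End Feasible.
End Projection.

(** * The hypergradient *)

Section Blocks.
Context {R : realType} {d1 d2 : nat}.
Implicit Types (A B : 'M[R]_(d1 + d2)) (u : 'rV[R]_d1) (v : 'rV[R]_d2).

Lemma ursubmxB A B : ursubmx (A - B) = ursubmx A - ursubmx B.
Proof. by apply/matrixP => k l; rewrite !mxE. Qed.

Lemma drsubmxB A B : drsubmx (A - B) = drsubmx A - drsubmx B.
Proof. by apply/matrixP => k l; rewrite !mxE. Qed.

Lemma dot_row_mx0l v (p : 'rV[R]_(d1 + d2)) :
  dot (row_mx 0 v) p = dot v (rsubmx p).
Proof. by rewrite -{1}(hsubmxK p) dot_row_mx dot0l add0r. Qed.

Lemma rsubmx_row_mul A u v :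
  rsubmx (row_mx u v *m A) = u *m ursubmx A + v *m drsubmx A.
Proof.
by rewrite -[A in LHS]submxK mul_row_block row_mxKr.
Qed.

Lemma enorm_ursubmx A u : enorm (u *m ursubmx A) <= enorm (row_mx u 0 *m A).
Proof.
have -> : u *m ursubmx A = rsubmx (row_mx u 0 *m A).
  by rewrite rsubmx_row_mul mul0mx addr0.
exact: enorm_rsubmx.
Qed.

Lemma enorm_drsubmx A v : enorm (v *m drsubmx A) <= enorm (row_mx 0 v *m A).
Proof.
have -> : v *m drsubmx A = rsubmx (row_mx 0 v *m A).
  by rewrite rsubmx_row_mul mul0mx add0r.
exact: enorm_rsubmx.
Qed.

End Blocks.

(** Bounds on blocks of the Hessian are easy for the action on row vectors [u *m A], where a block
    is a padding by zeros; duality carries them to [mxapp]. *)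
Lemma mxapp_le_tr (R : realType) m n (A : 'M[R]_(m, n)) M : 0 <= M ->
  (forall u, enorm (u *m A) <= M * enorm u) ->
  forall v, enorm (mxapp A v) <= M * enorm v.
Proof.
move=> M0 h v; have [v0|v0] := eqVneq (enorm (mxapp A v)) 0.
  by rewrite v0 mulr_ge0 ?enorm_ge0.
have vp : 0 < enorm (mxapp A v) by rewrite lt_def v0 enorm_ge0.
rewrite -(ler_pM2r vp) -[leLHS]expr2 enorm_sqr dot_mxapp.
apply: le_trans (dot_le _ _) _; rewrite mulrC [leRHS]mulrAC.
by rewrite ler_wpM2r ?enorm_ge0.
Qed.

Lemma enorm_pair_dist (R : realType) d1 d2 (x x' : 'rV[R]_d1) (y y' : 'rV[R]_d2) :
  enorm (row_mx x y - row_mx x' y') <= enorm (x - x') + enorm (y - y').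
Proof. by rewrite opp_row_mx add_row_mx enorm_row_mx_le. Qed.

Lemma mxapp_residual (R : realType) m n (A A' : 'M[R]_(m, n)) z u u' :
  mxapp A' z = u' -> mxapp A z - u = mxapp (A - A') z - (u - u').
Proof. by move=> <-; rewrite mxappBl opprB addrA addrNK. Qed.

Lemma mxapp_solvedB (R : realType) m n (A : 'M[R]_(m, n)) z z' u :
  mxapp A z = u -> mxapp A (z - z') = u - mxapp A z'.
Proof. by move=> <-; rewrite mxappBr. Qed.

Lemma mxapp_diff (R : realType) m n (A A' : 'M[R]_(m, n)) z z' u u' :
  u - mxapp A z - (u' - mxapp A' z') =
  (u - u') - mxapp (A - A') z' - mxapp A (z - z').
Proof.
by rewrite mxappBl mxappBr; apply/rowP => j; rewrite !mxE; ring.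
Qed.

Lemma mxapp_step (R : realType) m (A : 'M[R]_m) z z' u s :
  z - s *: (mxapp A z - u) - z' =
  (z - z' - s *: mxapp A (z - z')) + - (s *: (mxapp A z' - u)).
Proof.
rewrite mxappBr; move: (mxapp A z) (mxapp A z') => a a'.
by apply/rowP => j; rewrite !mxE; ring.
Qed.

Section Hypergradient.
Context {R : realType} {n : nat} (pb : bilevel R n) (c : constants R).
Hypothesis hc : valid_constants c.
Hypothesis ha : bilevel_assumptions pb c.

Local Notation Lg := (L_dg c).
Local Notation L1 := (L_df c).
Local Notation L2 := (L_d2g c).
Local Notation mu := (mu_g c).
Local Notation Lf := (L_f c).

Lemma Lg_ge0 : 0 <= Lg. Proof. by case: hc => -[]. Qed.
Lemma L1_ge0 : 0 <= L1. Proof. by case: hc => -[]. Qed.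
Lemma L2_ge0 : 0 <= L2. Proof. by case: hc => -[]. Qed.
Lemma mu_gt0 : 0 < mu. Proof. by case: hc => -[]. Qed.
Lemma Lf_ge0 : 0 <= Lf. Proof. by case: hc => _ [[]]. Qed.
Lemma LPhi_ge0 : 0 <= L_Phi c. Proof. by case: hc => _ [[]]. Qed.
Lemma bPhi_ge0 : 0 <= b_Phi c. Proof. by case: hc => _ [[]]. Qed.
Local Hint Resolve Lg_ge0 L1_ge0 L2_ge0 mu_gt0 Lf_ge0 : core.

Variable i : 'I_n.
Implicit Types (x : 'rV[R]_(dimx pb)) (y z v w : 'rV[R]_(dimy pb i)).

Local Notation g := (lower pb i).
Local Notation f := (upper pb i).

Lemma lower_slice_bound x y v :
  `|g (row_mx x (y + v)) - g (row_mx x y) - dot (lower_d2 x y) v|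
    <= Lg * enorm v ^+ 2.
Proof.
have := first_order_bound (@lower_diff _ _ _ _ ha i) (@lower_grad_lip _ _ _ _ ha i) Lg_ge0
  (row_mx x y) (row_mx 0 v).
rewrite add_row_mx addr0 enorm_row_mx0l.
by rewrite -[grad g _]hsubmxK dot_row_mx dot0r add0r -[rsubmx _]/(lower_d2 x y).
Qed.

Lemma lower_slice_continuous x : continuous (fun y => g (row_mx x y)).
Proof.
move=> y; apply/(@cvgrPdist_lt _ _ _ (nbhs y)) => e e0.
have := @differentiable_continuous _ _ _ _ _ (@lower_diff _ _ _ _ ha i (row_mx x y)).
move=> /(@cvgrPdist_lt _ _ _ (nbhs (row_mx x y)))/(_ e e0)/nbhs_ballP[r /= r0 h].
have := nbhsx_ballx y r r0.
apply: filterS => y' yy'; apply: h.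
move: yy'; rewrite -!ball_normE /= => yy'.
rewrite opp_row_mx add_row_mx subrr.
apply: le_lt_trans yy'; rewrite [leLHS]/Num.norm /= mx_normrE.
apply/bigmax_leP; split => // -[k j] _ /=; rewrite (ord1 k) mxE.
case: split_ordP => j' _; first by rewrite mxE normr0.
by rewrite [leRHS]/Num.norm /= mx_normrE; apply/bigmax_geP; right; exists (ord0, j').
Qed.

Lemma ystar_min x y : g (row_mx x (ystar i x)) <= g (row_mx x y).
Proof.
have := strongly_convex_min mu_gt0 (@lower_strongly_convex _ _ _ _ ha i x)
  (lower_slice_bound x) (@lower_slice_continuous x).
rewrite /ystar /argmin => ex; case: xgetP => [z _ /(_ y)//|h].
by case: ex => z /h.
Qed.

Local Opaque ystar.

Lemma ystar_stationary x : lower_d2 x (ystar i x) = 0.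
Proof. exact: min_stationary (lower_slice_bound x) _ (ystar_min x). Qed.

Lemma lower_d2_monotone x y y' :
  mu * enorm (y - y') ^+ 2 <= dot (lower_d2 x y - lower_d2 x y') (y - y').
Proof.
exact: strongly_monotone (@lower_strongly_convex _ _ _ _ ha i x) (lower_slice_bound x) y y'.
Qed.

Lemma lower_d2_lip x x' y y' :
  enorm (lower_d2 x y - lower_d2 x' y') <= Lg * (enorm (x - x') + enorm (y - y')).
Proof.
rewrite /lower_d2 -raddfB; apply: le_trans (enorm_rsubmx _) _.
apply: le_trans (lower_grad_lip ha _ _) _.
by rewrite ler_wpM2l// enorm_pair_dist.
Qed.

Lemma upper_d1_lip x x' y y' :
  enorm (upper_d1 x y - upper_d1 x' y') <= L1 * (enorm (x - x') + enorm (y - y')).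
Proof.
rewrite /upper_d1 -raddfB; apply: le_trans (enorm_lsubmx _) _.
apply: le_trans (upper_grad_lip ha _ _) _.
by rewrite ler_wpM2l// enorm_pair_dist.
Qed.

Lemma upper_d2_lip x x' y y' :
  enorm (upper_d2 x y - upper_d2 x' y') <= L1 * (enorm (x - x') + enorm (y - y')).
Proof.
rewrite /upper_d2 -raddfB; apply: le_trans (enorm_rsubmx _) _.
apply: le_trans (upper_grad_lip ha _ _) _.
by rewrite ler_wpM2l// enorm_pair_dist.
Qed.

Definition kap_y : R := Lg / mu.

Lemma kap_y_ge0 : 0 <= kap_y.
Proof. by rewrite divr_ge0// ltW. Qed.

(** Strong monotonicity of [lower_d2 x] between the two minimizers, where the gradient at
    [ystar i x'] is compared with its value 0 for the parameter [x']. *)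
Lemma ystar_lip x x' :
  enorm (ystar i x - ystar i x') <= kap_y * enorm (x - x').
Proof.
set y := ystar i x; set y' := ystar i x'.
have [e0|e0] := eqVneq (enorm (y - y')) 0.
  by rewrite e0 mulr_ge0 ?kap_y_ge0 ?enorm_ge0.
have ep : 0 < enorm (y - y') by rewrite lt_def e0 enorm_ge0.
rewrite /kap_y mulrAC ler_pdivlMr// -(ler_pM2r ep).
rewrite mulrAC -expr2 mulrC; apply: le_trans (lower_d2_monotone x y y') _.
have -> : lower_d2 x y - lower_d2 x y' = lower_d2 x' y' - lower_d2 x y'.
  by rewrite /y /y' !ystar_stationary.
apply: le_trans (dot_le _ _) _; rewrite ler_wpM2r ?enorm_ge0//.
apply: le_trans (lower_d2_lip _ _ _ _) _.
by rewrite subrr enorm0 addr0 (enormBC x').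
Qed.

(** The condition on [s] lets half of the linear gain [2 s mu] absorb the quadratic term
    [s^2 Lg^2]. *)
Lemma lower_step x y s : 0 <= s -> s * Lg ^+ 2 <= mu ->
  enorm (y - s *: lower_d2 x y - ystar i x) ^+ 2 <=
    (1 - s * mu) * enorm (y - ystar i x) ^+ 2.
Proof.
move=> s0 sL; rewrite addrAC; set e := y - ystar i x.
rewrite enorm_sqrB dotZr enormZ exprMn real_normK ?num_real//.
have := lower_d2_monotone x y (ystar i x); rewrite ystar_stationary subr0 -/e.
rewrite dotC => mon.
have := lower_d2_lip x x y (ystar i x).
rewrite ystar_stationary subr0 subrr enorm0 add0r -/e => lip.
have lip2 : enorm (lower_d2 x y) ^+ 2 <= Lg ^+ 2 * enorm e ^+ 2.
  by rewrite -exprMn ler_pXn2r ?nnegrE ?mulr_ge0 ?enorm_ge0.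
have h1 := ler_wpM2l s0 mon.
have h2 := ler_wpM2l (sqr_ge0 s) lip2.
have h3 := ler_wpM2r (mulr_ge0 s0 (sqr_ge0 (enorm e))) sL.
lra.
Qed.

Let hessL p (w : 'rV[R]_(dimx pb + dimy pb i)) : enorm (w *m hess g p) <= Lg * enorm w.
Proof.
apply: (jacobian_le (@lower_diff2 _ _ _ _ ha i) (@lower_hess_lip _ _ _ _ ha i)) => //.
exact: (@lower_grad_lip _ _ _ _ ha i).
Qed.

Lemma lower_d22_tr_le x y w : enorm (w *m lower_d22 x y) <= Lg * enorm w.
Proof.
apply: le_trans (enorm_drsubmx _ _) _; apply: le_trans (hessL _ _) _.
by rewrite enorm_row_mx0l.
Qed.

Lemma lower_d12_tr_le x y u : enorm (u *m lower_d12 x y) <= Lg * enorm u.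
Proof.
apply: le_trans (enorm_ursubmx _ _) _; apply: le_trans (hessL _ _) _.
by rewrite enorm_row_mx0r.
Qed.

Lemma lower_d22_le x y z : enorm (mxapp (lower_d22 x y) z) <= Lg * enorm z.
Proof. by apply: mxapp_le_tr => // w; exact: lower_d22_tr_le. Qed.

Lemma lower_d12_le x y z : enorm (mxapp (lower_d12 x y) z) <= Lg * enorm z.
Proof. by apply: mxapp_le_tr => // w; exact: lower_d12_tr_le. Qed.

Let hess_pair x x' y y' (w : 'rV[R]_(dimx pb + dimy pb i)) :
  enorm (w *m (hess g (row_mx x y) - hess g (row_mx x' y')))
    <= L2 * (enorm (x - x') + enorm (y - y')) * enorm w.
Proof.
apply: le_trans (opnorm_tr_le _ _) _; rewrite ler_wpM2r ?enorm_ge0//.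
apply: le_trans (lower_hess_lip ha _ _) _.
by rewrite ler_wpM2l// enorm_pair_dist.
Qed.

Let dist_ge0 x x' y y' : 0 <= L2 * (enorm (x - x') + enorm (y - y')).
Proof. by rewrite mulr_ge0// addr_ge0 ?enorm_ge0. Qed.

Lemma lower_d22_lip x x' y y' z :
  enorm (mxapp (lower_d22 x y - lower_d22 x' y') z)
    <= L2 * (enorm (x - x') + enorm (y - y')) * enorm z.
Proof.
apply: mxapp_le_tr => // w; rewrite /lower_d22 -drsubmxB.
apply: le_trans (enorm_drsubmx _ _) _; apply: le_trans (hess_pair _ _ _ _ _) _.
by rewrite enorm_row_mx0l.
Qed.

Lemma lower_d12_lip x x' y y' z :
  enorm (mxapp (lower_d12 x y - lower_d12 x' y') z)
    <= L2 * (enorm (x - x') + enorm (y - y')) * enorm z.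
Proof.
apply: mxapp_le_tr => // w; rewrite /lower_d12 -ursubmxB.
apply: le_trans (enorm_ursubmx _ _) _; apply: le_trans (hess_pair _ _ _ _ _) _.
by rewrite enorm_row_mx0r.
Qed.

(** Strong monotonicity of [lower_d2] between [y + t v] and [y], passed to the limit by
    [jacobian_dot_ge]. *)
Lemma lower_d22_pos x y v : mu * enorm v ^+ 2 <= dot (mxapp (lower_d22 x y) v) v.
Proof.
rewrite dot_mxapp.
have -> : dot v (v *m lower_d22 x y) =
    dot (row_mx 0 v) (row_mx 0 v *m hess g (row_mx x y)).
  by rewrite dot_row_mx0l rsubmx_row_mul mul0mx add0r.
apply: (jacobian_dot_ge (@lower_diff2 _ _ _ _ ha i) (@lower_hess_lip _ _ _ _ ha i)) => //.
move=> t t0 t1; rewrite scale_row_mx scaler0 add_row_mx addr0.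
rewrite dot_row_mx0l raddfB.
have := lower_d2_monotone x (y + t *: v) y.
rewrite addrAC subrr add0r enormZ exprMn real_normK ?num_real// dotZr dotC => h.
by rewrite -(ler_pM2l t0); move: h; rewrite expr2 !mulrA [mu * t]mulrC [t * mu * t]mulrAC.
Qed.

(** Positivity leaves no kernel. The transpose appears because [mxapp A v] is [v *m A^T]. *)
Lemma lower_d22_unit x y : (lower_d22 x y)^T \in unitmx.
Proof.
rewrite -row_free_unit -kermx_eq0; apply/eqP/row_matrixP => k; rewrite row0.
set v := row k _; apply: enorm_eq0; apply/eqP; rewrite -(@sqrf_eq0 R).
rewrite eq_le sqr_ge0 andbT -(ler_pM2l mu_gt0) mulr0.
apply: le_trans (lower_d22_pos x y v) _.
have -> : mxapp (lower_d22 x y) v = 0.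
  by rewrite /mxapp /v -row_mul mulmx_ker row0.
by rewrite dot0l.
Qed.

(** The Lipschitz bound of the upper function in [y], tested in the direction of the gradient
    itself; it gives the bound at every pair [(x, y)]. *)
Lemma upper_d2_bound x y : enorm (upper_d2 x y) <= Lf.
Proof.
set w := upper_d2 x y; have [w0|w0] := eqVneq (enorm w) 0; first by rewrite w0.
have wp : 0 < enorm w by rewrite lt_def w0 enorm_ge0.
rewrite -(ler_pM2r wp) -[leLHS]expr2.
apply: (@ler_scale_limit _ _ _ (L1 * enorm w ^+ 2)) => t t0 t1.
have := first_order_bound (@upper_diff _ _ _ _ ha i) (@upper_grad_lip _ _ _ _ ha i) L1_ge0
  (row_mx x y) (row_mx 0 (t *: w)).
rewrite add_row_mx addr0 enorm_row_mx0l.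
rewrite -[grad f _]hsubmxK dot_row_mx dot0r add0r -[rsubmx _]/w dotZr -enorm_sqr.
rewrite enormZ exprMn real_normK ?num_real// => b1.
have := upper_lip2 ha x (y + t *: w) y.
rewrite addrAC subrr add0r enormZ (gtr0_norm t0) => b2.
move: b1 b2; rewrite !ler_norml => /andP[h1 _] /andP[_ h2].
lra.
Qed.

Definition zstar x : 'rV[R]_(dimy pb i) :=
  upper_d2 x (ystar i x) *m invmx (lower_d22 x (ystar i x))^T.

Lemma zstarE x :
  mxapp (lower_d22 x (ystar i x)) (zstar x) = upper_d2 x (ystar i x).
Proof. by rewrite /mxapp /zstar mulmxKV// lower_d22_unit. Qed.

Local Opaque zstar lower_d22 lower_d12 upper_d1 upper_d2 lower_d2.

Definition kap_r : R := Lf / mu.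

Lemma kap_r_ge0 : 0 <= kap_r. Proof. by rewrite divr_ge0// ltW. Qed.

Let lower_d22_inv x y z r : 0 <= r ->
  enorm (mxapp (lower_d22 x y) z) <= r -> enorm z <= r / mu.
Proof.
move=> r0 h; have [z0|z0] := eqVneq (enorm z) 0.
  by rewrite z0 divr_ge0// ltW.
have zp : 0 < enorm z by rewrite lt_def z0 enorm_ge0.
rewrite ler_pdivlMr// mulrC -(ler_pM2r zp) -mulrA -expr2.
apply: le_trans (lower_d22_pos x y z) _; apply: le_trans (dot_le _ _) _.
by rewrite ler_wpM2r ?enorm_ge0.
Qed.

Lemma zstar_le x : enorm (zstar x) <= kap_r.
Proof.
by apply: (@lower_d22_inv x (ystar i x)) => //; rewrite zstarE upper_d2_bound.
Qed.

(** A Lipschitz constant in [(x, y)] common to [mxapp (lower_d22 x y) z - upper_d2 x y] and to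
    [hyper x y z], for [enorm z <= kap_r]. *)
Definition kap_u : R := L1 + L2 * kap_r.

Lemma kap_u_ge0 : 0 <= kap_u.
Proof. by rewrite addr_ge0// mulr_ge0// kap_r_ge0. Qed.

(** Inserting the adjoint state of [x'] into the system at [(x, y)] treats two perturbations at
    once: a change of [x] in [zstar_lip] and an inexact [y] in [adjoint_step]. *)
Lemma zstar_residual x x' y :
  enorm (mxapp (lower_d22 x y) (zstar x') - upper_d2 x y)
    <= kap_u * (enorm (x - x') + enorm (y - ystar i x')).
Proof.
rewrite (mxapp_residual _ _ (zstarE x')).
apply: le_trans (enormB _ _) _; rewrite /kap_u mulrDl addrC.
apply: lerD; first exact: upper_d2_lip.
apply: le_trans (lower_d22_lip _ _ _ _ _) _.
by rewrite [leRHS]mulrAC ler_wpM2l ?zstar_le.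
Qed.

Definition kap_z : R := kap_u * (1 + kap_y) / mu.

Lemma kap_z_ge0 : 0 <= kap_z.
Proof.
by rewrite divr_ge0 ?mulr_ge0 ?kap_u_ge0 ?addr_ge0 ?kap_y_ge0// ltW.
Qed.

Lemma zstar_lip x x' : enorm (zstar x - zstar x') <= kap_z * enorm (x - x').
Proof.
have -> : kap_z * enorm (x - x') = kap_u * (1 + kap_y) * enorm (x - x') / mu.
  by rewrite /kap_z mulrAC.
apply: (@lower_d22_inv x (ystar i x)).
  by rewrite !mulr_ge0 ?kap_u_ge0 ?addr_ge0 ?kap_y_ge0 ?enorm_ge0.
rewrite (mxapp_solvedB _ (zstarE x)) enormBC; apply: le_trans (zstar_residual _ _ _) _.
rewrite -mulrA ler_wpM2l ?kap_u_ge0// mulrDl mul1r lerD2l.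
exact: ystar_lip.
Qed.

Definition kap_s : R := (1 + 2 / mu) * kap_u ^+ 2.

Lemma adjoint_step x y z s : 0 < s -> s <= 1 -> s * Lg ^+ 2 <= mu -> s * mu <= 1 ->
  enorm (z - s *: (mxapp (lower_d22 x y) z - upper_d2 x y) - zstar x) ^+ 2 <=
    (1 - s * mu / 2) * enorm (z - zstar x) ^+ 2 +
    s * kap_s * enorm (y - ystar i x) ^+ 2.
Proof.
move=> s0 s1 sL smu; set e := z - zstar x.
set r := mxapp (lower_d22 x y) (zstar x) - upper_d2 x y.
have -> : z - s *: (mxapp (lower_d22 x y) z - upper_d2 x y) - zstar x =
    (e - s *: mxapp (lower_d22 x y) e) + - (s *: r).
  exact: mxapp_step.
(* Half of the contraction pays for the cross term. The residual is multiplied by about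
   [2 / (s mu)], which its own factor [s^2] reduces to order [s]; this is the origin of [kap_s]. *)
have ep : 0 < s * mu / 2 by rewrite divr_gt0// mulr_gt0.
apply: le_trans (enorm_sqr_young _ _ ep) _.
have h1 : enorm (e - s *: mxapp (lower_d22 x y) e) ^+ 2 <=
    (1 - s * mu) * enorm e ^+ 2.
  rewrite enorm_sqrB dotZr enormZ exprMn real_normK ?num_real// dotC.
  have mon := lower_d22_pos x y e.
  have lip2 : enorm (mxapp (lower_d22 x y) e) ^+ 2 <= Lg ^+ 2 * enorm e ^+ 2.
    by rewrite -exprMn ler_pXn2r ?nnegrE ?mulr_ge0 ?enorm_ge0// lower_d22_le.
  have k1 := ler_wpM2l (ltW s0) mon.
  have k2 := ler_wpM2l (sqr_ge0 s) lip2.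
  have k3 := ler_wpM2r (mulr_ge0 (ltW s0) (sqr_ge0 (enorm e))) sL.
  lra.
have h2 : enorm (- (s *: r)) ^+ 2 <= s ^+ 2 * (kap_u ^+ 2 * enorm (y - ystar i x) ^+ 2).
  rewrite enormN enormZ exprMn real_normK ?num_real// ler_wpM2l ?sqr_ge0//.
  rewrite -exprMn ler_pXn2r ?nnegrE ?mulr_ge0 ?kap_u_ge0 ?enorm_ge0//.
  by have := zstar_residual x x y; rewrite subrr enorm0 add0r.
apply: lerD.
  apply: le_trans (ler_wpM2l _ h1) _; first by rewrite addr_ge0// ltW.
  rewrite mulrA ler_wpM2r ?sqr_ge0//.
  by have := mulr_ge0 (ltW ep) (ltW ep); lra.
apply: le_trans (ler_wpM2l _ h2) _; first by rewrite addr_ge0// invr_ge0 ltW.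
rewrite /kap_s; set Y := enorm (y - _) ^+ 2.
have -> : s * ((1 + 2 / mu) * kap_u ^+ 2) * Y =
    s * (1 + 2 / mu) * (kap_u ^+ 2 * Y) by ring.
rewrite [leLHS]mulrA; apply: ler_wpM2r; first by apply: mulr_ge0; exact: sqr_ge0.
have -> : (1 + (s * mu / 2)^-1) * s ^+ 2 = s * (s + 2 / mu).
  have := mu_gt0; move: s0 => s0' m0; field; lra.
by rewrite ler_pM2l// lerD2r.
Qed.

Definition hyper x y z : 'rV[R]_(dimx pb) :=
  upper_d1 x y - mxapp (lower_d12 x y) z.

Definition hypergrad x : 'rV[R]_(dimx pb) := hyper x (ystar i x) (zstar x).

Lemma hyper_dist x x' y z :
  enorm (hyper x y z - hypergrad x') <=
    kap_u * (enorm (x - x') + enorm (y - ystar i x')) +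
    Lg * enorm (z - zstar x').
Proof.
rewrite /hypergrad /hyper mxapp_diff.
apply: le_trans (enormB _ _) _; apply: lerD; last exact: lower_d12_le.
apply: le_trans (enormB _ _) _; rewrite /kap_u mulrDl.
apply: lerD; first exact: upper_d1_lip.
apply: le_trans (lower_d12_lip _ _ _ _ _) _.
by rewrite [leRHS]mulrAC ler_wpM2l ?zstar_le.
Qed.

Definition kap_b : R := 2 * kap_u ^+ 2 + 2 * Lg ^+ 2.

Lemma hyper_bias x y z : enorm (hyper x y z - hypergrad x) ^+ 2 <=
  kap_b * (enorm (y - ystar i x) ^+ 2 + enorm (z - zstar x) ^+ 2).
Proof.
have := hyper_dist x x y z; rewrite (subrr x) enorm0 add0r.
set a := enorm (y - _); set b := enorm (z - _) => h.
apply: le_trans (_ : (kap_u * a + Lg * b) ^+ 2 <= _).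
  by rewrite ler_pXn2r ?nnegrE ?addr_ge0 ?mulr_ge0 ?kap_u_ge0 ?enorm_ge0.
rewrite /kap_b; have := sqr_ge0 (kap_u * a - Lg * b).
have := mulr_ge0 (sqr_ge0 kap_u) (sqr_ge0 b).
have := mulr_ge0 (sqr_ge0 Lg) (sqr_ge0 a); lra.
Qed.

Definition kap_G : R := kap_u * (1 + kap_y) + Lg * kap_z.

Lemma kap_G_ge0 : 0 <= kap_G.
Proof.
apply: addr_ge0; last by apply: mulr_ge0 => //; exact: kap_z_ge0.
apply: mulr_ge0; first exact: kap_u_ge0.
by apply: addr_ge0 => //; exact: kap_y_ge0.
Qed.

Lemma hypergrad_lip x x' :
  enorm (hypergrad x - hypergrad x') <= kap_G * enorm (x - x').
Proof.
apply: le_trans (hyper_dist _ _ _ _) _; rewrite /kap_G [leRHS]mulrDl.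
apply: lerD; last by rewrite -mulrA ler_wpM2l// zstar_lip.
rewrite -mulrA ler_wpM2l ?kap_u_ge0// mulrDl mul1r lerD2l.
exact: ystar_lip.
Qed.

Definition kap_Q : R := kap_u * (1 + kap_y) ^+ 2.

Lemma kap_Q_ge0 : 0 <= kap_Q.
Proof. by rewrite mulr_ge0 ?sqr_ge0 ?kap_u_ge0. Qed.

(* The derivative of [ystar] is never needed: linearizing the optimality condition
   along [row_mx h (ystar (x + h) - ystar x)] and pairing with [zstar] replaces it. *)
Lemma Phi_quadratic x h :
  `|Phi i (x + h) - Phi i x - dot (hypergrad x) h| <= kap_Q * enorm h ^+ 2.
Proof.
set dy := ystar i (x + h) - ystar i x.
set p := row_mx x (ystar i x); set v := row_mx h dy.
have pv : p + v = row_mx (x + h) (ystar i (x + h)).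
  by rewrite add_row_mx subrKC.
have b1 := first_order_bound (@upper_diff _ _ _ _ ha i) (@upper_grad_lip _ _ _ _ ha i) L1_ge0 p v.
have b2 := first_order_bound_dot (@lower_diff2 _ _ _ _ ha i) (@lower_hess_lip _ _ _ _ ha i) L2_ge0
  (row_mx 0 (zstar x)) p v.
have E1 : dot (grad f p) v = dot (upper_d1 x (ystar i x)) h +
    dot (zstar x) (dy *m lower_d22 x (ystar i x)).
  by rewrite -[grad f p]hsubmxK dot_row_mx -dot_mxapp zstarE.
(* Both expansions contain the unknown displacement [dy] only through the pairing
   [dot (zstar x) (dy *m lower_d22 _ _)], so it cancels when they are combined. *)
have E2 : dot (row_mx 0 (zstar x)) (grad g (p + v) - grad g p - v *m 'J (grad g) p) =
   - (dot (mxapp (lower_d12 x (ystar i x)) (zstar x)) h +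
      dot (zstar x) (dy *m lower_d22 x (ystar i x))).
  rewrite dot_row_mx0l !raddfB /=.
  rewrite pv -[rsubmx (grad g _)]/(lower_d2 _ _) ystar_stationary.
  rewrite -[rsubmx (grad g p)]/(lower_d2 _ _) ystar_stationary subrr sub0r.
  by rewrite rsubmx_row_mul dotNr dotDr dot_mxapp.
rewrite E1 pv -/(Phi i (x + h)) -/(Phi i x) in b1.
rewrite E2 normrN enorm_row_mx0l in b2.
have vle : enorm v ^+ 2 <= (1 + kap_y) ^+ 2 * enorm h ^+ 2.
  rewrite -exprMn ler_pXn2r ?nnegrE ?mulr_ge0 ?addr_ge0 ?kap_y_ge0 ?enorm_ge0//.
  apply: le_trans (enorm_row_mx_le _ _) _; rewrite mulrDl mul1r lerD2l.
  by apply: le_trans (ystar_lip _ _) _; rewrite addrAC subrr add0r.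
apply: le_trans (_ : kap_u * enorm v ^+ 2 <= _); last first.
  by rewrite /kap_Q -mulrA ler_wpM2l ?kap_u_ge0.
have b3 : L2 * enorm (zstar x) * enorm v ^+ 2 <= L2 * kap_r * enorm v ^+ 2.
  by rewrite ler_wpM2r ?sqr_ge0// ler_wpM2l// zstar_le.
rewrite /kap_u /hypergrad /hyper dotBl; move: b1 b2 b3.
rewrite !ler_norml => /andP[b11 b12] /andP[b21 b22] b3.
by apply/andP; split; lra.
Qed.

Lemma grad_Phi x : grad (Phi i) x = hypergrad x.
Proof. by apply: grad_quadratic => h; exact: Phi_quadratic. Qed.

Lemma hypergrad_le x : enorm (hypergrad x) <= L_Phi c.
Proof. by rewrite -grad_Phi; exact: Phi_grad_bound ha i x. Qed.

Lemma Phi_lip x x' : `|Phi i x - Phi i x'| <= L_Phi c * enorm (x - x').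
Proof. exact: lipschitz_quadratic Phi_quadratic hypergrad_le _ _. Qed.

Lemma upper_Phi_dist x y :
  `|f (row_mx x y) - Phi i x| <= Lf * enorm (y - ystar i x).
Proof. by rewrite /Phi; apply: (upper_lip2 ha). Qed.

End Hypergradient.

(** * The regularized max and the gradient map *)

Lemma ler_of_sqr (R : realDomainType) (x y : R) : 0 <= y -> x ^+ 2 <= y ^+ 2 -> x <= y.
Proof.
move=> y0 h; have [x0|/ltW x0] := leP 0 x; last exact: le_trans y0.
by rewrite -(@ler_pXn2r _ 2).
Qed.

Section MinMax.
Context {R : realType} {n dx : nat}.
Implicit Types (x h : 'rV[R]_dx) (l : 'rV[R]_n).
Variables (Ph : 'I_n -> 'rV[R]_dx -> R) (G : 'I_n -> 'rV[R]_dx -> 'rV[R]_dx).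
Variables (m L kQ kG b : R).
Hypothesis n0 : (0 < n)%N.
Hypothesis m0 : 0 < m.
Hypothesis L0 : 0 <= L.
Hypothesis kG0 : 0 <= kG.
Hypothesis Ph_quad : forall i x h,
  `|Ph i (x + h) - Ph i x - dot (G i x) h| <= kQ * enorm h ^+ 2.
Hypothesis G_le : forall i x, enorm (G i x) <= L.
Hypothesis Ph_lip : forall i x x', `|Ph i x - Ph i x'| <= L * enorm (x - x').
Hypothesis G_lip : forall i x x', enorm (G i x - G i x') <= kG * enorm (x - x').
Hypothesis Ph_le : forall i x, `|Ph i x| <= b.

Definition obj_vec x : 'rV[R]_n := \row_i Ph i x.

Definition reg_obj x l : R :=
  \sum_(i < n) l 0 i * Ph i x - m / 2 * enorm (l - unif R n) ^+ 2.

Definition reg_max x : R := sup [set reg_obj x l | l in simplex R n].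

(** The maximizer of [reg_obj x] over the simplex, as [reg_objE] and [reg_obj_max] show. *)
Definition lstar x : 'rV[R]_n :=
  proj (simplex R n) (unif R n + m^-1 *: obj_vec x).

Definition mix_grad x l : 'rV[R]_dx := \sum_i l 0 i *: G i x.

Definition reg_grad x : 'rV[R]_dx := mix_grad x (lstar x).

Let splx_near := @simplex_nearest R n n0.
Let splx_conv := @simplex_convex R n.

Lemma lstar_simplex x : simplex R n (lstar x).
Proof. by have [] := projP splx_near (unif R n + m^-1 *: obj_vec x). Qed.

(* Completing the square in [l]. *)
Lemma reg_objE x l : reg_obj x l =
  - (m / 2) * enorm (unif R n + m^-1 *: obj_vec x - l) ^+ 2 +
  (dot (unif R n) (obj_vec x) + m^-1 / 2 * enorm (obj_vec x) ^+ 2).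
Proof.
rewrite /reg_obj.
have -> : \sum_(i < n) l 0 i * Ph i x = dot l (obj_vec x).
  by apply: eq_bigr => i _; rewrite mxE.
have mn : m != 0 by rewrite gt_eqF.
set u := unif R n; set v := obj_vec x.
rewrite !enorm_sqr !dotE (dotC v u) (dotC u l) (dotC v l).
by field.
Qed.

Lemma reg_obj_max x l : simplex R n l -> reg_obj x l <= reg_obj x (lstar x).
Proof.
move=> ls; rewrite !reg_objE lerD2r !mulNr lerN2 ler_wpM2l ?divr_ge0 ?(ltW m0)//.
rewrite enorm_sqr_le.
by have [_ h] := projP splx_near (unif R n + m^-1 *: obj_vec x); apply: h.
Qed.

Lemma reg_maxE x : reg_max x = reg_obj x (lstar x).
Proof.
have ub : ubound [set reg_obj x l | l in simplex R n] (reg_obj x (lstar x)).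
  by move=> _ [l ls <-]; exact: reg_obj_max.
have im : [set reg_obj x l | l in simplex R n] (reg_obj x (lstar x)).
  by exists (lstar x) => //; exact: lstar_simplex.
apply/eqP; rewrite eq_le; apply/andP; split.
  by apply: ge_sup => //; exists (reg_obj x (lstar x)).
by apply: ub_le_sup => //; exists (reg_obj x (lstar x)).
Qed.

Lemma obj_vec_lip x x' :
  enorm (obj_vec x - obj_vec x') ^+ 2 <= n%:R * L ^+ 2 * enorm (x - x') ^+ 2.
Proof.
rewrite enorm_sqr_sum.
have -> : n%:R * L ^+ 2 * enorm (x - x') ^+ 2 =
    \sum_(j < n) (L * enorm (x - x')) ^+ 2.
  by rewrite sumr_const card_ord exprMn -[RHS]mulr_natl [RHS]mulrA.
apply: ler_sum => j _; rewrite !mxE -real_normK ?num_real//.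
by rewrite ler_pXn2r ?nnegrE ?mulr_ge0 ?enorm_ge0.
Qed.

Lemma obj_vec_le x : enorm (obj_vec x) ^+ 2 <= n%:R * b ^+ 2.
Proof.
rewrite enorm_sqr_sum.
have -> : n%:R * b ^+ 2 = \sum_(j < n) b ^+ 2.
  by rewrite sumr_const card_ord -[RHS]mulr_natl.
apply: ler_sum => j _; rewrite !mxE -real_normK ?num_real//.
have b0 : 0 <= b by exact: le_trans (Ph_le j x).
by rewrite ler_pXn2r ?nnegrE.
Qed.

Lemma lstar_lip x x' : enorm (lstar x - lstar x') ^+ 2 <=
  n%:R * L ^+ 2 / m ^+ 2 * enorm (x - x') ^+ 2.
Proof.
have := proj_nonexpansive splx_conv splx_near (unif R n + m^-1 *: obj_vec x)
  (unif R n + m^-1 *: obj_vec x').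
rewrite -/(lstar x) -/(lstar x') -enorm_sqr_le => /le_trans; apply.
rewrite opprD addrACA subrr add0r -scalerBr enormZ exprMn.
rewrite real_normK ?num_real// exprVn [leRHS]mulrAC [leLHS]mulrC ler_wpM2r ?invr_ge0 ?sqr_ge0//.
exact: obj_vec_lip.
Qed.

(** The reason for the dual step size [m^-1]: if [h] is the exact gradient in [l], then
    [l + m^-1 *: h] is the point whose projection defines [lstar x], whatever [l] is. The rest is
    nonexpansiveness. *)
Lemma dual_step_dist x l (h : 'rV[R]_n) : enorm (proj (simplex R n) (l + m^-1 *: h) - lstar x) ^+ 2
  <= m ^- 2 * enorm (h - (obj_vec x - m *: (l - unif R n))) ^+ 2.
Proof.
have := proj_nonexpansive splx_conv splx_near (l + m^-1 *: h)
  (unif R n + m^-1 *: obj_vec x).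
rewrite -/(lstar x) -enorm_sqr_le => /le_trans; apply.
have -> : l + m^-1 *: h - (unif R n + m^-1 *: obj_vec x) =
    m^-1 *: (h - (obj_vec x - m *: (l - unif R n))).
  have mn : m != 0 by rewrite gt_eqF.
  move: (unif R n) (obj_vec x) => u v.
  by apply/rowP => j; rewrite !mxE; field.
by rewrite enormZ exprMn real_normK ?num_real// exprVn.
Qed.

Lemma mix_grad_le x l : simplex R n l -> enorm (mix_grad x l) <= L.
Proof.
move=> ls; rewrite -(@ler_pXn2r _ 2) ?nnegrE ?enorm_ge0//.
apply: le_trans (enorm_sqr_simplex _ ls) _.
have [l0 l1] := ls; rewrite -[leRHS]mul1r -l1 mulr_suml; apply: ler_sum => i _.
by rewrite ler_wpM2l// ler_pXn2r ?nnegrE ?enorm_ge0.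
Qed.

Lemma mix_grad_lipr x l l' :
  enorm (mix_grad x l - mix_grad x l') ^+ 2 <= n%:R * L ^+ 2 * enorm (l - l') ^+ 2.
Proof.
have -> : mix_grad x l - mix_grad x l' = \sum_i (l - l') 0 i *: G i x.
  by rewrite -sumrB; apply: eq_bigr => i _; rewrite !mxE scalerBl.
exact: enorm_sum_coord.
Qed.

Lemma mix_grad_lipl x x' l : simplex R n l ->
  enorm (mix_grad x l - mix_grad x' l) ^+ 2 <= kG ^+ 2 * enorm (x - x') ^+ 2.
Proof.
move=> ls.
have -> : mix_grad x l - mix_grad x' l = \sum_i l 0 i *: (G i x - G i x').
  by rewrite -sumrB; apply: eq_bigr => i _; rewrite scalerBr.
apply: le_trans (enorm_sqr_simplex _ ls) _.
have [l0 l1] := ls; rewrite -exprMn -[leRHS]mul1r -l1 mulr_suml.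
apply: ler_sum => i _.
by rewrite ler_wpM2l// ler_pXn2r ?nnegrE ?mulr_ge0 ?enorm_ge0.
Qed.

Definition kap_Psi : R := kQ + n%:R * L ^+ 2 / m.

Let reg_obj_diff x h l : simplex R n l ->
  `|reg_obj (x + h) l - reg_obj x l - dot (mix_grad x l) h| <= kQ * enorm h ^+ 2.
Proof.
move=> [l0 l1]; have -> : reg_obj (x + h) l - reg_obj x l - dot (mix_grad x l) h =
    \sum_i l 0 i * (Ph i (x + h) - Ph i x - dot (G i x) h).
  rewrite /reg_obj opprB addrA subrK -sumrB /mix_grad dot_suml -sumrB.
  by apply: eq_bigr => i _; rewrite dotZl; ring.
apply: le_trans (ler_norm_sum _ _ _) _.
rewrite -[leRHS]mul1r -l1 mulr_suml; apply: ler_sum => i _.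
by rewrite normrM ger0_norm// ler_wpM2l.
Qed.

Let scale_sqr_div (a e : R) : a * (a / m ^+ 2 * e) = (a / m) ^+ 2 * e.
Proof.
have mn : m != 0 by rewrite gt_eqF.
by field.
Qed.

Let mix_cross x x' h l l' : l = lstar x -> l' = lstar x' ->
  enorm h = enorm (x - x') ->
  `|dot (mix_grad x l' - mix_grad x l) h| <= n%:R * L ^+ 2 / m * enorm h ^+ 2.
Proof.
move=> lE l'E hE; apply: le_trans (cauchy_schwarz _ _) _.
rewrite [enorm h ^+ 2]expr2 [leRHS]mulrA ler_wpM2r ?enorm_ge0//.
have a0 : 0 <= n%:R * L ^+ 2 / m.
  apply: divr_ge0; last exact: ltW.
  by apply: mulr_ge0; [exact: ler0n | exact: sqr_ge0].
apply: ler_of_sqr; first by apply: mulr_ge0 => //; exact: enorm_ge0.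
apply: le_trans (mix_grad_lipr _ _ _) _.
have nL : 0 <= n%:R * L ^+ 2 by rewrite mulr_ge0 ?ler0n ?sqr_ge0.
rewrite lE l'E; apply: le_trans (ler_wpM2l nL (lstar_lip x' x)) _.
by rewrite (enormBC x') -hE exprMn -scale_sqr_div.
Qed.

(** An envelope theorem with a remainder. From below, [lstar x] competes at [x + h]; from above,
    [lstar (x + h)] competes at [x], and exchanging its gradient for that of [lstar x] costs
    [n L^2 / m] by [lstar_lip]. *)
Lemma reg_max_quadratic x h :
  `|reg_max (x + h) - reg_max x - dot (reg_grad x) h| <= kap_Psi * enorm h ^+ 2.
Proof.
rewrite !reg_maxE /reg_grad.
have ls := lstar_simplex x; have ls' := lstar_simplex (x + h).
have h3 := reg_obj_max (x + h) ls; have h4 := reg_obj_max x ls'.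
have h5 : `|dot (mix_grad x (lstar (x + h)) - mix_grad x (lstar x)) h|
    <= n%:R * L ^+ 2 / m * enorm h ^+ 2.
  by apply: (@mix_cross x (x + h)) => //; rewrite opprD addrA subrr add0r enormN.
move: (lstar x) (lstar (x + h)) ls ls' h3 h4 h5 => l l' ls ls' h3 h4 h5.
have h1 := reg_obj_diff x h ls; have h2 := reg_obj_diff x h ls'.
have h6 := le_trans (normr_ge0 _) h5.
rewrite dotBl in h5; rewrite /kap_Psi mulrDl.
move: h1 h2 h3 h4 h5 h6.
move: (reg_obj x l) (reg_obj x l') (reg_obj (x + h) l) (reg_obj (x + h) l').
move: (dot (mix_grad x l) h) (dot (mix_grad x l') h) => d1 d2 a1 a2 a3 a4.
rewrite !ler_norml => /andP[h11 h12] /andP[h21 h22] h3 h4 /andP[h51 h52] h6.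
by apply/andP; split; lra.
Qed.

Lemma grad_reg_max x : grad reg_max x = reg_grad x.
Proof. by apply: grad_quadratic => h; exact: reg_max_quadratic. Qed.

Lemma reg_grad_le x : enorm (reg_grad x) <= L.
Proof. by apply: mix_grad_le; exact: lstar_simplex. Qed.

Lemma reg_grad_lip x x' :
  enorm (reg_grad x - reg_grad x') <= (kG + n%:R * L ^+ 2 / m) * enorm (x - x').
Proof.
apply: le_trans (enormB_trans (mix_grad x' (lstar x)) _ _) _; rewrite mulrDl.
apply: lerD.
  rewrite -(@ler_pXn2r _ 2) ?nnegrE ?mulr_ge0 ?enorm_ge0// exprMn.
  by apply: mix_grad_lipl; exact: lstar_simplex.
have a0 : 0 <= n%:R * L ^+ 2 / m.
  apply: divr_ge0; last exact: ltW.
  by apply: mulr_ge0; [exact: ler0n | exact: sqr_ge0].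
apply: ler_of_sqr; first by apply: mulr_ge0 => //; exact: enorm_ge0.
apply: le_trans (mix_grad_lipr _ _ _) _.
have nL : 0 <= n%:R * L ^+ 2 by rewrite mulr_ge0 ?ler0n ?sqr_ge0.
apply: le_trans (ler_wpM2l nL (lstar_lip x x')) _.
by rewrite exprMn -scale_sqr_div.
Qed.

Lemma reg_max_bound x : m <= 1 -> `|reg_max x| <= b + 2.
Proof.
move=> m1; rewrite reg_maxE /reg_obj.
have [l0 l1] := lstar_simplex x.
have h1 : `|\sum_(i < n) (lstar x) 0 i * Ph i x| <= b.
  apply: le_trans (ler_norm_sum _ _ _) _; rewrite -[leRHS]mul1r -l1 mulr_suml.
  by apply: ler_sum => i _; rewrite normrM ger0_norm// ler_wpM2l.
have h2 := simplex_dist (lstar_simplex x) (@simplex_unif R n n0).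
have h3 : 0 <= m * enorm (lstar x - unif R n) ^+ 2.
  by rewrite mulr_ge0 ?(ltW m0) ?sqr_ge0.
have h4 : m * enorm (lstar x - unif R n) ^+ 2 <= 1 * 4.
  by apply: ler_pM; rewrite ?(ltW m0) ?sqr_ge0.
move: h1; rewrite !ler_norml => /andP[h11 h12].
by apply/andP; split; lra.
Qed.

End MinMax.

(** * Projected gradient steps with an inexact gradient *)

Section ProjectedGradient.
Context {R : realType} {d : nat} (X : set 'rV[R]_d) (g : 'rV[R]_d -> 'rV[R]_d).
Implicit Types x q : 'rV[R]_d.
Variables (tau : R).
Hypothesis tau0 : 0 < tau.
Hypothesis Xconv : forall p q t, X p -> X q -> 0 <= t <= 1 ->
  X (p + t *: (q - p)).
Hypothesis Xnear : forall x, exists p,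
  X p /\ forall q, X q -> enorm (x - p) <= enorm (x - q).

Definition prox_map x : 'rV[R]_d := tau^-1 *: (x - proj X (x - tau *: g x)).

Lemma prox_map_le x : X x -> enorm (prox_map x) <= enorm (g x).
Proof.
move=> Xx; rewrite /prox_map -[x in x - _](proj_id Xconv Xnear Xx) enormZ.
rewrite ger0_norm ?invr_ge0 ?(ltW tau0)// mulrC ler_pdivrMr//.
apply: le_trans (proj_nonexpansive Xconv Xnear _ _) _.
by rewrite opprB addrC subrK enormZ gtr0_norm// mulrC.
Qed.

(** The step actually taken, along [h], plus the distance between two projections, which
    nonexpansiveness bounds by the gradient error. *)
Lemma prox_map_inexact x h : enorm (prox_map x) ^+ 2 <=
  2 / tau ^+ 2 * enorm (proj X (x - tau *: h) - x) ^+ 2 +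
  2 * enorm (h - g x) ^+ 2.
Proof.
have -> : prox_map x = - (tau^-1 *: (proj X (x - tau *: h) - x)) +
    tau^-1 *: (proj X (x - tau *: h) - proj X (x - tau *: g x)).
  rewrite /prox_map; move: (proj X _) (proj X _) => p p'.
  by apply/rowP => j; rewrite !mxE; ring.
apply: le_trans (enorm_sqrD_le _ _) _.
rewrite enormN !enormZ !exprMn !real_normK ?num_real// exprVn mulrA lerD2l.
rewrite ler_pM2l// mulrC ler_pdivrMr ?exprn_gt0//.
rewrite -[tau ^+ 2](@real_normK _ tau) ?num_real// [leRHS]mulrC -exprMn -enormZ.
rewrite enorm_sqr_le; apply: le_trans (proj_nonexpansive Xconv Xnear _ _) _.
have -> : x - tau *: h - (x - tau *: g x) = - (tau *: (h - g x)).
  by apply/rowP => j; rewrite !mxE; ring.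
by rewrite enormN.
Qed.

(** The variational inequality of the projection, tested at [x]. *)
Lemma prox_descent x h : X x ->
  dot h (proj X (x - tau *: h) - x) <= - tau^-1 * enorm (proj X (x - tau *: h) - x) ^+ 2.
Proof.
move=> Xx; have := proj_obtuse Xconv Xnear (x - tau *: h) Xx.
set p := proj X _ => ob.
have h1 : tau * dot h (p - x) <= - enorm (p - x) ^+ 2.
  rewrite enorm_sqr; move: ob; rewrite !dotE !(dotC p x); lra.
rewrite -(ler_pM2l tau0); apply: le_trans h1 _.
by rewrite mulrA mulrN mulfV ?gt_eqF// mulN1r.
Qed.

Lemma prox_map_continuous K :
  (forall x x', enorm (g x - g x') <= K * enorm (x - x')) ->
  continuous (fun x => enorm (prox_map x)).
Proof.
move=> gl; apply: (@lipschitz_continuous _ _ _ (tau^-1 * (2 + tau * K))) => x y.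
apply: le_trans (enorm_distl _ _) _.
rewrite /prox_map -scalerBr enormZ ger0_norm ?invr_ge0 ?(ltW tau0)// -mulrA.
rewrite ler_pM2l ?invr_gt0//.
have -> : x - proj X (x - tau *: g x) - (y - proj X (y - tau *: g y)) =
  (x - y) - (proj X (x - tau *: g x) - proj X (y - tau *: g y)).
  move: (proj X _) (proj X _) => p p'.
  by apply/rowP => j; rewrite !mxE; ring.
apply: le_trans (enormB _ _) _; rewrite -[2]/(1 + 1) -addrA mulrDl mul1r lerD2l.
apply: le_trans (proj_nonexpansive Xconv Xnear _ _) _.
have -> : x - tau *: g x - (y - tau *: g y) = (x - y) - tau *: (g x - g y).
  by apply/rowP => j; rewrite !mxE; ring.
apply: le_trans (enormB _ _) _; rewrite mulrDl mul1r lerD2l.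
by rewrite enormZ gtr0_norm// -mulrA ler_pM2l.
Qed.

End ProjectedGradient.

(** * Conditional expectations *)

Section Expectation.
Context {d : measure_display} {T : measurableType d} {R : realType}.
Variable P : probability T R.
Implicit Types (X Y Z W : T -> R) (a : R).

Definition Ex X : R := Rintegral P setT X.
Definition L1 X : Prop := P.-integrable setT (EFin \o X).
Definition L2 X : Prop :=
  measurable_fun setT X /\ L1 (fun w => X w ^+ 2).

Lemma L1_meas X : L1 X -> measurable_fun setT X.
Proof. by move=> /measurable_int/measurable_EFinP. Qed.

Lemma L1_ext X Y : X =1 Y -> L1 X -> L1 Y.
Proof. by move=> /funext ->. Qed.

Lemma Ex_ext X Y : X =1 Y -> Ex X = Ex Y.
Proof. by move=> /funext ->. Qed.

Lemma L1D X Y : L1 X -> L1 Y -> L1 (fun w => X w + Y w).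
Proof. by move=> hX hY; have := integrableD measurableT hX hY. Qed.

Lemma L1Z a X : L1 X -> L1 (fun w => a * X w).
Proof. by move=> hX; have := integrableZl measurableT a hX. Qed.

Lemma L1N X : L1 X -> L1 (fun w => - X w).
Proof. by move=> /(L1Z (-1)); apply: L1_ext => w; rewrite mulN1r. Qed.

Lemma L1B X Y : L1 X -> L1 Y -> L1 (fun w => X w - Y w).
Proof. by move=> hX /L1N; exact: L1D. Qed.

Lemma L1_cst a : L1 (fun=> a).
Proof. exact: finite_measure_integrable_cst. Qed.

Lemma L1_dom X Y : measurable_fun setT X -> L1 Y ->
  (forall w, `|X w| <= Y w) -> L1 X.
Proof.
move=> mX hY XY; apply: (le_integrable measurableT _ _ hY).
  exact/measurable_EFinP.
move=> w _ /=; rewrite lee_fin; apply: le_trans (XY w) (ler_norm _).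
Qed.

Lemma L1_sum (I : Type) (s : seq I) (F : I -> T -> R) :
  (forall i, L1 (F i)) -> L1 (fun w => \sum_(i <- s) F i w).
Proof.
move=> h; elim: s => [|i s IH].
  by apply: L1_ext (L1_cst 0) => w; rewrite big_nil.
by apply: L1_ext (L1D (h i) IH) => w; rewrite big_cons.
Qed.

Lemma ExD X Y : L1 X -> L1 Y -> Ex (fun w => X w + Y w) = Ex X + Ex Y.
Proof. by move=> hX hY; rewrite /Ex RintegralD. Qed.

Lemma ExZ a X : L1 X -> Ex (fun w => a * X w) = a * Ex X.
Proof. by move=> hX; rewrite /Ex RintegralZl. Qed.

Lemma ExN X : L1 X -> Ex (fun w => - X w) = - Ex X.
Proof.
by move=> hX; rewrite -mulN1r -ExZ//; apply: Ex_ext => w; rewrite mulN1r.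
Qed.

Lemma ExB X Y : L1 X -> L1 Y -> Ex (fun w => X w - Y w) = Ex X - Ex Y.
Proof. by move=> hX hY; rewrite ExD ?ExN//; exact: L1N. Qed.

Lemma Ex_cst a : Ex (fun=> a) = a.
Proof.
rewrite /Ex Rintegral_cst//; have -> : fine (P setT) = 1.
  by rewrite (@probability_setT _ _ _ P).
exact: mulr1.
Qed.

Lemma Ex_sum (I : Type) (s : seq I) (F : I -> T -> R) :
  (forall i, L1 (F i)) ->
  Ex (fun w => \sum_(i <- s) F i w) = \sum_(i <- s) Ex (F i).
Proof.
move=> h; elim: s => [|i s IH].
  by rewrite big_nil -[RHS]Ex_cst; apply: Ex_ext => w; rewrite big_nil.
rewrite big_cons -IH -ExD//; last exact: L1_sum.
by apply: Ex_ext => w; rewrite big_cons.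
Qed.

Lemma Ex_le X Y : L1 X -> L1 Y -> (forall w, X w <= Y w) -> Ex X <= Ex Y.
Proof. by move=> hX hY XY; apply: le_Rintegral. Qed.

Lemma Ex_ge0 X : (forall w, 0 <= X w) -> 0 <= Ex X.
Proof. by move=> h; apply: Rintegral_ge0. Qed.

Lemma ExE X : L1 X -> (\int[P]_w (X w)%:E)%E = (Ex X)%:E.
Proof.
by move=> hX; rewrite /Ex /Rintegral fineK//; exact: integrable_fin_num hX.
Qed.

Lemma L2_dom X Y : measurable_fun setT X -> L1 Y ->
  (forall w, X w ^+ 2 <= Y w) -> L2 X.
Proof.
move=> mX hY h; split => //; apply: (L1_dom _ hY); first exact: measurable_funX.
by move=> w; rewrite ger0_norm ?sqr_ge0.
Qed.

Lemma L2M X Y : L2 X -> L2 Y -> L1 (fun w => X w * Y w).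
Proof.
move=> [mX hX] [mY hY]; apply: L1_dom (L1D hX hY) _; first exact: measurable_funM.
move=> w; rewrite normrM; have := sqr_ge0 (`|X w| - `|Y w|).
rewrite sqrrB !real_normK ?num_real//.
by have := mulr_ge0 (normr_ge0 (X w)) (normr_ge0 (Y w)); lra.
Qed.

(** Replacing [X] by [min (X, Y)], almost surely equal to it, makes the inequality hold
    everywhere. *)
Lemma Ex_ae_le X Y : L1 X -> L1 Y -> {ae P, forall w, X w <= Y w} -> Ex X <= Ex Y.
Proof.
move=> hX hY XY; pose X' w := Order.min (X w) (Y w).
have mX' : measurable_fun setT X' by apply: measurable_minr; exact: L1_meas.
have hX' : L1 X'.
  apply: (L1_dom mX' (L1D (integrable_norm hX) (integrable_norm hY))) => w.
  rewrite /X' /Order.min /=; case: ltP => _.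
    by rewrite lerDl.
  by rewrite lerDr.
have -> : Ex X = Ex X'.
  congr fine; apply: ae_eq_integral => //; try exact: measurable_int.
  - exact: measurable_int hX.
  - exact: measurable_int hX'.
  - by apply: filterS XY => w XYw _ /=; rewrite /X' min_l.
by apply: Ex_le => // w; rewrite /X' ge_min lexx orbT.
Qed.

Section Conditioning.
Variable U : set (set T).
Hypothesis UT : <<s U >> `<=` measurable.
Local Notation TU := (g_sigma_algebraType U).

(** Measurability for the sigma-algebra [<<s U >>]: a sigma-algebra is attached to a type, so [T] is
    viewed as the convertible type [TU]. *)
Definition hist_meas X : Prop := measurable_fun (setT : set TU) (X : TU -> R).

Lemma hist_meas_meas X : hist_meas X -> measurable_fun setT X.
Proof. by move=> h _ B mB; apply: UT; exact: h. Qed.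

Import HBSimple HBNNSimple.

Lemma indic_dom (B : set T) D : measurable B -> L1 D ->
  L1 (fun w => \1_B w * D w).
Proof.
move=> mB hD; apply: (L1_dom _ (integrable_norm hD)).
  by apply: measurable_funM (L1_meas hD); exact: measurable_indic.
move=> w; rewrite normrM ler_piMl// indicE ger0_norm ?ler0n//.
by case: (_ \in _); rewrite ?lexx ?ler01.
Qed.

Let simple_ge0 D (f : {nnsfun TU >-> R}) : L1 D ->
  (forall B, <<s U >> B -> 0 <= Ex (fun w => \1_B w * D w)) ->
  L1 (fun w => f w * D w) /\ 0 <= Ex (fun w => f w * D w).
Proof.
move=> hD hB.
pose s := finmap.enum_fset (fset_set (range f)); pose B y : set T := f @^-1` [set y].
have GB y : <<s U >> (B y) by exact: (measurable_sfunP f).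
have E w : f w * D w = \sum_(y <- s) y * (\1_(B y) w * D w).
  rewrite fimfunE fsbig_finite//= mulr_suml.
  by apply: eq_bigr => y _; rewrite mulrA.
have h y : L1 (fun w => y * (\1_(B y) w * D w)).
  by apply/L1Z/indic_dom => //; apply: UT.
split; first by apply: L1_ext (L1_sum s h) => w; rewrite E.
rewrite (Ex_ext E) Ex_sum// big_seq; apply: sumr_ge0 => y.
rewrite in_fset_set// inE => -[w _ <-]; rewrite ExZ.
  by rewrite mulr_ge0// hB.
by apply: indic_dom => //; exact: UT.
Qed.

(** An inequality known on the sets of the history extends to nonnegative history-measurable
    weights: simple functions increase to [A], and [|A D|] dominates. *)
Lemma hist_pair_ge0 A D : L1 D ->
  (forall B, <<s U >> B -> 0 <= Ex (fun w => \1_B w * D w)) ->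
  hist_meas A -> (forall w, 0 <= A w) -> L1 (fun w => A w * D w) ->
  0 <= Ex (fun w => A w * D w).
Proof.
move=> hD hB mA A0 hAD.
have mA' : measurable_fun setT (EFin \o A : TU -> \bar R) by exact/measurable_EFinP.
pose f n := nnsfun_approx (measurableT : measurable (setT : set TU)) mA' n.
have cvf w : (fun n => f n w) @ \oo --> A w.
  have := @cvg_nnsfun_approx _ _ _ _ measurableT _ mA' (fun x _ => A0 x) w I.
  by move=> /fine_cvgP[_].
have ndf w : {homo (fun n => f n w) : n m / (n <= m)%N >-> n <= m}.
  by move=> n m nm; have /lefP := @nd_nnsfun_approx _ _ _ _ measurableT _ mA' n m nm; apply.
have fA n w : f n w <= A w.
  have := nondecreasing_cvgn_le (ndf w); move=> /(_ (cvgP _ (cvf w)) n).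
  by rewrite (cvg_lim _ (cvf w)).
have [] := @dominated_convergence _ T R P setT measurableT
  (fun n => EFin \o (fun w => f n w * D w)) (EFin \o (fun w => A w * D w))
  (fun w => `|A w * D w|%:E).
- by move=> n; exact: measurable_int (proj1 (simple_ge0 (f n) hD hB)).
- exact: measurable_int hAD.
- apply: aeW => w _; apply/fine_cvgP; split; first exact: nearW.
  by apply: cvgM; [exact: cvf | exact: cvg_cst].
- exact: (integrable_norm hAD).
- apply: aeW => w n _ /=; rewrite lee_fin !normrM ler_wpM2r//.
  by rewrite !ger0_norm.
move=> _ _ c; rewrite /Ex /Rintegral fine_ge0//.
rewrite -(cvg_lim _ c)//; apply: lime_ge; first exact: cvgP c.
apply: nearW => n /=.
by have [i1 i2] := simple_ge0 (f n) hD hB; rewrite ExE// lee_fin.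
Qed.

(** Both signs of [D], then the positive and negative parts of [A]. *)
Lemma hist_pair_eq0 A D : L1 D ->
  (forall B, <<s U >> B -> Ex (fun w => \1_B w * D w) = 0) ->
  hist_meas A -> L1 (fun w => A w * D w) -> Ex (fun w => A w * D w) = 0.
Proof.
move=> hD hB mA hAD.
have pos A' : hist_meas A' -> (forall w, 0 <= A' w) ->
    L1 (fun w => A' w * D w) -> Ex (fun w => A' w * D w) = 0.
  move=> mA' A'0 hA'D; apply/eqP; rewrite eq_le; apply/andP; split; last first.
    by apply: hist_pair_ge0 => // B GB; rewrite hB.
  rewrite -oppr_ge0 -ExN//.
  rewrite (@Ex_ext _ (fun w => A' w * - D w)); last by move=> w; rewrite mulrN.
  apply: hist_pair_ge0 => //; first exact: L1N.
    move=> B GB; rewrite (@Ex_ext _ (fun w => - (\1_B w * D w))).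
      by rewrite ExN ?hB ?oppr0//; apply: indic_dom => //; exact: UT.
    by move=> w; rewrite mulrN.
  by apply: L1_ext (L1N hA'D) => w; rewrite mulrN.
have mD := L1_meas hD.
have m0 (c : R) : hist_meas (fun=> c) by exact: measurable_cst.
pose Ap w := Order.max (A w) 0; pose An w := Order.max (- A w) 0.
have mAp : hist_meas Ap by exact: measurable_maxr.
have mAn : hist_meas An.
  by apply: measurable_maxr => //; exact: measurableT_comp mA.
have E w : A w = Ap w - An w.
  by rewrite /Ap /An /Order.max; case: ltP => h1; case: ltP => h2; lra.
have part A' : hist_meas A' -> (forall w, `|A' w| <= `|A w|) ->
    L1 (fun w => A' w * D w).
  move=> mA' h; apply: L1_dom (integrable_norm hAD) _.
    by apply: measurable_funM mD; exact: hist_meas_meas.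
  by move=> w /=; rewrite !normrM ler_wpM2r.
have hp : L1 (fun w => Ap w * D w).
  apply: part => // w; rewrite /Ap /Order.max; case: ltP => //.
  by rewrite normr0.
have hn : L1 (fun w => An w * D w).
  apply: part => // w; rewrite /An /Order.max; case: ltP => //.
    by rewrite normr0.
  by rewrite normrN.
rewrite (@Ex_ext _ (fun w => Ap w * D w - An w * D w)); last first.
  by move=> w; rewrite -mulrBl -E.
rewrite ExB// !pos ?subr0// => w; rewrite /Ap /An le_max lexx orbT//.
Qed.

Lemma Ex_indic (B : set T) X : measurable B -> L1 X ->
  (\int[P]_(w in B) (X w)%:E)%E = (Ex (fun w => \1_B w * X w))%:E.
Proof.
move=> mB hX; rewrite -ExE; last exact: indic_dom.
rewrite integral_mkcond; apply: eq_integral => w _.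
by rewrite patchE indicE; case: (_ \in _); rewrite ?mul1r ?mul0r.
Qed.

(** Taking out what is known: a version of the conditional expectation is defined by its integrals
    over sets, and here the indicator becomes a history-measurable factor. *)
Lemma cond_exp_pair X M A : is_cond_exp P <<s U >> X M -> hist_meas A ->
  L1 (fun w => A w * (X w - M w)) -> Ex (fun w => A w * (X w - M w)) = 0.
Proof.
move=> [hX hM _ h] mA; apply: hist_pair_eq0 => //; first exact: L1B.
move=> B GB; have mB := UT GB; have := h B GB.
rewrite !Ex_indic// => -[E].
rewrite (@Ex_ext _ (fun w => \1_B w * X w - \1_B w * M w)).
  by rewrite ExB ?E ?subrr//; exact: indic_dom.
by move=> w; rewrite mulrBr.
Qed.

(** [W Z^2] is not known to be integrable beforehand. For the truncations [min (W, m)] it is, with a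
    bound uniform in [m], and monotone convergence gives the integrability and the estimate
    together. *)
Lemma cond_sq_le_pair Z (s : R) W : cond_sq_le P <<s U >> Z s ->
  hist_meas W -> (forall w, 0 <= W w) -> L1 W ->
  L1 (fun w => W w * Z w ^+ 2) /\
  Ex (fun w => W w * Z w ^+ 2) <= s ^+ 2 * Ex W.
Proof.
move=> [V [[hZ hV _ hVZ] Vs]] mW W0 hW.
have mZ := L1_meas hZ.
have hD : L1 (fun w => s ^+ 2 - Z w ^+ 2) by apply: L1B => //; exact: L1_cst.
have hB B : <<s U >> B -> 0 <= Ex (fun w => \1_B w * (s ^+ 2 - Z w ^+ 2)).
  move=> GB; have mB := UT GB.
  have hS : L1 (fun w => \1_B w * s ^+ 2) by apply: indic_dom => //; exact: L1_cst.
  have hV' : L1 (fun w => \1_B w * V w) by exact: indic_dom.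
  have hZ' : L1 (fun w => \1_B w * Z w ^+ 2) by exact: indic_dom.
  rewrite (@Ex_ext _ (fun w => \1_B w * s ^+ 2 - \1_B w * Z w ^+ 2)); last first.
    by move=> w; rewrite mulrBr.
  rewrite ExB// subr_ge0; have := hVZ B GB.
  rewrite !Ex_indic// => -[<-].
  apply: Ex_ae_le => //; apply: filterS Vs => w Vw.
  by rewrite ler_wpM2l// indicE ler0n.
pose Wm m w := Order.min (W w) m%:R.
have Wm0 m w : 0 <= Wm m w by rewrite le_min W0 ler0n.
have WmW m w : Wm m w <= W w by rewrite ge_min lexx.
have mWm m : hist_meas (Wm m) by apply: measurable_minr => //; exact: measurable_cst.
have mWm' m : measurable_fun setT (Wm m) by exact: hist_meas_meas.
have lWm m : L1 (Wm m).
  by apply: L1_dom hW _ => // w; rewrite ger0_norm.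
have lWmZ m : L1 (fun w => Wm m w * Z w ^+ 2).
  apply: (L1_dom _ (L1Z m%:R hZ)).
    exact: measurable_funM.
  move=> w; rewrite normrM (ger0_norm (Wm0 m w)) (ger0_norm (sqr_ge0 _)).
  by apply: ler_wpM2r; [exact: sqr_ge0 | rewrite ge_min lexx orbT].
have le m : Ex (fun w => Wm m w * Z w ^+ 2) <= s ^+ 2 * Ex W.
  apply: le_trans (_ : s ^+ 2 * Ex (Wm m) <= _); last first.
    by rewrite ler_wpM2l ?sqr_ge0// Ex_le.
  rewrite -subr_ge0 -ExZ// -ExB//; last exact: L1Z.
  have E w : s ^+ 2 * Wm m w - Wm m w * Z w ^+ 2 = Wm m w * (s ^+ 2 - Z w ^+ 2) by ring.
  rewrite (Ex_ext E); apply: hist_pair_ge0 => //.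
  by apply: L1_ext E _; apply: L1B => //; exact: L1Z.
have mWZ : measurable_fun setT (fun w => W w * Z w ^+ 2).
  by apply: measurable_funM => //; exact: hist_meas_meas.
have WZ0 w : 0 <= W w * Z w ^+ 2 by rewrite mulr_ge0 ?sqr_ge0.
pose F m w := Wm m w * Z w ^+ 2.
have := @cvg_monotone_convergence _ T R P setT measurableT (fun m => EFin \o F m).
have i1 m : measurable_fun setT (EFin \o F m).
  by apply/measurable_EFinP; exact: L1_meas (lWmZ m).
have i2 m (w : T) : [set: T] w -> (0 <= (EFin \o F m) w)%E.
  by rewrite /F /= lee_fin mulr_ge0 ?sqr_ge0.
have i3 (w : T) : [set: T] w -> nondecreasing_seq (fun m => (EFin \o F m) w).
  move=> _ m k mk; rewrite /F /= lee_fin ler_wpM2r ?sqr_ge0//.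
  by rewrite le_min2// ler_nat.
move=> /(_ i1 i2 i3) c.
have key : (\int[P]_w (W w * Z w ^+ 2)%:E <= (s ^+ 2 * Ex W)%:E)%E.
  have E w : limn (fun m => (EFin \o F m) w) = (W w * Z w ^+ 2)%:E.
    apply: lim_near_cst => //; near=> m.
    rewrite /F /Wm /= min_l//; near: m; exact: nbhs_infty_ger.
  rewrite (eq_integral _ _ (fun w _ => esym (E w))).
  rewrite -(cvg_lim _ c)//; apply: lime_le; first exact: cvgP c.
  by apply: nearW => m; rewrite /= (ExE (lWmZ m)) lee_fin.
have hWZ : L1 (fun w => W w * Z w ^+ 2).
  apply/integrableP; split; first exact/measurable_EFinP.
  under eq_integral => w _ do rewrite /= ger0_norm//.
  by apply: le_lt_trans key _; rewrite ltry.
by split => //; rewrite -lee_fin -ExE.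
Unshelve. all: by end_near. Qed.

End Conditioning.
End Expectation.

(** * Measurability of vector-valued maps, coordinate by coordinate *)

Section VectorMeasurability.
Context {d0 : measure_display} {T : measurableType d0} {R : realType}.

Definition vec_meas d (X : T -> 'rV[R]_d) : Prop :=
  forall j, measurable_fun setT (fun w => X w 0 j).

Let box d (q : 'rV[rat]_d) (m : nat) : set 'rV[R]_d :=
  [set v | forall j, `|ratr (q 0 j) - v 0 j| < m.+1%:R^-1].

Let box_measurable d (X : T -> 'rV[R]_d) q m : vec_meas X ->
  measurable (X @^-1` box q m).
Proof.
move=> mX.
have -> : X @^-1` box q m =
    \bigcap_(j in [set: 'I_d]) [set w | `|ratr (q 0 j) - X w 0 j| < m.+1%:R^-1].
  by apply/seteqP; split => [w h j _|w h j]; exact: h.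
apply: fin_bigcap_measurable => [|j _]; first exact: finite_finset.
have -> : [set w | `|ratr (q 0 j) - X w 0 j| < m.+1%:R^-1] =
  setT `&` (fun w => `|ratr (q 0 j) - X w 0 j|) @^-1` `]-oo, m.+1%:R^-1[.
  by rewrite setTI; apply/seteqP; split => w /=; rewrite in_itv.
have mf : measurable_fun setT (fun w => `|ratr (q 0 j) - X w 0 j|).
  by apply: measurableT_comp => //; exact: measurable_funB.
exact: mf.
Qed.

(** An open set is the union of the rational boxes that it contains. They are countably many,
    enumerated through [unpickle], and the preimage of each is a finite intersection over the
    coordinates. *)
Lemma preimage_open_measurable d (X : T -> 'rV[R]_d) (V : set 'rV[R]_d) :
  vec_meas X -> open V -> measurable (X @^-1` V).
Proof.
move=> mX oV.
pose A (k : nat) : set T :=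
  if unpickle k is Some (q, m) then
    if `[< box q m `<=` V >] then X @^-1` box q m else set0
  else set0.
have -> : X @^-1` V = \bigcup_k A k.
  apply/seteqP; split => [w Vw|w [k _]]; last first.
    rewrite /A; case: unpickle => [[q m]|//].
    by case: asboolP => // sub /sub.
  have := oV _ Vw => /nbhs_ballP[e /= e0 eV].
  (* The box is centred at a rational point within [1 / (m + 1)] of [X w], so all its points are
     within twice that distance, less than [e]. *)
  have [m me] : exists m, m.+1%:R^-1 < e / 2.
    exists (Num.bound (e / 2)^-1).
    have e20 : 0 < e / 2 by rewrite divr_gt0.
    rewrite -[ltRHS]invrK ltf_pV2 ?posrE ?invr_gt0//.
    apply: lt_le_trans (archi_boundP _) _; first by rewrite invr_ge0 ltW.
    by rewrite ler_nat.
  have /choice[q hq] : forall j, exists r : rat, `|ratr r - X w 0 j| < m.+1%:R^-1.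
    move=> j; have m0 : 0 < m.+1%:R^-1 :> R by rewrite invr_gt0 ltr0n.
    move: (m.+1%:R^-1) m0 => t m0.
    have lt : X w 0 j - t < X w 0 j + t by lra.
    have [r] := rat_in_itvoo lt; rewrite in_itv /= => /andP[r1 r2].
    by exists r; rewrite ltr_norml; apply/andP; split; lra.
  pose qv := \row_j q j.
  have inb : box qv m (X w) by move=> j; rewrite mxE; exact: hq.
  exists (pickle (qv, m)) => //; rewrite /A pickleK.
  case: asboolP => //; case=> v vb; apply: eV; split => // i j.
  rewrite (ord1 i) /ball /= ; apply: le_lt_trans (ler_distD (ratr (qv 0 j)) _ _) _.
  have := inb j; have := vb j; move: (m.+1%:R^-1) me => t me.
  by rewrite (distrC (X w 0 j)); lra.
apply: bigcupT_measurable => k; rewrite /A; case: unpickle => [[q m]|//].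
by case: asboolP => // _; exact: box_measurable.
Qed.

Lemma continuous_comp_meas d (X : T -> 'rV[R]_d) (F : 'rV[R]_d -> R) :
  continuous F -> vec_meas X -> measurable_fun setT (fun w => F (X w)).
Proof.
move=> cF mX; apply: (measurability _ (RGenOInfty.measurableE R)).
move=> _ [_ [a ->] <-]; rewrite setTI.
have -> : (fun w => F (X w)) @^-1` `]a, +oo[ = X @^-1` (F @^-1` `]a, +oo[).
  by [].
apply: preimage_open_measurable => //.
by apply: open_comp => // x _; exact: cF.
Qed.

Definition econtinuous d e (G : 'rV[R]_d -> 'rV[R]_e) : Prop :=
  forall j, continuous (fun p => G p 0 j).

Lemma vec_meas_comp d e (X : T -> 'rV[R]_d) (G : 'rV[R]_d -> 'rV[R]_e) :
  econtinuous G -> vec_meas X -> vec_meas (fun w => G (X w)).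
Proof. by move=> cG mX j; exact: (continuous_comp_meas (cG j) mX). Qed.

Lemma vec_meas_cst d (v : 'rV[R]_d) : vec_meas (fun=> v).
Proof. by move=> j; exact: measurable_cst. Qed.

Lemma vec_measD d (X Y : T -> 'rV[R]_d) :
  vec_meas X -> vec_meas Y -> vec_meas (fun w => X w + Y w).
Proof.
move=> hX hY j; rewrite (_ : (fun w => _) = (fun w => X w 0 j + Y w 0 j)).
  exact: measurable_funD.
by apply/funext => w; rewrite mxE.
Qed.

Lemma vec_measZ d (f : T -> R) (X : T -> 'rV[R]_d) :
  measurable_fun setT f -> vec_meas X -> vec_meas (fun w => f w *: X w).
Proof.
move=> hf hX j; rewrite (_ : (fun w => _) = (fun w => f w * X w 0 j)).
  exact: measurable_funM.
by apply/funext => w; rewrite mxE.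
Qed.

Lemma vec_measN d (X : T -> 'rV[R]_d) : vec_meas X -> vec_meas (fun w => - X w).
Proof.
move=> hX j; rewrite (_ : (fun w => _) = (fun w => - (X w 0 j))).
  exact: measurableT_comp.
by apply/funext => w; rewrite mxE.
Qed.

Lemma vec_measB d (X Y : T -> 'rV[R]_d) :
  vec_meas X -> vec_meas Y -> vec_meas (fun w => X w - Y w).
Proof. by move=> hX /vec_measN; exact: vec_measD. Qed.

Lemma vec_meas_sum d (I : Type) (s : seq I) (F : I -> T -> 'rV[R]_d) :
  (forall i, vec_meas (F i)) -> vec_meas (fun w => \sum_(i <- s) F i w).
Proof.
move=> h; elim: s => [|i s IH].
  rewrite (_ : (fun w => _) = (fun=> 0)); first exact: vec_meas_cst.
  by apply/funext => w; rewrite big_nil.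
rewrite (_ : (fun w => _) = (fun w => F i w + \sum_(j <- s) F j w)).
  exact: vec_measD.
by apply/funext => w; rewrite big_cons.
Qed.

Lemma vec_meas_row_mx d e (X : T -> 'rV[R]_d) (Y : T -> 'rV[R]_e) :
  vec_meas X -> vec_meas Y -> vec_meas (fun w => row_mx (X w) (Y w)).
Proof.
move=> hX hY j; case: (split_ordP j) => k ->.
  rewrite (_ : (fun w => _) = (fun w => X w 0 k)) //.
  by apply/funext => w; rewrite row_mxEl.
rewrite (_ : (fun w => _) = (fun w => Y w 0 k)) //.
by apply/funext => w; rewrite row_mxEr.
Qed.

Lemma dot_meas d (X Y : T -> 'rV[R]_d) : vec_meas X -> vec_meas Y ->
  measurable_fun setT (fun w => dot (X w) (Y w)).
Proof.
move=> hX hY; rewrite /dot; elim: (index_enum _) => [|j s IH].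
  rewrite (_ : (fun w => _) = (fun=> 0)); first exact: measurable_cst.
  by apply/funext => w; rewrite big_nil.
rewrite (_ : (fun w => _) =
    (fun w => X w 0 j * Y w 0 j + \sum_(j <- s) X w 0 j * Y w 0 j)).
  by apply: measurable_funD => //; exact: measurable_funM.
by apply/funext => w; rewrite big_cons.
Qed.

Lemma enorm_meas d (X : T -> 'rV[R]_d) : vec_meas X ->
  measurable_fun setT (fun w => enorm (X w)).
Proof. exact: continuous_comp_meas (@enorm_continuous R d). Qed.

Definition mx_meas m n (A : T -> 'M[R]_(m, n)) : Prop :=
  forall i j, measurable_fun setT (fun w => A w i j).

Lemma mxapp_meas m n (A : T -> 'M[R]_(m, n)) (X : T -> 'rV[R]_n) :
  mx_meas A -> vec_meas X -> vec_meas (fun w => mxapp (A w) (X w)).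
Proof.
move=> hA hX i; rewrite (_ : (fun w => _) = (fun w => dot (X w) (row i (A w)))).
  apply: dot_meas => // j; rewrite (_ : (fun w => _) = (fun w => A w i j)) //.
  by apply/funext => w; rewrite mxE.
by apply/funext => w; rewrite mxappE; apply: eq_bigr => j _; rewrite mxE.
Qed.

Lemma mx_measB m n (A B : T -> 'M[R]_(m, n)) :
  mx_meas A -> mx_meas B -> mx_meas (fun w => A w - B w).
Proof.
move=> hA hB i j; rewrite (_ : (fun w => _) = (fun w => A w i j - B w i j)).
  exact: measurable_funB.
by apply/funext => w; rewrite !mxE.
Qed.

End VectorMeasurability.

Lemma lipschitz_econtinuous (R : realType) d e (G : 'rV[R]_d -> 'rV[R]_e) L :
  elipschitz L G -> econtinuous G.
Proof. by move=> h j; exact: elipschitz_coord_continuous h. Qed.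

(** * Square-integrable vectors and noise *)

Section VectorL2.
Context {d0 : measure_display} {T : measurableType d0} {R : realType}.
Variable P : probability T R.
Local Notation L1 := (L1 P).
Local Notation L2 := (L2 P).
Local Notation Ex := (Ex P).

Definition VL2 d (X : T -> 'rV[R]_d) : Prop :=
  vec_meas X /\ L1 (fun w => enorm (X w) ^+ 2).

Section Fixed.
Context {d : nat}.
Implicit Types X Y : T -> 'rV[R]_d.

Lemma VL2_meas X : VL2 X -> vec_meas X. Proof. by case. Qed.

Lemma VL2_sqr X : VL2 X -> L1 (fun w => enorm (X w) ^+ 2). Proof. by case. Qed.

Lemma VL2_dom X (Y : T -> R) : vec_meas X -> L1 Y ->
  (forall w, enorm (X w) ^+ 2 <= Y w) -> VL2 X.
Proof.
move=> mX hY h; split => //; apply: (L1_dom _ hY).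
  by apply: measurable_funX; exact: enorm_meas.
by move=> w; rewrite ger0_norm ?sqr_ge0.
Qed.

Lemma VL2_coord X j : VL2 X -> L2 (fun w => X w 0 j).
Proof.
move=> [mX hX]; apply: (L2_dom (mX j) hX) => w.
rewrite -real_normK ?num_real// ler_pXn2r ?nnegrE ?enorm_ge0//.
exact: enorm_coord.
Qed.

Lemma VL2_of_coord X : (forall j, L2 (fun w => X w 0 j)) -> VL2 X.
Proof.
move=> h; split; first by move=> j; case: (h j).
apply: (@L1_ext _ _ _ P (fun w => \sum_j X w 0 j ^+ 2)).
  by move=> w; rewrite enorm_sqr_sum.
by apply: L1_sum => j; case: (h j).
Qed.

Lemma VL2_ext X Y : X =1 Y -> VL2 X -> VL2 Y.
Proof. by move=> /funext ->. Qed.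

Lemma VL2D X Y : VL2 X -> VL2 Y -> VL2 (fun w => X w + Y w).
Proof.
move=> [mX hX] [mY hY]; apply: (VL2_dom (vec_measD mX mY) (L1Z 2 (L1D hX hY))).
by move=> w; rewrite mulrDr enorm_sqrD_le.
Qed.

Lemma VL2_scale (f : T -> R) X K : measurable_fun setT f -> VL2 X ->
  (forall w, `|f w| <= K) -> VL2 (fun w => f w *: X w).
Proof.
move=> mf [mX hX] fK; apply: (VL2_dom (vec_measZ mf mX) (L1Z (K ^+ 2) hX)) => w.
rewrite enormZ exprMn ler_wpM2r ?sqr_ge0// ler_pXn2r ?nnegrE//.
exact: le_trans (fK w).
Qed.

Lemma VL2Z a X : VL2 X -> VL2 (fun w => a *: X w).
Proof. by move=> hX; apply: (@VL2_scale (fun=> a) _ `|a|). Qed.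

Lemma VL2N X : VL2 X -> VL2 (fun w => - X w).
Proof. by move=> /(VL2Z (-1)); apply: VL2_ext => w; rewrite scaleN1r. Qed.

Lemma VL2B X Y : VL2 X -> VL2 Y -> VL2 (fun w => X w - Y w).
Proof. by move=> hX /VL2N; exact: VL2D. Qed.

Lemma VL2_cst (v : 'rV[R]_d) : VL2 (fun=> v).
Proof. by split; [exact: vec_meas_cst | exact: L1_cst]. Qed.

Lemma VL2_sum (I : Type) (s : seq I) (F : I -> T -> 'rV[R]_d) :
  (forall i, VL2 (F i)) -> VL2 (fun w => \sum_(i <- s) F i w).
Proof.
move=> h; elim: s => [|i s IH].
  by apply: VL2_ext (VL2_cst 0) => w; rewrite big_nil.
by apply: VL2_ext (VL2D (h i) IH) => w; rewrite big_cons.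
Qed.

Lemma dot_L1 X Y : VL2 X -> VL2 Y -> L1 (fun w => dot (X w) (Y w)).
Proof. by move=> hX hY; apply: L1_sum => j; apply: L2M; exact: VL2_coord. Qed.

Lemma Ex_dot_sum X Y : VL2 X -> VL2 Y ->
  Ex (fun w => dot (X w) (Y w)) = \sum_j Ex (fun w => X w 0 j * Y w 0 j).
Proof.
by move=> hX hY; rewrite Ex_sum// => j; apply: L2M; exact: VL2_coord.
Qed.

Lemma Ex_young X Y eps : 0 < eps -> VL2 X -> VL2 Y ->
  Ex (fun w => enorm (X w + Y w) ^+ 2) <=
  (1 + eps) * Ex (fun w => enorm (X w) ^+ 2) +
  (1 + eps^-1) * Ex (fun w => enorm (Y w) ^+ 2).
Proof.
move=> e0 hX hY; have hXY := VL2_sqr (VL2D hX hY).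
case: hX hY => _ hX [_ hY]; rewrite -!ExZ// -ExD; try exact: L1Z.
apply: Ex_le => //; first by apply: L1D; exact: L1Z.
by move=> w; exact: enorm_sqr_young.
Qed.

Lemma Ex_orthogonal X Y (a : R) : VL2 X -> VL2 Y ->
  Ex (fun w => dot (X w) (Y w)) = 0 ->
  Ex (fun w => enorm (X w + a *: Y w) ^+ 2) =
  Ex (fun w => enorm (X w) ^+ 2) + a ^+ 2 * Ex (fun w => enorm (Y w) ^+ 2).
Proof.
move=> hX hY h0; have hd := dot_L1 hX hY.
rewrite (@Ex_ext _ _ _ P _ (fun w => enorm (X w) ^+ 2 +
  (2 * a) * dot (X w) (Y w) + a ^+ 2 * enorm (Y w) ^+ 2)).
  case: hX hY => _ hX [_ hY].
  rewrite ExD; [|by apply: L1D => //; exact: L1Z|exact: L1Z].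
  by rewrite ExD ?ExZ ?h0 ?mulr0 ?addr0//; exact: L1Z.
by move=> w; rewrite enorm_sqrD dotZr enormZ exprMn real_normK ?num_real// mulrA.
Qed.

End Fixed.

Lemma VL2_lip d e (X : T -> 'rV[R]_d) (G : 'rV[R]_d -> 'rV[R]_e) L :
  elipschitz L G -> VL2 X -> VL2 (fun w => G (X w)).
Proof.
move=> lG [mX hX].
have mG := vec_meas_comp (lipschitz_econtinuous lG) mX.
apply: (VL2_dom mG (L1D (L1_cst P (2 * enorm (G 0) ^+ 2))
  (L1Z (2 * L ^+ 2) hX))) => w.
have := enorm_sqrD_le (G 0) (G (X w) - G 0); rewrite subrKC => /le_trans; apply.
rewrite lerD2l -mulrA ler_wpM2l//; have := lG (X w) 0; rewrite subr0 => h.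
by rewrite -exprMn ler_pXn2r ?nnegrE ?enorm_ge0//; exact: le_trans (enorm_ge0 _) h.
Qed.

Lemma VL2_row_mx d e (X : T -> 'rV[R]_d) (Y : T -> 'rV[R]_e) :
  VL2 X -> VL2 Y -> VL2 (fun w => row_mx (X w) (Y w)).
Proof.
move=> [mX hX] [mY hY]; split; first exact: vec_meas_row_mx.
by apply: L1_ext (L1D hX hY) => w; rewrite enorm_row_mx.
Qed.

Lemma VL2_mxapp m n (A : T -> 'M[R]_(m, n)) (X : T -> 'rV[R]_n) K :
  mx_meas A -> (forall w v, enorm (mxapp (A w) v) <= K * enorm v) -> VL2 X ->
  VL2 (fun w => mxapp (A w) (X w)).
Proof.
move=> mA AK [mX hX]; apply: (VL2_dom (mxapp_meas mA mX) (L1Z (K ^+ 2) hX)) => w.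
have h := AK w (X w); rewrite -exprMn ler_pXn2r ?nnegrE ?enorm_ge0//.
exact: le_trans (enorm_ge0 _) h.
Qed.

Section Noise.
Variable U : set (set T).
Hypothesis UT : <<s U >> `<=` measurable.
Local Notation TU := (g_sigma_algebraType U).

Definition hist_vec d (X : T -> 'rV[R]_d) : Prop := vec_meas (X : TU -> 'rV[R]_d).

Lemma hist_vec_meas d (X : T -> 'rV[R]_d) : hist_vec X -> vec_meas X.
Proof. by move=> h j; exact: hist_meas_meas (h j). Qed.

Lemma noise_sqr_le Z (s : R) : cond_sq_le P <<s U >> Z s ->
  L1 (fun w => Z w ^+ 2) /\ Ex (fun w => Z w ^+ 2) <= s ^+ 2.
Proof.
move=> hZ; have := cond_sq_le_pair UT hZ (W := fun=> 1).
case; [exact: measurable_cst| by []| exact: L1_cst|] => h1 h2; split.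
  by apply: L1_ext h1 => w; rewrite mul1r.
rewrite (@Ex_ext _ _ _ P _ (fun w => 1 * Z w ^+ 2)); last by move=> w; rewrite mul1r.
by apply: le_trans h2 _; rewrite Ex_cst mulr1.
Qed.

Lemma noise_orthogonal d (X M A : T -> 'rV[R]_d) :
  cond_unbiased P <<s U >> X M -> hist_vec A -> VL2 A ->
  VL2 (fun w => X w - M w) -> Ex (fun w => dot (A w) (X w - M w)) = 0.
Proof.
move=> hX gA hA hD; rewrite Ex_dot_sum// big1// => j _.
rewrite (@Ex_ext _ _ _ P _ (fun w => A w 0 j * (X w 0 j - M w 0 j))).
  apply: (cond_exp_pair UT (hX 0 j) (gA j)).
  apply: (L1_ext _ (L2M (VL2_coord j hA) (VL2_coord j hD))) => w.
  by rewrite !mxE.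
by move=> w; rewrite !mxE.
Qed.

Section MatrixNoise.
Context {m n : nat} (H M : T -> 'M[R]_(m, n)) (z : T -> 'rV[R]_n) (s : R).
Hypothesis mH : mx_meas (fun w => H w - M w).
Hypothesis hH : cond_sq_le P <<s U >> (fun w => opnorm (H w - M w)) s.
Hypothesis gz : hist_vec z.
Hypothesis hz : VL2 z.

(** The factor [W w * enorm (z w) ^+ 2] is history measurable and leaves the conditional second
    moment of the matrix noise. The weight [W] is 1 for a single objective and a coordinate of
    [lambda] in mixtures. *)
Lemma mx_noise_L1 (W : T -> R) : hist_meas U W -> (forall w, 0 <= W w <= 1) ->
  L1 (fun w => W w * enorm (mxapp (H w - M w) (z w)) ^+ 2) /\
  Ex (fun w => W w * enorm (mxapp (H w - M w) (z w)) ^+ 2) <=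
    s ^+ 2 * Ex (fun w => W w * enorm (z w) ^+ 2).
Proof.
move=> gW W01.
have W0 w : 0 <= W w by case/andP: (W01 w).
have mW := hist_meas_meas UT gW.
have gz2 : hist_meas U (fun w => enorm (z w) ^+ 2).
  apply: (@measurable_funX _ TU); exact: enorm_meas gz.
have gWz : hist_meas U (fun w => W w * enorm (z w) ^+ 2) by exact: measurable_funM.
have mz2 := hist_meas_meas UT gz2.
have W1 w : 0 <= W w * enorm (z w) ^+ 2 by apply: mulr_ge0; [|exact: sqr_ge0].
have hWz : L1 (fun w => W w * enorm (z w) ^+ 2).
  apply: (L1_dom _ (VL2_sqr hz)); first exact: measurable_funM.
  move=> w; rewrite ger0_norm; last exact: W1.
  by apply: ler_piMl; [exact: sqr_ge0 | case/andP: (W01 w)].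
have [h1 h2] := cond_sq_le_pair UT hH gWz W1 hWz.
have le w : W w * enorm (mxapp (H w - M w) (z w)) ^+ 2 <=
    W w * enorm (z w) ^+ 2 * opnorm (H w - M w) ^+ 2.
  rewrite -[leRHS]mulrA ler_wpM2l// -exprMn [enorm (z w) * _]mulrC.
  by rewrite ler_pXn2r ?nnegrE ?mulr_ge0 ?enorm_ge0 ?opnorm_ge0 ?mxapp_le.
have m3 : measurable_fun setT (fun w => W w * enorm (mxapp (H w - M w) (z w)) ^+ 2).
  apply: measurable_funM => //; apply: measurable_funX.
  by apply: enorm_meas; apply: mxapp_meas => //; exact: VL2_meas hz.
have h3 : L1 (fun w => W w * enorm (mxapp (H w - M w) (z w)) ^+ 2).
  apply: (L1_dom m3 h1) => w; rewrite ger0_norm//.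
  by apply: mulr_ge0; [|exact: sqr_ge0].
by split => //; apply: le_trans h2; exact: Ex_le.
Qed.

Lemma mx_noise_VL2 : VL2 (fun w => mxapp (H w - M w) (z w)).
Proof.
have [|w|h _] := @mx_noise_L1 (fun=> 1); first exact: measurable_cst.
  by rewrite ler01 lexx.
split; first by apply: mxapp_meas => //; exact: VL2_meas hz.
by apply: L1_ext h => w; rewrite mul1r.
Qed.

(** Expanded into entries: each product of a coordinate of [A] and one of [z] is history measurable
    and meets an entry of [H - M] with conditional mean 0. *)
Lemma mx_noise_orthogonal (A : T -> 'rV[R]_m) :
  cond_unbiased P <<s U >> H M -> hist_vec A -> VL2 A ->
  Ex (fun w => dot (A w) (mxapp (H w - M w) (z w))) = 0.
Proof.
move=> hu gA hA.
(* A product of two square-integrable factors would only be integrable; the conditional variance of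
   [H] makes this one square integrable. *)
have hzD i j : L2 (fun w => z w 0 j * (H w i j - M w i j)).
  have gz2 : hist_meas U (fun w => enorm (z w) ^+ 2).
    apply: (@measurable_funX _ TU); exact: enorm_meas gz.
  have [h1 _] := cond_sq_le_pair UT hH gz2 (fun w => sqr_ge0 _) (VL2_sqr hz).
  apply: (L2_dom _ h1).
    apply: measurable_funM; first exact: VL2_meas hz j.
    by have := mH i j; under eq_fun do rewrite !mxE.
  move=> w; rewrite -exprMn -real_normK ?num_real// normrM.
  rewrite ler_pXn2r ?nnegrE ?mulr_ge0 ?enorm_ge0 ?opnorm_ge0//.
  apply: ler_pM => //; first exact: enorm_coord.
  by have := opnorm_coord (H w - M w) i j; rewrite !mxE.
rewrite Ex_dot_sum//; last exact: mx_noise_VL2.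
rewrite big1// => i _.
have E w : A w 0 i * mxapp (H w - M w) (z w) 0 i =
    \sum_j (A w 0 i * z w 0 j) * (H w i j - M w i j).
  by rewrite mxappE mulr_sumr; apply: eq_bigr => j _; rewrite !mxE mulrA.
have hL j : L1 (fun w => (A w 0 i * z w 0 j) * (H w i j - M w i j)).
  by apply: (L1_ext _ (L2M (VL2_coord i hA) (hzD i j))) => w; rewrite mulrA.
rewrite (Ex_ext P E) Ex_sum// big1// => j _.
by apply: (cond_exp_pair UT (hu i j)) => //; exact: (measurable_funM (gA i) (gz j)).
Qed.

End MatrixNoise.
End Noise.
End VectorL2.

Lemma inv_young_le (R : realFieldType) (s mu k : R) : 0 < mu -> 0 < s -> s <= 1 ->
  1 + (s * mu / k)^-1 <= (1 + k / mu) / s.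
Proof.
move=> mu0 s0 s1; rewrite mulrDl mul1r; apply: lerD.
  by rewrite invf_ge1.
by rewrite !invfM invrK [_ * k]mulrC [s^-1 * _]mulrC mulrA.
Qed.

(** * One-step recursions *)

Section Arithmetic.
Context {R : realFieldType}.
Implicit Types s mu : R.

Lemma inv_half_le s : 0 < s -> s <= 1 -> 1 + (s / 2)^-1 <= 3 / s.
Proof.
move=> s0 s1; rewrite invf_div; have : 1 <= s^-1 by rewrite invf_ge1.
by move: (s^-1) => t; lra.
Qed.

Lemma descent_arith sm (Y N : R) : 0 <= sm <= 1 -> 0 <= Y -> 0 <= N ->
  (1 + sm / 2) * ((1 - sm) * Y + N) <= (1 - sm / 2) * Y + 2 * N.
Proof.
move=> /andP[sm0 sm1] Y0 N0.
have k1 := mulr_ge0 (mulr_ge0 sm0 sm0) Y0.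
have k2 := mulr_ge0 sm0 N0.
have k3 : 0 <= (1 - sm) * N by apply: mulr_ge0 => //; lra.
lra.
Qed.

Lemma adjoint_arith s mu (sH2 ks a Z Y r : R) : 0 < mu -> 0 < s -> s * mu <= 1 ->
  s * (64 * sH2) <= mu -> 0 <= ks -> 0 <= Z -> 0 <= Y -> 0 <= r -> 0 <= sH2 ->
  a <= (1 - s * mu / 2) * Z + s * ks * Y ->
  (1 + s * mu / 4) * (a + s ^+ 2 * (4 * sH2 * Z + r)) <=
  (1 - s * mu / 8) * Z + 2 * (s * ks * Y) + 2 * s ^+ 2 * r.
Proof.
move=> mu0 s0 smu sH ks0 Z0 Y0 r0 sH0 ha.
have t0 : 0 <= s * mu by apply: mulr_ge0; exact: ltW.
set t := s * mu in t0 smu ha *.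
have s2 : 0 <= s ^+ 2 by exact: sqr_ge0.
have h1 : s ^+ 2 * (64 * sH2) <= t.
  by rewrite expr2 -mulrA /t; apply: ler_wpM2l => //; exact: ltW.
have h2 : s ^+ 2 * (64 * sH2) * Z <= t * Z by apply: ler_wpM2r.
have tZ := mulr_ge0 t0 Z0.
have ttZ := mulr_ge0 t0 tZ.
have Q0 : 0 <= s * ks * Y by apply: mulr_ge0 => //; apply: mulr_ge0 => //; exact: ltW.
have R0 : 0 <= s ^+ 2 * r by apply: mulr_ge0.
have c0 : 0 <= 1 + t / 4 by lra.
apply: le_trans (_ : (1 + t / 4) * ((1 - t / 2) * Z + s * ks * Y + (t * Z / 16 + s ^+ 2 * r)) <= _).
  by apply: ler_wpM2l => //; apply: lerD => //; lra.
have k1 : t * (s * ks * Y) <= s * ks * Y by rewrite ler_piMl.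
have k2 : t * (s ^+ 2 * r) <= s ^+ 2 * r by rewrite ler_piMl.
have k3 : t * (t * Z) <= t * Z by rewrite ler_piMl.
lra.
Qed.

Lemma averaging_arith s (a p B N : R) : 0 < s -> s <= 1 -> 0 <= p -> 0 <= B ->
  0 <= N -> a <= (1 - s) * p + s * B ->
  (1 + s / 2) * (a + s ^+ 2 * N) <= (1 - s / 2) * p + 2 * (s * B) + 2 * s ^+ 2 * N.
Proof.
move=> s0 s1 p0 B0 N0 ha.
have sB : 0 <= s * B by apply: mulr_ge0 => //; exact: ltW.
have sN : 0 <= s ^+ 2 * N by apply: mulr_ge0 => //; exact: sqr_ge0.
have sp : 0 <= s * p by apply: mulr_ge0 => //; exact: ltW.
have ssp : 0 <= s * (s * p) by apply: mulr_ge0 => //; exact: ltW.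
have k1 : s * (s * B) <= s * B by rewrite ler_piMl.
have k2 : s * (s ^+ 2 * N) <= s ^+ 2 * N by rewrite ler_piMl.
apply: le_trans (_ : (1 + s / 2) * ((1 - s) * p + s * B + s ^+ 2 * N) <= _).
  by apply: ler_wpM2l; [lra | rewrite lerD2r].
lra.
Qed.

End Arithmetic.

Section OneStep.
Context {d0 : measure_display} {T : measurableType d0} {R : realType}.
Variable P : probability T R.
Variable U : set (set T).
Hypothesis UT : <<s U >> `<=` measurable.
Local Notation L1 := (L1 P).
Local Notation Ex := (Ex P).
Local Notation VL2 := (VL2 P).
Local Notation TU := (g_sigma_algebraType U).

Lemma hist_vecD d (X Y : T -> 'rV[R]_d) :
  hist_vec U X -> hist_vec U Y -> hist_vec U (fun w => X w + Y w).
Proof. exact: (@vec_measD _ TU). Qed.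

Lemma hist_vecZ d a (X : T -> 'rV[R]_d) :
  hist_vec U X -> hist_vec U (fun w => a *: X w).
Proof. by move=> hX; apply: (@vec_measZ _ TU) => //; exact: measurable_cst. Qed.

Lemma hist_vecB d (X Y : T -> 'rV[R]_d) :
  hist_vec U X -> hist_vec U Y -> hist_vec U (fun w => X w - Y w).
Proof. exact: (@vec_measB _ TU). Qed.

(** The common pattern of the noisy recursions: [A] is the error after a noiseless step, [xi] a
    noise orthogonal to it, and [D] the drift of the target, separated by Young's inequality. *)
Lemma tracking_step d (A xi D : T -> 'rV[R]_d) (s eps N : R) :
  0 < eps -> VL2 A -> VL2 xi -> VL2 D ->
  Ex (fun w => dot (A w) (xi w)) = 0 -> Ex (fun w => enorm (xi w) ^+ 2) <= N ->
  Ex (fun w => enorm (A w + s *: xi w + D w) ^+ 2) <=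
  (1 + eps) * (Ex (fun w => enorm (A w) ^+ 2) + s ^+ 2 * N) +
  (1 + eps^-1) * Ex (fun w => enorm (D w) ^+ 2).
Proof.
move=> e0 hA hxi hD h0 hN.
apply: le_trans (Ex_young e0 (VL2D hA (VL2Z s hxi)) hD) _.
rewrite lerD2r (Ex_orthogonal s hA hxi h0).
apply: ler_wpM2l; first by apply: addr_ge0 => //; exact: ltW.
by rewrite lerD2l; apply: ler_wpM2l => //; exact: sqr_ge0.
Qed.

Lemma noise_VL2 d (X M : T -> 'rV[R]_d) (s : R) : vec_meas X -> vec_meas M ->
  cond_sq_le P <<s U >> (fun w => enorm (X w - M w)) s ->
  VL2 (fun w => X w - M w) /\ Ex (fun w => enorm (X w - M w) ^+ 2) <= s ^+ 2.
Proof.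
move=> mX mM /(noise_sqr_le UT)[h1 h2]; split => //.
by split => //; exact: vec_measB.
Qed.

(** Here [yb] and [yb'] are the minimizers before and after the step. Young's parameter [s mu / 2]
    keeps half of the contraction and multiplies the drift by order [1 / s]. *)
Lemma descent_step d (y yb yb' g v : T -> 'rV[R]_d) (V : T -> R) (mu s sg K : R) :
  0 < mu -> 0 < s -> s <= 1 -> s * mu <= 1 ->
  VL2 y -> VL2 yb -> VL2 yb' -> VL2 g ->
  hist_vec U y -> hist_vec U yb -> hist_vec U g -> vec_meas v ->
  cond_unbiased P <<s U >> v g ->
  cond_sq_le P <<s U >> (fun w => enorm (v w - g w)) sg ->
  (forall w, enorm (y w - s *: g w - yb w) ^+ 2 <=
    (1 - s * mu) * enorm (y w - yb w) ^+ 2) ->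
  L1 V -> (forall w, enorm (yb w - yb' w) ^+ 2 <= K * V w) ->
  Ex (fun w => enorm (y w - s *: v w - yb' w) ^+ 2) <=
  (1 - s * mu / 2) * Ex (fun w => enorm (y w - yb w) ^+ 2) +
  2 * s ^+ 2 * sg ^+ 2 + (1 + 2 / mu) / s * (K * Ex V).
Proof.
move=> mu0 s0 s1 smu hy hyb hyb' hg gy gyb gg mv unb var step hV drift.
have [hxi hN] := noise_VL2 mv (hist_vec_meas UT gg) var.
pose A w := y w - s *: g w - yb w.
have hA : VL2 A by apply: VL2B => //; apply: VL2B => //; exact: VL2Z.
have gA : hist_vec U A.
  by apply: hist_vecB => //; apply: hist_vecB => //; exact: hist_vecZ.
have h0 : Ex (fun w => dot (A w) (- (v w - g w))) = 0.
  rewrite (@Ex_ext _ _ _ P _ (fun w => - dot (A w) (v w - g w))).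
    by rewrite ExN ?(noise_orthogonal UT unb gA hA hxi) ?oppr0//; exact: dot_L1.
  by move=> w; rewrite dotNr.
have eps0 : 0 < s * mu / 2 by rewrite divr_gt0// mulr_gt0.
have hN' : Ex (fun w => enorm (- (v w - g w)) ^+ 2) <= sg ^+ 2.
  by apply: le_trans hN; rewrite (@Ex_ext _ _ _ P _ (fun w => enorm (v w - g w) ^+ 2))// => w; rewrite enormN.
have := tracking_step s eps0 hA (VL2N hxi) (VL2B hyb hyb') h0 hN'.
rewrite (@Ex_ext _ _ _ P _ (fun w => enorm (y w - s *: v w - yb' w) ^+ 2)); last first.
  by move=> w; congr (enorm _ ^+ 2); apply/rowP => j; rewrite !mxE; ring.
move=> /le_trans; apply.
have e1 : Ex (fun w => enorm (A w) ^+ 2) <=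
    (1 - s * mu) * Ex (fun w => enorm (y w - yb w) ^+ 2).
  rewrite -ExZ; last by apply: VL2_sqr; exact: VL2B.
  apply: Ex_le => //; first exact: VL2_sqr hA.
  by apply: L1Z; apply: VL2_sqr; exact: VL2B.
have e2 : Ex (fun w => enorm (yb w - yb' w) ^+ 2) <= K * Ex V.
  by rewrite -ExZ//; apply: Ex_le => //; [apply: VL2_sqr; exact: VL2B | exact: L1Z].
have Y0 : 0 <= Ex (fun w => enorm (y w - yb w) ^+ 2).
  by apply: Ex_ge0 => w; exact: sqr_ge0.
have D0 : 0 <= Ex (fun w => enorm (yb w - yb' w) ^+ 2).
  by apply: Ex_ge0 => w; exact: sqr_ge0.
apply: lerD; last first.
  apply: le_trans (_ : (1 + 2 / mu) / s * Ex (fun w =>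
      enorm (yb w - yb' w) ^+ 2) <= _).
    by apply: ler_wpM2r => //; exact: inv_young_le.
  apply: ler_wpM2l e2.
  by apply: divr_ge0; [apply: addr_ge0 => //; apply: divr_ge0 | ]; exact: ltW.
apply: le_trans (_ : (1 + s * mu / 2) *
    ((1 - s * mu) * Ex (fun w => enorm (y w - yb w) ^+ 2) + s ^+ 2 * sg ^+ 2) <= _).
  by apply: ler_wpM2l; [apply: addr_ge0 => //; exact: ltW | rewrite lerD2r].
move: (Ex (fun w => enorm (y w - yb w) ^+ 2)) Y0 => Y Y0.
rewrite -[2 * _ * _]mulrA; apply: descent_arith => //.
  by rewrite smu (ltW (mulr_gt0 s0 mu0)).
by apply: mulr_ge0; exact: sqr_ge0.
Qed.

(* [zb] and [zb'] are the solutions of [M z = um] before and after the step. *)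
Lemma adjoint_descent_step d (z zb zb' um u : T -> 'rV[R]_d) (H M : T -> 'M[R]_d)
    (V Yr : T -> R) (mu s su sH r ks K B : R) :
  0 < mu -> 0 < s -> s <= 1 -> s * mu <= 1 -> s * (64 * sH ^+ 2) <= mu -> 0 <= ks ->
  VL2 z -> VL2 zb -> VL2 zb' -> VL2 um ->
  hist_vec U z -> hist_vec U zb -> hist_vec U um ->
  @mx_meas _ TU _ _ _ M -> mx_meas H -> vec_meas u ->
  (forall w v, enorm (mxapp (M w) v) <= B * enorm v) ->
  cond_unbiased P <<s U >> u um -> cond_unbiased P <<s U >> H M ->
  cond_sq_le P <<s U >> (fun w => enorm (u w - um w)) su ->
  cond_sq_le P <<s U >> (fun w => opnorm (H w - M w)) sH ->
  (forall w, enorm (zb w) <= r) -> L1 Yr ->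
  (forall w, enorm (z w - s *: (mxapp (M w) (z w) - um w) - zb w) ^+ 2 <=
    (1 - s * mu / 2) * enorm (z w - zb w) ^+ 2 + s * ks * Yr w) ->
  (forall w, 0 <= Yr w) ->
  L1 V -> (forall w, enorm (zb w - zb' w) ^+ 2 <= K * V w) ->
  VL2 (fun w => z w - s *: (mxapp (H w) (z w) - u w)) /\
  Ex (fun w => enorm (z w - s *: (mxapp (H w) (z w) - u w) - zb' w) ^+ 2) <=
  (1 - s * mu / 8) * Ex (fun w => enorm (z w - zb w) ^+ 2) +
  2 * (s * ks * Ex Yr) + 2 * s ^+ 2 * (4 * sH ^+ 2 * r ^+ 2 + 2 * su ^+ 2)
  + (1 + 4 / mu) / s * (K * Ex V).
Proof.
move=> mu0 s0 s1 smu sHmu ks0 hz hzb hzb' hum gz gzb gum gM mH mu_ MB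
  unbu unbH varu varH zbr hYr step Yr0 hV drift.
have [hxu hNu] := noise_VL2 mu_ (hist_vec_meas UT gum) varu.
have mM : mx_meas M by move=> i j; exact: hist_meas_meas (gM i j).
have mHM := mx_measB mH mM.
have hxH := mx_noise_VL2 UT mHM varH gz hz.
have hMz := VL2_mxapp mM MB hz.
pose xi w := - (mxapp (H w - M w) (z w)) + (u w - um w).
have hxi : VL2 xi by apply: VL2D => //; exact: VL2N.
pose A w := z w - s *: (mxapp (M w) (z w) - um w) - zb w.
have hA : VL2 A by apply: VL2B => //; apply: VL2B => //; apply: VL2Z; exact: VL2B.
have gA : hist_vec U A.
  apply: hist_vecB => //; apply: hist_vecB => //; apply: hist_vecZ.
  by apply: hist_vecB => //; exact: (@mxapp_meas _ TU).
have E w : z w - s *: (mxapp (H w) (z w) - u w) - zb' w =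
    A w + s *: xi w + (zb w - zb' w).
  rewrite /A /xi mxappBl; move: (mxapp (H w) _) (mxapp (M w) _) => a b.
  by apply/rowP => j; rewrite !mxE; ring.
split.
  apply: (@VL2_ext _ _ _ _ _ (fun w => A w + s *: xi w + (zb w - zb' w) + zb' w)).
    by move=> w; rewrite -E subrK.
  by apply: VL2D => //; apply: VL2D; [apply: VL2D => //; exact: VL2Z | exact: VL2B].
have h0 : Ex (fun w => dot (A w) (xi w)) = 0.
  have o1 := mx_noise_orthogonal UT mHM varH gz hz unbH gA hA.
  have o2 := noise_orthogonal UT unbu gA hA hxu.
  rewrite (@Ex_ext _ _ _ P _ (fun w => dot (A w) (u w - um w) -
    dot (A w) (mxapp (H w - M w) (z w)))).
    by rewrite ExB ?o1 ?o2 ?subr0//; exact: dot_L1.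
  by move=> w; rewrite /xi [LHS]dotDr [X in X + _]dotNr [LHS]addrC.
have eps0 : 0 < s * mu / 4 by rewrite divr_gt0// mulr_gt0.
pose EZ := Ex (fun w => enorm (z w - zb w) ^+ 2).
have hZ : L1 (fun w => enorm (z w - zb w) ^+ 2) by apply: VL2_sqr; exact: VL2B.
(* The second moment of the matrix noise grows with [z], hence with the error itself. This part
   carries the factor [s^2], and the condition on [64 sH^2] lets the contraction absorb it. *)
have hN : Ex (fun w => enorm (xi w) ^+ 2) <=
    4 * sH ^+ 2 * EZ + (4 * sH ^+ 2 * r ^+ 2 + 2 * su ^+ 2).
  have zle : Ex (fun w => enorm (z w) ^+ 2) <= 2 * EZ + 2 * r ^+ 2.
    rewrite /EZ -ExZ// -[2 * r ^+ 2](Ex_cst P) -ExD; [|exact: L1Z|exact: L1_cst].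
    apply: Ex_le; [exact: VL2_sqr| by apply: L1D; [exact: L1Z|exact: L1_cst] |].
    move=> w; have := enorm_sqrD_le (z w - zb w) (zb w); rewrite subrK.
    move=> /le_trans; apply; rewrite lerD2l ler_pM2l// ler_pXn2r ?nnegrE ?enorm_ge0//.
    exact: le_trans (enorm_ge0 (zb w)) _.
  have [hH1 hH2] := mx_noise_L1 UT mHM varH gz hz (W := fun=> 1)
    (measurable_cst _) (fun w => (introT andP (conj ler01 (lexx 1)))).
  have hH3 : Ex (fun w => enorm (mxapp (H w - M w) (z w)) ^+ 2) <=
      sH ^+ 2 * Ex (fun w => enorm (z w) ^+ 2).
    rewrite (@Ex_ext _ _ _ P _ (fun w => 1 * enorm (mxapp (H w - M w) (z w)) ^+ 2)).
      apply: le_trans hH2 _; rewrite (@Ex_ext _ _ _ P _ (fun w => enorm (z w) ^+ 2))//.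
      by move=> w; rewrite mul1r.
    by move=> w; rewrite mul1r.
  have l1 := VL2_sqr hxH; have l2 := VL2_sqr hxu.
  have : Ex (fun w => enorm (xi w) ^+ 2) <=
      2 * Ex (fun w => enorm (mxapp (H w - M w) (z w)) ^+ 2) +
      2 * Ex (fun w => enorm (u w - um w) ^+ 2).
    rewrite -!ExZ// -ExD; [|exact: L1Z|exact: L1Z].
    apply: Ex_le; [exact: VL2_sqr hxi | by apply: L1D; exact: L1Z |].
    by move=> w; rewrite -(enormN (mxapp _ _)) enorm_sqrD_le.
  move: hH3 hNu zle (sqr_ge0 sH); rewrite -/EZ.
  move: (Ex (fun w => enorm (xi w) ^+ 2)) (Ex (fun w => enorm (z w) ^+ 2)) EZ
    (Ex (fun w => enorm (mxapp (H w - M w) (z w)) ^+ 2))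
    (Ex (fun w => enorm (u w - um w) ^+ 2)) (sH ^+ 2) (su ^+ 2) (r ^+ 2).
  move=> a1 a2 a3 a4 a5 a6 a7 a8 h1 h2 h3 h4 h5.
  by have := ler_wpM2l h4 h3; lra.
have := tracking_step s eps0 hA hxi (VL2B hzb hzb') h0 hN.
rewrite -(Ex_ext P (fun w => congr1 (fun v => enorm v ^+ 2) (E w))).
move=> /le_trans; apply.
have e1 : Ex (fun w => enorm (A w) ^+ 2) <= (1 - s * mu / 2) * EZ + s * ks * Ex Yr.
  rewrite /EZ -!ExZ// -ExD; [|exact: L1Z|exact: L1Z].
  by apply: Ex_le => //; [exact: VL2_sqr hA | apply: L1D; exact: L1Z].
have e2 : Ex (fun w => enorm (zb w - zb' w) ^+ 2) <= K * Ex V.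
  by rewrite -ExZ//; apply: Ex_le => //; [apply: VL2_sqr; exact: VL2B | exact: L1Z].
have Z0 : 0 <= EZ by apply: Ex_ge0 => w; exact: sqr_ge0.
have Y0 : 0 <= Ex Yr by exact: Ex_ge0.
have D0 : 0 <= Ex (fun w => enorm (zb w - zb' w) ^+ 2).
  by apply: Ex_ge0 => w; exact: sqr_ge0.
apply: lerD; last first.
  apply: le_trans (_ : (1 + 4 / mu) / s * Ex (fun w =>
      enorm (zb w - zb' w) ^+ 2) <= _).
    by apply: ler_wpM2r => //; exact: inv_young_le.
  apply: ler_wpM2l e2.
  by apply: divr_ge0; [apply: addr_ge0 => //; apply: divr_ge0 | ]; exact: ltW.
rewrite -/EZ; move: (Ex (fun w => enorm (A w) ^+ 2)) EZ (Ex Yr) e1 Z0 Y0 {hN} => a z1 y1.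
move=> e1 Z0 Y0; apply: adjoint_arith => //.
  apply: addr_ge0; apply: mulr_ge0 => //; try exact: sqr_ge0.
  by apply: mulr_ge0 => //; exact: sqr_ge0.
exact: sqr_ge0.
Qed.

(* Exponential averaging [h] of the quantity [hb], which drifts to [hb'], from
   samples with bias [b] and noise [xi]. *)
Lemma averaging_step d (h hb hb' b xi : T -> 'rV[R]_d) (B Q : T -> R) (s N : R) :
  0 < s -> s <= 1 -> VL2 h -> VL2 hb -> VL2 hb' -> VL2 b -> VL2 xi ->
  hist_vec U h -> hist_vec U hb -> hist_vec U b ->
  (forall A, hist_vec U A -> VL2 A -> Ex (fun w => dot (A w) (xi w)) = 0) ->
  Ex (fun w => enorm (xi w) ^+ 2) <= N -> L1 B -> L1 Q ->
  (forall w, enorm (b w) ^+ 2 <= B w) ->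
  (forall w, enorm (hb w - hb' w) ^+ 2 <= Q w) ->
  Ex (fun w => enorm ((1 - s) *: h w + s *: (hb w + b w + xi w) - hb' w) ^+ 2) <=
  (1 - s / 2) * Ex (fun w => enorm (h w - hb w) ^+ 2) +
  2 * (s * Ex B) + 2 * s ^+ 2 * N + 3 / s * Ex Q.
Proof.
move=> s0 s1 hh hhb hhb' hb_ hxi gh ghb gb orth hN hB hQ bB drift.
pose A w := (1 - s) *: (h w - hb w) + s *: b w.
have hhB := VL2B hh hhb.
have hA : VL2 A by apply: VL2D; exact: VL2Z.
have gA : hist_vec U A.
  by apply: hist_vecD; apply: hist_vecZ => //; exact: hist_vecB.
have eps0 : 0 < s / 2 by rewrite divr_gt0.
have E w : (1 - s) *: h w + s *: (hb w + b w + xi w) - hb' w =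
    A w + s *: xi w + (hb w - hb' w).
  by apply/rowP => j; rewrite !mxE; ring.
have := tracking_step s eps0 hA hxi (VL2B hhb hhb') (orth A gA hA) hN.
rewrite (@Ex_ext _ _ _ P _ (fun w => enorm ((1 - s) *: h w + s *: (hb w + b w + xi w) - hb' w) ^+ 2)); last by move=> w; rewrite E.
move=> /le_trans; apply.
have hp := VL2_sqr hhB.
have e1 : Ex (fun w => enorm (A w) ^+ 2) <=
    (1 - s) * Ex (fun w => enorm (h w - hb w) ^+ 2) + s * Ex B.
  rewrite -!ExZ// -ExD; [|exact: L1Z|exact: L1Z].
  apply: Ex_le => //; [exact: VL2_sqr hA | by apply: L1D; exact: L1Z |].
  move=> w; apply: le_trans (enorm_sqr_convex _ _ _) _; first by rewrite (ltW s0) s1.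
  by rewrite lerD2l; apply: ler_wpM2l; first exact: ltW.
have e2 : Ex (fun w => enorm (hb w - hb' w) ^+ 2) <= Ex Q.
  by apply: Ex_le => //; apply: VL2_sqr; exact: VL2B.
have p0 : 0 <= Ex (fun w => enorm (h w - hb w) ^+ 2).
  by apply: Ex_ge0 => w; exact: sqr_ge0.
have D0 : 0 <= Ex (fun w => enorm (hb w - hb' w) ^+ 2).
  by apply: Ex_ge0 => w; exact: sqr_ge0.
have N0 : 0 <= N by apply: le_trans hN; apply: Ex_ge0 => w; exact: sqr_ge0.
have B0 : 0 <= Ex B by apply: Ex_ge0 => w; apply: le_trans (bB w); exact: sqr_ge0.
apply: lerD; last first.
  apply: ler_pM => //; first by apply: addr_ge0 => //; rewrite invr_ge0 ltW.
  exact: inv_half_le.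
move: (Ex (fun w => enorm (A w) ^+ 2)) (Ex (fun w => enorm (h w - hb w) ^+ 2))
  (Ex B) e1 p0 B0 => a p1 b1 e1 p0 B0.
exact: averaging_arith.
Qed.

Section MixedNoise.
Context {n q : nat} (r : 'I_n -> nat).
Variables (l : T -> 'rV[R]_n) (X M : 'I_n -> T -> 'rV[R]_q).
Variables (J N : forall i, T -> 'M[R]_(q, r i)) (z : forall i, T -> 'rV[R]_(r i)).
Variables (s1 s2 : R).
Hypothesis gl : hist_vec U l.
Hypothesis ls : forall w, simplex R n (l w).
Hypothesis mX : forall i, vec_meas (X i).
Hypothesis gM : forall i, hist_vec U (M i).
Hypothesis mJ : forall i, mx_meas (J i).
Hypothesis gN : forall i, @mx_meas _ TU _ _ _ (N i).
Hypothesis gz : forall i, hist_vec U (z i).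
Hypothesis hz : forall i, VL2 (z i).
Hypothesis unbX : forall i, cond_unbiased P <<s U >> (X i) (M i).
Hypothesis unbJ : forall i, cond_unbiased P <<s U >> (J i) (N i).
Hypothesis varX : forall i, cond_sq_le P <<s U >> (fun w => enorm (X i w - M i w)) s1.
Hypothesis varJ : forall i, cond_sq_le P <<s U >> (fun w => opnorm (J i w - N i w)) s2.

Definition mixed_noise w : 'rV[R]_q :=
  \sum_i l w 0 i *: (X i w - M i w - mxapp (J i w - N i w) (z i w)).

Let l01 i w : 0 <= l w 0 i <= 1.
Proof.
have [h0 h1] := ls w; rewrite h0 -h1 (bigD1 i)//= lerDl.
by apply: sumr_ge0 => j _.
Qed.

Let l_ge0 i w : 0 <= l w 0 i. Proof. by case/andP: (l01 i w). Qed.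

Let l_le1 i w : `|l w 0 i| <= 1.
Proof. by rewrite ger0_norm//; case/andP: (l01 i w). Qed.

Let ml i : measurable_fun setT (fun w => l w 0 i).
Proof. exact: hist_meas_meas (gl i). Qed.

Let L1l i : L1 (fun w => l w 0 i).
Proof. by apply: (L1_dom (ml i) (L1_cst P 1)) => w; exact: l_le1. Qed.

Let hX i : VL2 (fun w => X i w - M i w).
Proof. by have [] := noise_VL2 (mX i) (hist_vec_meas UT (@gM i)) (varX i). Qed.

Let mJN i : mx_meas (fun w => J i w - N i w).
Proof.
apply: mx_measB => [|a b]; first exact: mJ.
by have h := @gN i a b; exact: (hist_meas_meas UT h).
Qed.

Let hJ i : VL2 (fun w => mxapp (J i w - N i w) (z i w)).
Proof. exact: (mx_noise_VL2 UT (@mJN i) (varJ i) (@gz i) (hz i)). Qed.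

Let hXJ i : VL2 (fun w => X i w - M i w - mxapp (J i w - N i w) (z i w)).
Proof. exact: VL2B. Qed.

Lemma mixed_noise_VL2 : VL2 mixed_noise.
Proof. by apply: VL2_sum => i; apply: (@VL2_scale _ _ _ P _ _ _ 1). Qed.

(** The weight [l w 0 i] is moved to the side of [A], where it stays history measurable and
    bounded. *)
Lemma mixed_noise_orthogonal A : hist_vec U A -> VL2 A ->
  Ex (fun w => dot (A w) (mixed_noise w)) = 0.
Proof.
move=> gA hA.
pose Al i w := l w 0 i *: A w.
have gAl i : hist_vec U (Al i) by apply: (@vec_measZ _ TU) => //; exact: gl.
have hAl i : VL2 (Al i) by apply: (@VL2_scale _ _ _ P _ _ _ 1).
have E w : dot (A w) (mixed_noise w) =
    \sum_i (dot (Al i w) (X i w - M i w) - dot (Al i w) (mxapp (J i w - N i w) (z i w))).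
  rewrite dotC dot_suml; apply: eq_bigr => i _.
  by rewrite dotZl dotBl !(dotC _ (A w)) !dotZl mulrBr.
rewrite (Ex_ext P E) Ex_sum; last first.
  by move=> i; apply: L1B; exact: dot_L1.
rewrite big1// => i _; rewrite ExB; [|exact: dot_L1|exact: dot_L1].
rewrite (noise_orthogonal UT (@unbX i) (@gAl i) (hAl i) (hX i)).
rewrite (mx_noise_orthogonal UT (@mJN i) (varJ i) (@gz i) (hz i) (@unbJ i) (@gAl i) (hAl i)).
exact: subr0.
Qed.

Lemma Ex_weights : \sum_i Ex (fun w => l w 0 i) = 1.
Proof.
rewrite -Ex_sum// -[RHS](Ex_cst P); apply: Ex_ext => w.
by case: (ls w).
Qed.

Let L1lX i : L1 (fun w => l w 0 i * enorm (X i w - M i w) ^+ 2).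
Proof.
apply: (L1_dom _ (VL2_sqr (hX i))).
  by apply: measurable_funM => //; exact: L1_meas (VL2_sqr (hX i)).
move=> w; rewrite normrM [`|_ ^+ 2|]ger0_norm ?sqr_ge0//.
by apply: ler_piMl => //; exact: sqr_ge0.
Qed.

(** Jensen's inequality for weights of sum 1 bounds the noise of the mixture without a factor
    [n]. *)
Lemma mixed_noise_le : Ex (fun w => enorm (mixed_noise w) ^+ 2) <=
  2 * s1 ^+ 2 + 2 * s2 ^+ 2 * \sum_i Ex (fun w => l w 0 i * enorm (z i w) ^+ 2).
Proof.
have hj i := mx_noise_L1 UT (@mJN i) (varJ i) (@gz i) (hz i) (gl i) (l01 i).
have hx i := cond_sq_le_pair UT (varX i) (gl i) (l_ge0 i) (L1l i).
have step : Ex (fun w => enorm (mixed_noise w) ^+ 2) <=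
    \sum_i (2 * Ex (fun w => l w 0 i * enorm (X i w - M i w) ^+ 2) +
     2 * Ex (fun w => l w 0 i * enorm (mxapp (J i w - N i w) (z i w)) ^+ 2)).
  under eq_bigr => i _.
    rewrite -ExZ; last by case: (hx i).
    rewrite -ExZ; last by case: (hj i).
    rewrite -ExD; [|by apply: L1Z; case: (hx i)|by apply: L1Z; case: (hj i)].
    over.
  have hs i : L1 (fun w => 2 * (l w 0 i * enorm (X i w - M i w) ^+ 2) +
     2 * (l w 0 i * enorm (mxapp (J i w - N i w) (z i w)) ^+ 2)).
    by apply: L1D; apply: L1Z; [case: (hx i) | case: (hj i)].
  rewrite -Ex_sum//; apply: Ex_le; [exact: VL2_sqr mixed_noise_VL2|exact: L1_sum|].
  move=> w; apply: le_trans (enorm_sqr_simplex _ (ls w)) _.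
  apply: ler_sum => i _; rewrite ![2 * (l w 0 i * _)]mulrCA -mulrDr.
  apply: ler_wpM2l => //; rewrite -(enormN (mxapp _ _)).
  exact: enorm_sqrD_le.
have E1 : 2 * s1 ^+ 2 = \sum_i 2 * s1 ^+ 2 * Ex (fun w => l w 0 i).
  by rewrite -mulr_sumr Ex_weights mulr1.
apply: le_trans step _; rewrite E1 mulr_sumr -big_split /=.
apply: ler_sum => i _; apply: lerD; rewrite -mulrA ler_pM2l//.
  by case: (hx i).
by case: (hj i).
Qed.

End MixedNoise.
End OneStep.

(** * The Lyapunov function *)

Lemma le_of_eq (R : numDomainType) (a b : R) : a = b -> a <= b.
Proof. by move=> ->. Qed.

(* [U] is the squared step of [x], [Y], [Z], [p], [q], [d] are the squared errors of
   [y], [z], [h_x], [h_lambda], [lambda], and [V] is the objective value.  Each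
   weight lets the contraction of one error absorb its coefficients in the other
   recursions; what is left of [U] is absorbed by the decrease of [V], provided
   that [tau] (through [i4], which is [(4 tau^2)^-1]) is small. *)
Section Lyapunov.
Context {R : realType}.
Variables (M mu kap nu n m i2 al s r tau i4 : R).
Hypothesis M1 : 1 <= M.
Hypothesis mu0 : 0 < mu.
Hypothesis n1 : 1 <= n.
Hypothesis m0 : 0 < m.
Hypothesis i20 : 0 < i2.
Hypothesis i2E : m ^+ 2 * i2 = 1.
Hypothesis kapM : 64 * M <= kap ^+ 2.
Hypothesis al0 : 0 < al.
Hypothesis s0 : 0 < s.
Hypothesis s1 : s <= 1.
Hypothesis r0 : 0 <= r.
Hypothesis rE : r * kap ^+ 2 = s.
Hypothesis tau0 : 0 < tau.
Variables (a B A ze w : R).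
Hypothesis a0 : 0 <= a.
Hypothesis A0 : 0 <= A.
Hypothesis ze0 : 0 <= ze.
Hypothesis w0 : 0 <= w.
Hypothesis aE : a * s = 6 * al.
Hypothesis BE : B = 8 * (M + 1) * n.
Hypothesis AE : A * s = 8 * B * al * i2.
Hypothesis zeE : ze * mu = 16 * M * a.
Hypothesis wE : w * mu = 2 * M * (ze + a + A).
Hypothesis UE : 3 * B * n * M * i2 * al + M * r * (a + A + w + ze) <= al * i4.

Let M0 : 0 <= M. Proof. exact: le_trans ler01 M1. Qed.
Let n0 : 0 <= n. Proof. exact: le_trans ler01 n1. Qed.
(** In the application [r] is [n alpha^2 / s], so that [M r] is the coefficient of the drift terms;
    it is at most [1 / 64] of the contraction rate. *)
Let Mr : M * r * 64 <= s.
Proof. by have := ler_wpM2l r0 kapM; rewrite rE; lra. Qed.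

(** Like [coef_l] and [coef_z], this collects all occurrences of one error in the weighted sum of
    the recursions. [coef_l] keeps a surplus [n M al d], which is part of the decrease to be
    proved. *)
Let coef_q (q : R) : 0 <= q ->
  - (A * s / 2) * q + 2 * B * al * i2 * q + a * (M * r) * i2 * q + A * (M * r) * q <= 0.
Proof.
have hM := M1; have hn := n1; have hs := s1.
move=> q0.
have h1 : 64 * (a * (M * r)) <= 6 * al by have := ler_wpM2l a0 Mr; rewrite aE; lra.
have h2 : 64 * (A * (M * r)) <= 8 * B * al * i2.
  by have := ler_wpM2l A0 Mr; rewrite AE; lra.
have iq : 0 <= i2 * q by apply: mulr_ge0 => //; exact: ltW.
have k1 := ler_wpM2r iq h1.
have k2 := ler_wpM2r q0 h2.
have aq : 0 <= al * (i2 * q) by apply: mulr_ge0 => //; exact: ltW.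
have B1 : 1 <= B.
  by rewrite BE; have := mulr_ge0 M0 n0; lra.
have k3 : 0 <= (B - 1) * (al * (i2 * q)) by apply: mulr_ge0 => //; lra.
rewrite AE; lra.
Qed.

Let coef_l (d : R) : 0 <= d ->
  - (B * al / 2) * d + 2 * n * M * al * d + a * (M * r) * d + A * (M * r) * m ^+ 2 * d
    <= - (n * M * al * d).
Proof.
have hM := M1; have hn := n1; have hs := s1.
move=> d0.
have h1 : 64 * (a * (M * r)) <= 6 * al by have := ler_wpM2l a0 Mr; rewrite aE; lra.
have h2 : 64 * (A * (M * r)) <= 8 * B * al * i2.
  by have := ler_wpM2l A0 Mr; rewrite AE; lra.
have k1 := ler_wpM2r d0 h1.
have k2 := ler_wpM2r (mulr_ge0 (sqr_ge0 m) d0) h2.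
have E : 8 * B * al * i2 * (m ^+ 2 * d) = 8 * B * al * d.
  have -> : 8 * B * al * i2 * (m ^+ 2 * d) = 8 * B * al * d * (m ^+ 2 * i2) by ring.
  by rewrite i2E mulr1.
rewrite E in k2.
have ad : 0 <= al * d by apply: mulr_ge0 => //; exact: ltW.
have k3 : 0 <= (n - 1) * (al * d) by apply: mulr_ge0 => //; lra.
have k4 : 0 <= n * M * (al * d) by apply: mulr_ge0 => //; exact: mulr_ge0.
rewrite BE in k2 *; lra.
Qed.

Let coef_z (z : R) : 0 <= z ->
  - (ze * s * mu / 8) * z + a * s * M * z + a * s ^+ 2 * M * z <= 0.
Proof.
have hM := M1; have hn := n1; have hs := s1.
move=> z0.
have E : ze * s * mu = 16 * M * a * s by rewrite -zeE; ring.
have asz : 0 <= a * s * M * z.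
  by do 2 (apply: mulr_ge0 => //); apply: mulr_ge0 => //; exact: ltW.
have k : 0 <= (1 - s) * (a * s * M * z) by apply: mulr_ge0 => //; lra.
rewrite E; lra.
Qed.

Lemma lyapunov_step (V V' U Y Y' Z Z' p p' q q' d d' : R) :
  0 <= U -> 0 <= Y -> 0 <= Z -> 0 <= p -> 0 <= q -> 0 <= d ->
  V' <= V + tau * (- 2 * al * i4 * U + al * (2 * p + 2 * (n * M * d))) ->
  Y' <= (1 - s * mu / 2) * Y + M * r * U + s ^+ 2 * n * M ->
  Z' <= (1 - s * mu / 8) * Z + s * M * Y + M * r * U + s ^+ 2 * n * M ->
  p' <= (1 - s / 2) * p + s * M * (Y + Z) + s ^+ 2 * M * (1 + Z) +
    M * r * (U + (i2 * q + d)) ->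
  q' <= (1 - s / 2) * q + s * M * Y + s ^+ 2 * n * M +
    M * r * (U + m ^+ 2 * (i2 * q + d)) ->
  d' <= (1 - al / 2) * d + 2 * (al * (i2 * q)) + 3 * al * n * M * i2 * U ->
  V' + tau * (a * p' + B * d' + A * q' + w * Y' + ze * Z') <=
  V + tau * (a * p + B * d + A * q + w * Y + ze * Z)
    - al * tau * (p + n * M * d + i4 * U) +
    tau * (s ^+ 2 * n * M * (a + A + w + ze)).
Proof.
have hM := M1; have hn := n1; have hs := s1.
move=> U0 Y0 Z0 p0 q0 d0 hV hY hZ hp hq hd.
have B0 : 0 <= B by rewrite BE; apply: mulr_ge0 => //; apply: mulr_ge0 => //; lra.
have cq := coef_q q0; have cl := coef_l d0; have cz := coef_z Z0.
have cy : - (w * s * mu / 2) * Y + ze * (s * M * Y) + a * (s * M * Y) + A * (s * M * Y) = 0.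
  have -> : w * s * mu = 2 * M * (ze + a + A) * s by rewrite -wE; ring.
  by field.
have cU := ler_wpM2r U0 UE.
have cn : a * (s ^+ 2 * M) <= a * (s ^+ 2 * n * M).
  apply: ler_wpM2l => //; apply: ler_wpM2r => //.
  by rewrite ler_peMr// sqr_ge0.
have mq : m ^+ 2 * (i2 * q + d) = q + m ^+ 2 * d by rewrite mulrDr mulrA i2E mul1r.
rewrite mq in hq.
have h1 := ler_wpM2l a0 hp; have h2 := ler_wpM2l B0 hd; have h3 := ler_wpM2l A0 hq.
have h4 := ler_wpM2l w0 hY; have h5 := ler_wpM2l ze0 hZ.
have main : a * p' + B * d' + A * q' + w * Y' + ze * Z' +
    (- 2 * al * i4 * U + al * (2 * p + 2 * (n * M * d))) <=
    a * p + B * d + A * q + w * Y + ze * Z - al * (p + n * M * d + i4 * U) +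
    s ^+ 2 * n * M * (a + A + w + ze).
  have ap : a * (s / 2 * p) = 3 * al * p.
    have -> : a * (s / 2 * p) = a * s * p / 2 by ring.
    by rewrite aE; field.
  lra.
have := ler_wpM2l (ltW tau0) main; lra.
Qed.

End Lyapunov.

Lemma telescope_bound (R : realType) (W X : nat -> R) (c N : R) K :
  (forall k, W k.+1 <= W k - c * X k + N) ->
  c * \sum_(0 <= k < K) X k <= W 0 - W K + K%:R * N.
Proof.
move=> h; elim: K => [|K IH]; first by rewrite big_geq// mulr0 mul0r addr0 subrr.
rewrite big_nat_recr//= mulrDr -[in K.+1%:R]addn1 natrD; have := h K; lra.
Qed.

(** A bound for the sum of the weights [a + A + w + ze], multiplied by [8 M sqrt n], in units of
    [n / mu_lambda^2]; see [weights_sum]. *)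
Definition weight_const (R : realType) (M mu : R) : R :=
  (1 + 2 * M / mu) * (6 + 64 * (M + 1) + 96 * M / mu).

(** With [tau = step_const M mu * m / n], the coefficient [(4 tau^2)^-1] is [(n / m)^2] times the
    square of the sum in the parentheses. Its two terms dominate the drift of the five weighted
    targets: [weight_const] for those with weights [a], [A], [w], [ze], and [24 M (M + 1)] for
    [lstar]. *)
Definition step_const (R : realType) (M mu : R) : R :=
  (2 * (weight_const M mu + 24 * M * (M + 1)))^-1.

(** In units of [n sqrt n / mu_lambda^2]: the range of the objective divided by [tau], the weighted
    initial errors, and the initial error of [lambda]. *)
Definition start_const (R : realType) (M mu D : R) : R :=
  2 * M / step_const M mu + weight_const M mu * (M + 2 * D ^+ 2) + 32 * (M + 1).

(** * Explicit weights and the summed bound *)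

Section Weights.
Context {R : realType}.
Variables (M mu nu n m i2 al s tau D : R).
Hypothesis M1 : 1 <= M.
Hypothesis mu0 : 0 < mu.
Hypothesis nu1 : 1 <= nu.
Hypothesis nE : n = nu ^+ 2.
Hypothesis m0 : 0 < m.
Hypothesis m1 : m <= 1.
Hypothesis i20 : 0 < i2.
Hypothesis i2E : m ^+ 2 * i2 = 1.
Hypothesis al0 : 0 < al.
Hypothesis sE : s = 8 * M * nu * al.
Hypothesis s1 : s <= 1.
Hypothesis tauE : tau = step_const M mu * m / n.

Local Notation kap := (8 * M).
Local Notation CS := (weight_const M mu).
Local Notation t := (step_const M mu).
Local Notation B := (8 * (M + 1) * n).
Let a := 6 / (kap * nu).
Let A := 8 * B * i2 / (kap * nu).
Let ze := 16 * M * a / mu.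
Let w := 2 * M * (ze + a + A) / mu.
Let i4 := (4 * tau ^+ 2)^-1.
Let r := nu * al / kap.

Let M0 : 0 < M. Proof. exact: lt_le_trans ltr01 M1. Qed.
Let kap0 : 0 < kap. Proof. exact: mulr_gt0. Qed.
Let nu0 : 0 < nu. Proof. exact: lt_le_trans ltr01 nu1. Qed.
Let n1 : 1 <= n. Proof. by rewrite nE exprn_ege1. Qed.
Let n0 : 0 < n. Proof. exact: lt_le_trans ltr01 n1. Qed.
Let kn0 : 0 < kap * nu. Proof. exact: mulr_gt0. Qed.
Let M10 : 0 < M + 1. Proof. exact: addr_gt0. Qed.
Let B0 : 0 < B. Proof. by rewrite mulr_gt0// mulr_gt0. Qed.
Let a0 : 0 < a. Proof. by rewrite divr_gt0. Qed.
Let A0 : 0 < A. Proof. by rewrite divr_gt0// mulr_gt0// mulr_gt0. Qed.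
Let ze0 : 0 < ze. Proof. by rewrite divr_gt0// mulr_gt0// mulr_gt0. Qed.
Let w0 : 0 < w. Proof. by rewrite divr_gt0// mulr_gt0 ?mulr_gt0// !addr_gt0. Qed.
Let CS64 : 64 * (M + 1) <= CS.
Proof.
have h : 0 <= M / mu by rewrite divr_ge0// ltW.
have hM := M1; rewrite /weight_const -!mulrA; move: (M / mu) h => v h.
have := mulr_ge0 h (ltW M0); have := mulr_ge0 h h; nra.
Qed.
Let CS0 : 0 < CS. Proof. by apply: lt_le_trans CS64; rewrite mulr_gt0. Qed.
Let X0 : 0 < CS + 24 * M * (M + 1). Proof. by rewrite addr_gt0// !mulr_gt0. Qed.
Let t0 : 0 < t. Proof. by rewrite invr_gt0 mulr_gt0. Qed.
Let tau0 : 0 < tau. Proof. by rewrite tauE divr_gt0// mulr_gt0. Qed.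
Let i21 : 1 <= i2.
Proof.
have : m ^+ 2 <= 1 by rewrite expr_le1// ltW.
by move=> /(ler_wpM2r (ltW i20)); rewrite i2E mul1r.
Qed.
Let ni1 : 1 <= n * i2.
Proof. by rewrite -[1]mulr1; apply: ler_pM. Qed.

Let weights_sum : (a + A + w + ze) * (kap * nu) <= CS * (n * i2).
Proof.
have e1 : a * (kap * nu) = 6 by rewrite divfK// gt_eqF.
have e2 : A * (kap * nu) = 64 * (M + 1) * (n * i2).
  by rewrite divfK ?gt_eqF//; ring.
have e3 : ze * (kap * nu) = 96 * M / mu.
  have -> : ze * (kap * nu) = 16 * M * (a * (kap * nu)) / mu by rewrite /ze; ring.
  by rewrite e1; ring.
have -> : (a + A + w + ze) * (kap * nu) = (1 + 2 * M / mu) *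
    (a * (kap * nu) + A * (kap * nu) + ze * (kap * nu)) by rewrite /w; ring.
rewrite e1 e2 e3 /weight_const -[X in _ <= X]mulrA; apply: ler_wpM2l.
  by rewrite addr_ge0// divr_ge0 ?(ltW mu0)// mulr_ge0// ltW.
have h : 0 <= 96 * M / mu by rewrite divr_ge0 ?(ltW mu0)// mulr_ge0// ltW.
have h1 := ler_wpM2l h ni1; rewrite mulr1 in h1.
have h2 := ni1; lra.
Qed.

(** This is where [tau] must be small: what the squared step of [x] contributes to all the
    recursions has to fit under [al / (4 tau^2)]. *)
Let weights_U : 3 * B * n * M * i2 * al + M * r * (a + A + w + ze) <= al * i4.
Proof.
have hM := M1.
have e4 : i4 = n ^+ 2 * i2 * (CS + 24 * M * (M + 1)) ^+ 2.
  have i2i : i2 = m ^- 2 by apply: (mulfI (x := m ^+ 2)); rewrite ?i2E ?divff// gt_eqF// exprn_gt0.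
  rewrite /i4 tauE /step_const i2i; move: X0; move: (_ + _ * (M + 1)) => X hX.
  by field; rewrite !gt_eqF.
have e5 : M * r * (a + A + w + ze) = M * al / kap ^+ 2 * ((a + A + w + ze) * (kap * nu)).
  by rewrite /r; move: (a + A + w + ze) => S; field; rewrite gt_eqF.
have k1 : M * al / kap ^+ 2 <= M * al.
  rewrite ler_pdivrMr ?exprn_gt0// ler_peMr ?mulr_ge0 ?(ltW M0) ?(ltW al0)//.
  by apply: exprn_ege1; lra.
have k2 : M * r * (a + A + w + ze) <= M * al * (CS * (n * i2)).
  rewrite e5; apply: ler_pM weights_sum => //.
    by rewrite divr_ge0 ?mulr_ge0 ?(ltW M0) ?(ltW al0)// exprn_ge0// ltW.
  by rewrite mulr_ge0 ?(ltW kn0)// !addr_ge0// ltW.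
have k3 : M * al * (CS * (n * i2)) <= M * al * (CS * (n ^+ 2 * i2)).
  apply: ler_wpM2l; first by rewrite mulr_ge0 ?(ltW M0) ?(ltW al0).
  apply: ler_wpM2l; first exact: ltW.
  by apply: ler_wpM2r; [exact: ltW | rewrite expr2 ler_peMl// ltW].
have k4 : M * (CS + 24 * (M + 1)) <= (CS + 24 * M * (M + 1)) ^+ 2.
  rewrite expr2; have h := CS64; apply: ler_pM; try lra.
    by rewrite -mulrA; have := mulr_ge0 (ltW M0) (ltW M10); lra.
  by have := ler_wpM2r (ltW M10) hM; rewrite mul1r -mulrA; lra.
have h0 : 0 <= al * (n ^+ 2 * i2) by apply: mulr_ge0; [exact: ltW | apply: mulr_ge0; [exact: sqr_ge0 | exact: ltW]].
have := ler_wpM2l h0 k4; rewrite e4.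
have -> : 3 * B * n * M * i2 * al = 24 * M * (M + 1) * (al * (n ^+ 2 * i2)) by ring.
move: k2 k3; move: (M * r * _) => W; lra.
Qed.

Variables (V U Y Z p q d : nat -> R).
Hypothesis U0 : forall k, 0 <= U k.
Hypothesis Y0 : forall k, 0 <= Y k.
Hypothesis Z0 : forall k, 0 <= Z k.
Hypothesis p0 : forall k, 0 <= p k.
Hypothesis q0 : forall k, 0 <= q k.
Hypothesis d0 : forall k, 0 <= d k.
Hypothesis rV : forall k, V k.+1 <= V k - al / (2 * tau) * U k +
  al * tau * (2 * p k + 2 * (n * M * d k)).
Hypothesis rY : forall k, Y k.+1 <= (1 - s * mu / 2) * Y k +
  M / s * (n * al ^+ 2 * U k) + s ^+ 2 * n * M.
Hypothesis rZ : forall k, Z k.+1 <= (1 - s * mu / 8) * Z k + s * M * Y k +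
  M / s * (n * al ^+ 2 * U k) + s ^+ 2 * n * M.
Hypothesis rp : forall k, p k.+1 <= (1 - s / 2) * p k + s * M * (Y k + Z k) +
  s ^+ 2 * M * (1 + Z k) + M / s * (n * al ^+ 2 * (U k + (i2 * q k + d k))).
Hypothesis rq : forall k, q k.+1 <= (1 - s / 2) * q k + s * M * Y k +
  s ^+ 2 * n * M + M / s * (n * al ^+ 2 * (U k + m ^+ 2 * (i2 * q k + d k))).
Hypothesis rd : forall k, d k.+1 <= (1 - al / 2) * d k + 2 * (al * (i2 * q k)) +
  3 * al * n * M * i2 * U k.
Hypothesis hV : forall k, `|V k| <= M.
Hypothesis hY : Y 0 <= n * (M + 2 * D ^+ 2).
Hypothesis hZ : Z 0 <= n * (M + 2 * D ^+ 2).
Hypothesis hp : p 0 <= M.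
Hypothesis hq : q 0 <= n * M.
Hypothesis hd : d 0 <= 4.

Let W k := V k + tau * (a * p k + B * d k + A * q k + w * Y k + ze * Z k).

Lemma weighted_bound K : al * \sum_(0 <= k < K) (p k + n * M * d k + (4 * tau ^+ 2)^-1 * U k) <=
  start_const M mu D * (n * nu * i2) +
  K%:R * (8 * M ^+ 2 * CS * (n ^+ 2 * nu * i2 * al ^+ 2)).
Proof.
have s0 : 0 < s by rewrite sE !mulr_gt0.
have rE v : M / s * (n * al ^+ 2 * v) = M * r * v.
  by rewrite sE /r nE; field; rewrite !gt_eqF.
have step k : W k.+1 <= W k - (al * tau) * (p k + n * M * d k + i4 * U k) +
    tau * (s ^+ 2 * n * M * (a + A + w + ze)).
  apply: (@lyapunov_step _ M mu kap n m i2 al s r tau i4) => //.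
  - by have := ler_wpM2l (ltW M0) M1; rewrite exprMn expr2; lra.
  - by rewrite /r divr_ge0 ?(ltW kap0)// mulr_ge0// ltW.
  - by rewrite /r sE; field; rewrite gt_eqF.
  - exact: ltW.
  - exact: ltW.
  - exact: ltW.
  - exact: ltW.
  - by rewrite /a sE; field; rewrite !gt_eqF.
  - by rewrite /A sE; field; rewrite !gt_eqF.
  - by rewrite /ze divfK// gt_eqF.
  - by rewrite /w divfK// gt_eqF.
  - apply: le_trans (rV k) _; apply: le_of_eq; rewrite /i4; field.
    by rewrite gt_eqF.
  - by have := rY k; rewrite rE.
  - by have := rZ k; rewrite rE.
  - by have := rp k; rewrite rE.
  - by have := rq k; rewrite rE.
(* The weighted errors are nonnegative, so the bound on the objective suffices from below. *)
have WK : - M <= W K.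
  have := hV K; rewrite ler_norml => /andP[h _]; rewrite /W.
  have : 0 <= tau * (a * p K + B * d K + A * q K + w * Y K + ze * Z K).
    by apply: mulr_ge0; [exact: ltW|do !apply: addr_ge0; apply: mulr_ge0 => //; exact: ltW].
  lra.
have D0 := sqr_ge0 D.
have b0 : a * p 0 + B * d 0 + A * q 0 + w * Y 0 + ze * Z 0 <=
    (a + A + w + ze) * (n * (M + 2 * D ^+ 2)) + 4 * B.
  have k0 : M <= n * (M + 2 * D ^+ 2).
    have M2 : 0 <= M + 2 * D ^+ 2 by have := M0; lra.
    by have := ler_wpM2r M2 n1; lra.
  have k1 := ler_wpM2l (ltW a0) (le_trans hp k0).
  have k2 := ler_wpM2l (ltW B0) hd.
  have k3 : A * q 0 <= A * (n * (M + 2 * D ^+ 2)).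
    apply: ler_wpM2l; first exact: ltW.
    by apply: le_trans hq _; rewrite ler_pM2l//; lra.
  have k4 := ler_wpM2l (ltW w0) hY; have k5 := ler_wpM2l (ltW ze0) hZ.
  lra.
have W0 : W 0 <= M + tau * ((a + A + w + ze) * (n * (M + 2 * D ^+ 2)) + 4 * B).
  have := hV 0%N; rewrite ler_norml => /andP[_ h]; rewrite /W.
  have := ler_wpM2l (ltW tau0) b0; lra.
have tel : (al * tau) * \sum_(0 <= k < K) (p k + n * M * d k + i4 * U k) <=
  W 0 - W K + K%:R * (tau * (s ^+ 2 * n * M * (a + A + w + ze))) := telescope_bound K step.
have main : al * \sum_(0 <= k < K) (p k + n * M * d k + i4 * U k) <=
    2 * M / tau + ((a + A + w + ze) * (n * (M + 2 * D ^+ 2)) + 4 * B) +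
    K%:R * (s ^+ 2 * n * M * (a + A + w + ze)).
  have e1 : tau * (2 * M / tau) = 2 * M by rewrite mulrC divfK// gt_eqF.
  rewrite -(ler_pM2l tau0); move: e1 tel WK W0.
  move: (\sum_(_ <= _ < _) _) (W 0%N) (W K) (s ^+ 2 * n * M * _) (2 * M / tau)
    ((a + A + w + ze) * _ + _) => S u v N g h.
  lra.
apply: le_trans main _; apply: lerD; last first.
  apply: ler_wpM2l => //.
  have -> : s ^+ 2 * n * M * (a + A + w + ze) =
      8 * M ^+ 2 * n * nu * al ^+ 2 * ((a + A + w + ze) * (kap * nu)).
    by rewrite sE; ring.
  have h : 0 <= 8 * M ^+ 2 * n * nu * al ^+ 2.
    do !apply: mulr_ge0; rewrite ?sqr_ge0//; exact: ltW.
  by apply: le_trans (ler_wpM2l h weights_sum) _; apply: le_of_eq; ring.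
have nn : n * i2 <= n * nu * i2.
  by apply: ler_wpM2r; [exact: ltW | rewrite ler_peMr// ltW].
have k1 : 2 * M / tau <= 2 * M / t * (n * nu * i2).
  have -> : 2 * M / tau = 2 * M / t * (n * (m * i2)).
    have -> : m * i2 = m^-1.
      by apply: (mulfI (x := m)); rewrite ?gt_eqF// mulrA -expr2 i2E divff// gt_eqF.
    by rewrite tauE; field; rewrite !gt_eqF.
  apply: ler_wpM2l; first by rewrite divr_ge0 ?(ltW t0)// mulr_ge0// ltW.
  apply: le_trans nn; rewrite ler_pM2l//.
  by rewrite ler_piMl// ltW.
have k2 : (a + A + w + ze) * (n * (M + 2 * D ^+ 2)) <=
    CS * (M + 2 * D ^+ 2) * (n * nu * i2).
  have -> : (a + A + w + ze) * (n * (M + 2 * D ^+ 2)) =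
     ((a + A + w + ze) * (kap * nu)) * (nu * (M + 2 * D ^+ 2) / kap).
    by rewrite nE; field; rewrite gt_eqF.
  have M2 : 0 <= M + 2 * D ^+ 2 by have := M0; lra.
  have h : 0 <= nu * (M + 2 * D ^+ 2) / kap.
    by rewrite divr_ge0 ?(ltW kap0)// mulr_ge0// ltW.
  apply: le_trans (ler_wpM2r h weights_sum) _.
  have -> : CS * (M + 2 * D ^+ 2) * (n * nu * i2) =
    CS * (n * i2) * (nu * (M + 2 * D ^+ 2)) by ring.
  apply: ler_wpM2l.
    exact (mulr_ge0 (ltW CS0) (mulr_ge0 (ltW n0) (ltW i20))).
  rewrite ler_pdivrMr// ler_peMr//; last by have := M1; lra.
  by rewrite mulr_ge0// ltW.
have k3 : 4 * B <= 32 * (M + 1) * (n * nu * i2).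
  have -> : 4 * B = 32 * (M + 1) * n by ring.
  apply: ler_wpM2l; first by rewrite mulr_ge0// ltW.
  by apply: le_trans nn; rewrite ler_peMr// ltW.
by rewrite /start_const !mulrDl; lra.
Qed.

End Weights.

(** * A run of the algorithm *)

(** Of the decrease [1 / tau] of the projected step, a quarter goes to the gradient error through
    Young's inequality and a quarter to the curvature [kP]; half remains. *)
Lemma value_arith (R : realFieldType) (alpha tau kP : R) : 0 < alpha -> 0 < tau ->
  kP * (alpha * tau) <= 4^-1 ->
  forall v' v dg dh M gg B : R,
  v' - v - alpha * dg <= kP * (alpha ^+ 2 * M) -> dh <= - tau^-1 * M ->
  2 * (dg - dh) <= 2 * tau * gg + (2 * tau)^-1 * M -> gg <= B -> 0 <= M ->
  v' <= v - alpha / (2 * tau) * M + alpha * tau * B.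
Proof.
move=> a0 t0 hk v' v dg dh M gg B h1 h2 h3 h4 M0.
have t1 : tau * tau^-1 = 1 by rewrite divff// gt_eqF.
have E2 : (2 * tau)^-1 = tau^-1 / 2 by rewrite invfM mulrC.
have E3 : alpha / (2 * tau) = alpha * tau^-1 / 2 by rewrite E2 mulrA.
have hk' : kP * alpha <= tau^-1 / 4.
  by rewrite ler_pdivlMl// mulrC -mulrA.
rewrite E3; rewrite E2 in h3; move: (tau^-1) t1 h2 h3 hk' => ti t1 h2 h3 hk'.
have k1 : alpha * dg <= alpha * (- (3 / 4) * (ti * M) + tau * B).
  by rewrite ler_pM2l//; have := ler_wpM2l (ltW t0) h4; lra.
have k2 := ler_wpM2r (mulr_ge0 (ltW a0) M0) hk'.
lra.
Qed.

Lemma sigma_mx_sub (R : realType) d (T : measurableType d) m n (X : T -> 'M[R]_(m, n)) :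
  sigma_mx X `<=` measurable -> mx_meas X.
Proof.
move=> h i j _ B mB; apply: h; apply: sub_sigma_algebra.
by exists i, j; exists B.
Qed.

Lemma sub_sigma_mx (R : realType) d (T : measurableType d) m n (X : T -> 'M[R]_(m, n)) :
  mx_meas X -> sigma_mx X `<=` measurable.
Proof.
move=> h; apply: smallest_sub; first exact: sigma_algebra_measurable.
by move=> _ [i [j [B mB <-]]]; exact: h.
Qed.

Lemma vec_meas_mx (R : realType) d (T : measurableType d) n (X : T -> 'rV[R]_n) :
  vec_meas X <-> mx_meas X.
Proof.
by split=> [h i j|h j]; [rewrite (ord1 i); exact: h | exact: h].
Qed.

Lemma ler_nth_sum (R : numDomainType) (t : seq R) i :
  all (>= 0) t -> t`_i <= \sum_(v <- t) v.
Proof.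
elim: t i => [|v t IH] [|i] /=; rewrite ?big_nil ?big_cons//.
  move=> /andP[_ /allP h]; rewrite lerDl big_seq.
  by apply: sumr_ge0 => u; exact: h.
by move=> /andP[v0 h]; apply: le_trans (IH i h) _; rewrite lerDr.
Qed.

(** * A common bound for the coefficients *)

Section RunConst.
Context {R : realType} (c : constants R).

(* The coefficients of the one-step recursions and of the starting errors; the
   Lyapunov argument only needs a common upper bound for them. *)
Definition run_terms : seq R :=
  [:: 2 * sigma_g1 c ^+ 2;
      2 * (4 * sigma_g2 c ^+ 2 * kap_r c ^+ 2 + 2 * sigma_f2 c ^+ 2);
      2 * kap_s c;
      (1 + 2 / mu_g c) * kap_y c ^+ 2;
      (1 + 4 / mu_g c) * kap_z c ^+ 2;
      2 * kap_b c;
      2 * (2 * sigma_f1 c ^+ 2 + 4 * sigma_g2 c ^+ 2 * kap_r c ^+ 2);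
      8 * sigma_g2 c ^+ 2;
      6 * kap_G c ^+ 2;
      12 * L_Phi c ^+ 2;
      2 * L_f c ^+ 2;
      2 * sigma_f0 c ^+ 2;
      12;
      kap_Q c;
      2 * b_Phi c ^+ 2 + 8;
      b_Phi c + 2;
      2 * kap_r c ^+ 2].

Definition run_const : R := 1 + \sum_(v <- run_terms) v.

Hypothesis hc : valid_constants c.

Lemma run_terms_ge0 : all (>= 0) run_terms.
Proof.
have mu0 := ltW (mu_gt0 hc).
have f a : 0 <= a -> 0 <= 1 + a / mu_g c.
  by move=> a0; apply: addr_ge0 => //; apply: divr_ge0.
have s0 : 0 <= kap_s c by apply: mulr_ge0; [exact: f|exact: sqr_ge0].
have b0 : 0 <= kap_b c.
  by apply: addr_ge0; apply: mulr_ge0 => //; exact: sqr_ge0.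
have Q0 := kap_Q_ge0 hc; have B0 := bPhi_ge0 hc.
have p4 u v : 0 <= 4 * u ^+ 2 * v ^+ 2 :> R.
  by apply: mulr_ge0; [apply: mulr_ge0 => //|]; exact: sqr_ge0.
have p2 a u : 0 <= a -> 0 <= a * u ^+ 2 :> R by move=> a0; apply: mulr_ge0 => //; exact: sqr_ge0.
have pf a u : 0 <= a -> 0 <= (1 + a / mu_g c) * u ^+ 2.
  by move=> a0; apply: p2; exact: f.
rewrite /run_terms /=; repeat (apply/andP; split) => //; try exact: p2; try exact: pf;
  try (by apply: mulr_ge0); try (by apply: addr_ge0 => //; exact: p2).
- by apply: mulr_ge0 => //; apply: addr_ge0; [exact: p4|exact: p2].
- by apply: mulr_ge0 => //; apply: addr_ge0; [exact: p2|exact: p4].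
Qed.

Lemma run_const_ge i : run_terms`_i <= run_const.
Proof.
apply: le_trans (ler_nth_sum i run_terms_ge0) _.
by rewrite /run_const lerDr.
Qed.

Lemma run_const_ge1 : 1 <= run_const.
Proof.
rewrite /run_const lerDl big_seq; apply: sumr_ge0 => v.
by move: v; apply/allP; exact: run_terms_ge0.
Qed.

End RunConst.

Section Run.
Context {R : realType} {n : nat} {pb : bilevel R n} {d0 : measure_display}
  {T : measurableType d0}.
Variables (c : constants R) (P : probability T R) (e : execution pb T).
Variables (m tau alpha s : R).
Hypothesis hc : valid_constants c.
Hypothesis hok : feasible_set_ok pb.
Hypothesis ha : bilevel_assumptions pb c.
Hypothesis n0 : (0 < n)%N.
Hypothesis m0 : 0 < m.
Hypothesis m1 : m <= 1.
Hypothesis tau0 : 0 < tau.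
Hypothesis al0 : 0 < alpha.
Hypothesis al1 : alpha <= 1.
Hypothesis s0 : 0 < s.
Hypothesis s1 : s <= 1.
Variables (x0 : 'rV[R]_(dimx pb)) (l0 : 'rV[R]_n) (y0 z0 : forall i, 'rV[R]_(dimy pb i)).
Hypothesis hinit : morma_soba_init e x0 l0 y0 z0.
Hypothesis hstep : forall k w, morma_soba_step e m tau m^-1 (fun=> alpha)
  (fun=> s) (fun=> s) (fun=> s) k w.
Hypothesis horacle : forall k, oracle_assumptions P e c k.

Local Notation L1 := (L1 P).
Local Notation L2 := (L2 P).
Local Notation Ex := (Ex P).
Local Notation VL2 := (VL2 P).
Local Notation Lg := (L_dg c).
Local Notation mu := (mu_g c).
Local Notation LP := (L_Phi c).
Local Notation G := (@hypergrad R n pb).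
Local Notation x k w := (it_x e k w).
Local Notation l k w := (it_l e k w).
Local Notation y i k w := (it_y e i k w).
Local Notation z i k w := (it_z e i k w).
Local Notation hx k w := (it_hx e k w).
Local Notation hl k w := (it_hl e k w).

Definition cand_x k w := proj (feas pb) (x k w - tau *: hx k w).
Definition cand_l k w := proj (simplex R n) (l k w + m^-1 *: hl k w).

Let fconv := feas_convex hok.
Let fnear := feas_nearest hok.
Let sconv := @simplex_convex R n.
Let snear := @simplex_nearest R n n0.

Lemma run_x k w : x k.+1 w = x k w + alpha *: (cand_x k w - x k w).
Proof. exact: step_x (hstep k w). Qed.

Lemma run_l k w : l k.+1 w = l k w + alpha *: (cand_l k w - l k w).
Proof. exact: step_l (hstep k w). Qed.

Lemma cand_x_feas k w : feas pb (cand_x k w).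
Proof. by have [] := projP fnear (x k w - tau *: hx k w). Qed.

Lemma cand_l_simplex k w : simplex R n (cand_l k w).
Proof. by have [] := projP snear (l k w + m^-1 *: hl k w). Qed.

Lemma run_feas k w : feas pb (x k w).
Proof.
elim: k => [|k IH]; first by rewrite (init_x hinit); exact: x0_feas hinit.
by rewrite run_x; apply: fconv => //; [exact: cand_x_feas | rewrite (ltW al0)].
Qed.

Lemma run_simplex k w : simplex R n (l k w).
Proof.
elim: k => [|k IH]; first by rewrite (init_l hinit); exact: l0_simplex hinit.
by rewrite run_l; apply: sconv => //; [exact: cand_l_simplex | rewrite (ltW al0)].
Qed.

Lemma run_l01 k w i : 0 <= l k w 0 i <= 1.
Proof.
have [h0 h1] := run_simplex k w; rewrite h0 -h1 (bigD1 i)//= lerDl.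
by apply: sumr_ge0 => j _.
Qed.

(* [history e k] is convertible to [<<s hist_gen k>>]. *)
Definition hist_gen k : set (set T) :=
  \bigcup_(j in [set j | (j <= k)%N])
    (sigma_mx (it_x e j) `|` sigma_mx (it_l e j) `|`
     (\bigcup_i (sigma_mx (it_y e i j) `|` sigma_mx (it_z e i j))) `|`
     sigma_mx (it_hx e j) `|` sigma_mx (it_hl e j)).

(** A conclusion, reached by induction in [square_integrable_run]. Besides giving a meaning to the
    expectations, it provides the measurability of the iterates that makes the history a family of
    measurable sets. *)
Definition square_integrable k : Prop :=
  [/\ VL2 (it_x e k), VL2 (it_l e k), (forall i, VL2 (it_y e i k)) &
      (forall i, VL2 (it_z e i k)) ] /\ VL2 (it_hx e k) /\ VL2 (it_hl e k).

Lemma hist_gen_sub k : (forall j, (j <= k)%N -> square_integrable j) ->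
  <<s hist_gen k >> `<=` measurable.
Proof.
move=> h; apply: smallest_sub; first exact: sigma_algebra_measurable.
have v q (X : T -> 'rV[R]_q) : VL2 X -> sigma_mx X `<=` measurable.
  by move=> [mX _]; apply: sub_sigma_mx; apply/vec_meas_mx.
move=> A [j /= jk]; have [[hx_ hl_ hy hz] [hhx hhl]] := h j jk.
by move=> [[[[/(v _ _ hx_)|/(v _ _ hl_)]|[i _ [/(v _ _ (hy i))|/(v _ _ (hz i))]]]|
  /(v _ _ hhx)]|/(v _ _ hhl)].
Qed.

Local Notation Ph := (@Phi R n pb).

Definition grad_x k w := mix_grad G (x k w) (l k w).
Definition grad_l k w := obj_vec Ph (x k w) - m *: (l k w - unif R n).
Definition opt_l k w := lstar Ph m (x k w).

Definition move_sq k w := enorm (cand_x k w - x k w) ^+ 2.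
Definition err_y i k w := enorm (y i k w - ystar i (x k w)) ^+ 2.
Definition err_z i k w := enorm (z i k w - zstar i (x k w)) ^+ 2.
Definition err_hx k w := enorm (hx k w - grad_x k w) ^+ 2.
Definition err_hl k w := enorm (hl k w - grad_l k w) ^+ 2.
Definition err_l k w := enorm (l k w - opt_l k w) ^+ 2.
Definition value k w := reg_max Ph m (x k w).

Let LP0 : 0 <= LP := LPhi_ge0 hc.
Let Ph_lip i p q : `|Ph i p - Ph i q| <= LP * enorm (p - q).
Proof. exact: Phi_lip hc ha i p q. Qed.
Let G_le i p : enorm (G i p) <= LP.
Proof. exact: hypergrad_le hc ha i p. Qed.
Let G_lip i p q : enorm (G i p - G i q) <= kap_G c * enorm (p - q).
Proof. exact: hypergrad_lip hc ha i p q. Qed.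
Let Ph_le i p : `|Ph i p| <= b_Phi c.
Proof. exact: Phi_bound ha i p. Qed.
Let Ph_quad i p h : `|Ph i (p + h) - Ph i p - dot (G i p) h| <= kap_Q c * enorm h ^+ 2.
Proof. exact: Phi_quadratic hc ha i p h. Qed.

Lemma opt_l_simplex k w : simplex R n (opt_l k w).
Proof. exact: lstar_simplex. Qed.

(** Stated, like [meas_G] and [meas_grad_x], for any measurable type, so as to apply both to [T] and
    to [T] with the sigma-algebra of the history. *)
Lemma meas_obj d' (T' : measurableType d') (X : T' -> 'rV[R]_(dimx pb)) :
  vec_meas X -> vec_meas (fun w => obj_vec Ph (X w)).
Proof.
move=> hX j; rewrite (_ : (fun w => _) = (fun w => Ph j (X w))).
  by apply: continuous_comp_meas hX; exact: lipschitz_continuous (Ph_lip j).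
by apply/funext => w; rewrite mxE.
Qed.

Lemma meas_G i d' (T' : measurableType d') (X : T' -> 'rV[R]_(dimx pb)) :
  vec_meas X -> vec_meas (fun w => G i (X w)).
Proof.
move=> hX; apply: vec_meas_comp hX.
by apply: (@lipschitz_econtinuous _ _ _ _ (kap_G c)) => p q; exact: G_lip.
Qed.

Lemma meas_grad_x d' (T' : measurableType d') (X : T' -> 'rV[R]_(dimx pb))
    (Y : T' -> 'rV[R]_n) :
  vec_meas X -> vec_meas Y -> vec_meas (fun w => mix_grad G (X w) (Y w)).
Proof.
move=> hX hY; apply: vec_meas_sum => i; apply: vec_measZ; first exact: hY.
exact: meas_G.
Qed.

Lemma VL2_grad_x k : VL2 (it_x e k) -> VL2 (it_l e k) -> VL2 (grad_x k).
Proof.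
move=> hX hY; apply: (VL2_dom (meas_grad_x (VL2_meas hX) (VL2_meas hY))
  (L1_cst P (LP ^+ 2))) => w.
rewrite ler_pXn2r ?nnegrE ?enorm_ge0//.
exact: (mix_grad_le LP0 G_le _ (run_simplex k w)).
Qed.

Lemma VL2_grad_l k : VL2 (it_x e k) -> VL2 (it_l e k) -> VL2 (grad_l k).
Proof.
move=> hX hY; apply: VL2B; last by apply: VL2Z; apply: VL2B => //; exact: VL2_cst.
apply: (VL2_dom (meas_obj (VL2_meas hX)) (L1_cst P (n%:R * b_Phi c ^+ 2))) => w.
exact: obj_vec_le.
Qed.

Let lip_opt_l : elipschitz (Num.sqrt (n%:R * LP ^+ 2 / m ^+ 2)) (lstar Ph m).
Proof.
move=> p q; apply: ler_of_sqr.
  by apply: mulr_ge0; [exact: sqrtr_ge0 | exact: enorm_ge0].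
rewrite exprMn [Num.sqrt (_ / _) ^+ 2]sqr_sqrtr; first exact: (lstar_lip m n0 LP0 Ph_lip p q).
by apply: divr_ge0; [apply: mulr_ge0; [exact: ler0n|exact: sqr_ge0] | exact: sqr_ge0].
Qed.

Lemma VL2_opt_l k : VL2 (it_x e k) -> VL2 (opt_l k).
Proof. exact: (@VL2_lip _ _ _ P _ _ (it_x e k) _ _ lip_opt_l). Qed.

Let lip_ystar i : elipschitz (kap_y c) (@ystar R n pb i).
Proof. by move=> p q; exact: (ystar_lip hc ha). Qed.
Let lip_zstar i : elipschitz (kap_z c) (@zstar R n pb i).
Proof. by move=> p q; exact: (zstar_lip hc ha). Qed.

Lemma VL2_opt_y i k : VL2 (it_x e k) -> VL2 (fun w => ystar i (x k w)).
Proof. exact: (@VL2_lip _ _ _ P _ _ (it_x e k) _ _ (@lip_ystar i)). Qed.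
Lemma VL2_opt_z i k : VL2 (it_x e k) -> VL2 (fun w => zstar i (x k w)).
Proof. exact: (@VL2_lip _ _ _ P _ _ (it_x e k) _ _ (@lip_zstar i)). Qed.

Lemma move_x k w : enorm (x k w - x k.+1 w) ^+ 2 = alpha ^+ 2 * move_sq k w.
Proof.
rewrite run_x opprD addrA subrr sub0r enormN enormZ exprMn.
by rewrite real_normK ?num_real.
Qed.

(** * The recursions at a fixed iteration *)

Section AtStep.
Variable k : nat.
Hypothesis UT : <<s hist_gen k >> `<=` measurable.
Local Notation U := (hist_gen k).
Local Notation TU := (g_sigma_algebraType U).
Hypothesis sq : square_integrable k.

Let gen_hist q (X : T -> 'rV[R]_q) : sigma_mx X `<=` U -> hist_vec U X.
Proof.
move=> h; apply/(@vec_meas_mx R _ TU); apply: (@sigma_mx_sub R _ TU) => A /h.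
exact: sub_sigma_algebra.
Qed.

Lemma hist_x : hist_vec U (it_x e k).
Proof. by apply: gen_hist => A hA; exists k => //=; do 4 left. Qed.

Lemma hist_l : hist_vec U (it_l e k).
Proof. by apply: gen_hist => A hA; exists k => //=; do 3 left; right. Qed.

Lemma hist_y i : hist_vec U (it_y e i k).
Proof. by apply: gen_hist => A hA; exists k => //=; do 2 left; right; exists i => //; left. Qed.

Lemma hist_z i : hist_vec U (it_z e i k).
Proof. by apply: gen_hist => A hA; exists k => //=; do 2 left; right; exists i => //; right. Qed.

Lemma hist_hx : hist_vec U (it_hx e k).
Proof. by apply: gen_hist => A hA; exists k => //=; left; right. Qed.

Lemma hist_hl : hist_vec U (it_hl e k).
Proof. by apply: gen_hist => A hA; exists k => //=; right. Qed.

Let sx : VL2 (it_x e k). Proof. by case: sq => -[]. Qed.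
Let sl : VL2 (it_l e k). Proof. by case: sq => -[]. Qed.
Let sy i : VL2 (it_y e i k). Proof. by case: sq => -[]. Qed.
Let sz i : VL2 (it_z e i k). Proof. by case: sq => -[]. Qed.
Let shx : VL2 (it_hx e k). Proof. by case: sq => _ []. Qed.
Let shl : VL2 (it_hl e k). Proof. by case: sq => _ []. Qed.

Let xy i w := row_mx (x k w) (y i k w).
Let hist_xy i : hist_vec U (xy i).
Proof. by apply: (@vec_meas_row_mx _ TU R); [exact: hist_x | exact: hist_y]. Qed.
Let sxy i : VL2 (xy i). Proof. exact: VL2_row_mx. Qed.

Lemma hist_lip p q (X : T -> 'rV[R]_p) (F : 'rV[R]_p -> 'rV[R]_q) L :
  elipschitz L F -> hist_vec U X -> hist_vec U (fun w => F (X w)).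
Proof. by move=> hF hX; apply: (@vec_meas_comp _ TU) hX; exact: lipschitz_econtinuous hF. Qed.

Let lip_d1f i : elipschitz (L_df c) (fun p => lsubmx (grad (upper pb i) p)).
Proof.
move=> p q; rewrite -raddfB; apply: le_trans (enorm_lsubmx _) _.
exact: (upper_grad_lip ha).
Qed.

Let lip_d2f i : elipschitz (L_df c) (fun p => rsubmx (grad (upper pb i) p)).
Proof.
move=> p q; rewrite -raddfB; apply: le_trans (enorm_rsubmx _) _.
exact: (upper_grad_lip ha).
Qed.

Let lip_d2g i : elipschitz Lg (fun p => rsubmx (grad (lower pb i) p)).
Proof.
move=> p q; rewrite -raddfB; apply: le_trans (enorm_rsubmx _) _.
exact: (lower_grad_lip ha).
Qed.

Definition mean_ux i w := upper_d1 (x k w) (y i k w).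
Definition mean_uy i w := upper_d2 (x k w) (y i k w).
Definition mean_v i w := lower_d2 (x k w) (y i k w).
Definition mean_H i w := lower_d22 (x k w) (y i k w).
Definition mean_J i w := lower_d12 (x k w) (y i k w).
Definition mean_s w := \row_i upper pb i (row_mx (x k w) (y i k w)).
Definition opt_y i w := ystar i (x k w).
Definition opt_z i w := zstar i (x k w).

Lemma hist_mean_ux i : hist_vec U (mean_ux i).
Proof. exact: (@hist_lip _ _ (xy i) _ _ (@lip_d1f i) (@hist_xy i)). Qed.
Lemma hist_mean_uy i : hist_vec U (mean_uy i).
Proof. exact: (@hist_lip _ _ (xy i) _ _ (@lip_d2f i) (@hist_xy i)). Qed.
Lemma hist_mean_v i : hist_vec U (mean_v i).
Proof. exact: (@hist_lip _ _ (xy i) _ _ (@lip_d2g i) (@hist_xy i)). Qed.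
Lemma VL2_mean_ux i : VL2 (mean_ux i).
Proof. exact: (@VL2_lip _ _ _ P _ _ (xy i) _ _ (@lip_d1f i) (sxy i)). Qed.
Lemma VL2_mean_uy i : VL2 (mean_uy i).
Proof. exact: (@VL2_lip _ _ _ P _ _ (xy i) _ _ (@lip_d2f i) (sxy i)). Qed.
Lemma VL2_mean_v i : VL2 (mean_v i).
Proof. exact: (@VL2_lip _ _ _ P _ _ (xy i) _ _ (@lip_d2g i) (sxy i)). Qed.

Lemma hist_opt_y i : hist_vec U (opt_y i).
Proof. exact: (@hist_lip _ _ (it_x e k) _ _ (@lip_ystar i) hist_x). Qed.
Lemma hist_opt_z i : hist_vec U (opt_z i).
Proof. exact: (@hist_lip _ _ (it_x e k) _ _ (@lip_zstar i) hist_x). Qed.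

Let hess_entry i a b : continuous (fun p => hess (lower pb i) p a b).
Proof.
apply: (@lipschitz_continuous _ _ _ (L_d2g c)) => p q.
apply: le_trans (lower_hess_lip ha p q).
by move: (hess _ p) (hess _ q) => A B; have := opnorm_coord (A - B) a b; rewrite !mxE.
Qed.

Lemma hist_mean_H i : @mx_meas _ TU R _ _ (mean_H i).
Proof.
move=> a b; rewrite /mean_H /lower_d22.
rewrite (_ : (fun w => _) =
    (fun w => hess (lower pb i) (xy i w) (rshift _ a) (rshift _ b))).
  exact: (@continuous_comp_meas _ TU R _ _ _ (@hess_entry i _ _) (@hist_xy i)).
by apply/funext => w; move: (hess _ _) => A; rewrite !mxE.
Qed.

Lemma hist_mean_J i : @mx_meas _ TU R _ _ (mean_J i).
Proof.
move=> a b; rewrite /mean_J /lower_d12.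
rewrite (_ : (fun w => _) =
    (fun w => hess (lower pb i) (xy i w) (lshift _ a) (rshift _ b))).
  exact: (@continuous_comp_meas _ TU R _ _ _ (@hess_entry i _ _) (@hist_xy i)).
by apply/funext => w; move: (hess _ _) => A; rewrite !mxE.
Qed.

Let o_meas j : oracle_sigma e k j `<=` measurable.
Proof. exact: (oracle_measurable (horacle k)). Qed.
(** The ordinals from 0 to 4 here and below are positions in the list of [oracle_sigma]. *)
Let m_ux i : vec_meas (or_ux e i k.+1).
Proof. exact/vec_meas_mx/sigma_mx_sub/(@o_meas (inl (i, @Ordinal 5 0 isT))). Qed.
Let m_uy i : vec_meas (or_uy e i k.+1).
Proof. exact/vec_meas_mx/sigma_mx_sub/(@o_meas (inl (i, @Ordinal 5 1 isT))). Qed.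
Let m_v i : vec_meas (or_v e i k.+1).
Proof. exact/vec_meas_mx/sigma_mx_sub/(@o_meas (inl (i, @Ordinal 5 2 isT))). Qed.
Let m_H i : mx_meas (or_H e i k.+1).
Proof. exact/sigma_mx_sub/(@o_meas (inl (i, @Ordinal 5 3 isT))). Qed.
Let m_J i : mx_meas (or_J e i k.+1).
Proof. exact/sigma_mx_sub/(@o_meas (inl (i, @Ordinal 5 4 isT))). Qed.
Let m_s : vec_meas (or_s e k.+1).
Proof. exact/vec_meas_mx/sigma_mx_sub/(@o_meas (inr tt)). Qed.

Lemma VL2_cand_x : VL2 (cand_x k).
Proof.
have h : elipschitz 1 (proj (feas pb)).
  by move=> p q; rewrite mul1r; exact: proj_nonexpansive.
exact: (@VL2_lip _ _ _ P _ _ _ _ _ h (VL2B sx (VL2Z tau shx))).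
Qed.

Lemma VL2_cand_l : VL2 (cand_l k).
Proof.
have h : elipschitz 1 (proj (simplex R n)).
  by move=> p q; rewrite mul1r; exact: proj_nonexpansive.
exact: (@VL2_lip _ _ _ P _ _ _ _ _ h (VL2D sl (VL2Z m^-1 shl))).
Qed.

Lemma VL2_next_x : VL2 (it_x e k.+1).
Proof.
apply: VL2_ext (VL2D sx (VL2Z alpha (VL2B VL2_cand_x sx))) => w.
by rewrite run_x.
Qed.

Lemma VL2_next_l : VL2 (it_l e k.+1).
Proof.
apply: VL2_ext (VL2D sl (VL2Z alpha (VL2B VL2_cand_l sl))) => w.
by rewrite run_l.
Qed.

Lemma L1_move : L1 (move_sq k).
Proof. by apply: VL2_sqr; apply: VL2B => //; exact: VL2_cand_x. Qed.

Lemma drift_opt_y i w : enorm (ystar i (x k w) - ystar i (x k.+1 w)) ^+ 2 <=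
  kap_y c ^+ 2 * alpha ^+ 2 * move_sq k w.
Proof.
rewrite -mulrA -move_x -exprMn ler_pXn2r ?nnegrE ?enorm_ge0//; first exact: lip_ystar.
by apply: mulr_ge0; [exact: kap_y_ge0 | exact: enorm_ge0].
Qed.

Lemma drift_opt_z i w : enorm (zstar i (x k w) - zstar i (x k.+1 w)) ^+ 2 <=
  kap_z c ^+ 2 * alpha ^+ 2 * move_sq k w.
Proof.
rewrite -mulrA -move_x -exprMn ler_pXn2r ?nnegrE ?enorm_ge0//; first exact: lip_zstar.
by apply: mulr_ge0; [exact: kap_z_ge0 | exact: enorm_ge0].
Qed.

Lemma VL2_next_y i : VL2 (it_y e i k.+1).
Proof.
have [h _] := noise_VL2 UT (@m_v i) (hist_vec_meas UT (@hist_mean_v i)) (v_var (horacle k) i).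
apply: VL2_ext (VL2B (sy i) (VL2Z s (VL2D h (VL2_mean_v i)))) => w.
by rewrite subrK -(step_y (hstep k w)).
Qed.

Hypothesis smu : s * mu <= 1.
Hypothesis sLg : s * Lg ^+ 2 <= mu.

Lemma rec_y i : Ex (err_y i k.+1) <= (1 - s * mu / 2) * Ex (err_y i k) +
  2 * s ^+ 2 * sigma_g1 c ^+ 2 +
  (1 + 2 / mu) / s * (kap_y c ^+ 2 * alpha ^+ 2 * Ex (move_sq k)).
Proof.
have h := descent_step UT (mu_gt0 hc) s0 s1 smu (sy i) (VL2_opt_y i sx)
  (VL2_opt_y i VL2_next_x) (VL2_mean_v i) (@hist_y i) (@hist_opt_y i) (@hist_mean_v i)
  (@m_v i) (v_unbiased (horacle k) (i:=i)) (v_var (horacle k) i)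
  (fun w => lower_step hc ha (x k w) (y i k w) (ltW s0) sLg) L1_move (drift_opt_y i).
have E : Ex (err_y i k.+1) =
    Ex (fun w => enorm (y i k w - s *: or_v e i k.+1 w - ystar i (x k.+1 w)) ^+ 2).
  by apply: Ex_ext => w; rewrite /err_y (step_y (hstep k w)).
exact: le_trans (le_of_eq E) h.
Qed.

Hypothesis sH : s * (64 * sigma_g2 c ^+ 2) <= mu.

Lemma L1_err_y i : L1 (err_y i k).
Proof. by apply: VL2_sqr; apply: VL2B => //; exact: VL2_opt_y. Qed.

Lemma L1_err_z i : L1 (err_z i k).
Proof. by apply: VL2_sqr; apply: VL2B => //; exact: VL2_opt_z. Qed.

Let rec_z_both i : VL2 (it_z e i k.+1) /\
  Ex (err_z i k.+1) <= (1 - s * mu / 8) * Ex (err_z i k) +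
  2 * (s * kap_s c * Ex (err_y i k)) +
  2 * s ^+ 2 * (4 * sigma_g2 c ^+ 2 * kap_r c ^+ 2 + 2 * sigma_f2 c ^+ 2) +
  (1 + 4 / mu) / s * (kap_z c ^+ 2 * alpha ^+ 2 * Ex (move_sq k)).
Proof.
have ks0 : 0 <= kap_s c.
  apply: mulr_ge0; last exact: sqr_ge0.
  by apply: addr_ge0 => //; apply: divr_ge0 => //; exact: ltW (mu_gt0 hc).
have := adjoint_descent_step UT (mu_gt0 hc) s0 s1 smu sH ks0 (sz i) (VL2_opt_z i sx)
  (VL2_opt_z i VL2_next_x) (VL2_mean_uy i) (@hist_z i) (@hist_opt_z i)
  (@hist_mean_uy i) (@hist_mean_H i) (@m_H i) (@m_uy i)
  (fun w v => lower_d22_le hc ha (x k w) (y i k w) v)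
  (uy_unbiased (horacle k) (i:=i)) (H_unbiased (horacle k) (i:=i))
  (uy_var (horacle k) i) (H_var (horacle k) i)
  (fun w => zstar_le hc ha i (x k w)) (L1_err_y i)
  (fun w => adjoint_step hc ha (x k w) (y i k w) (z i k w) s0 s1 sLg smu)
  (fun w => sqr_ge0 _) L1_move (drift_opt_z i).
move=> [h1 h2]; split.
  by apply: VL2_ext h1 => w; rewrite (step_z (hstep k w)).
have E : Ex (err_z i k.+1) = Ex (fun w => enorm (z i k w - s *:
    (mxapp (or_H e i k.+1 w) (z i k w) - or_uy e i k.+1 w) - zstar i (x k.+1 w)) ^+ 2).
  by apply: Ex_ext => w; rewrite /err_z (step_z (hstep k w)).
exact: le_trans (le_of_eq E) h2.
Qed.

Lemma VL2_next_z i : VL2 (it_z e i k.+1). Proof. by case: (rec_z_both i). Qed.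

Lemma rec_z i : Ex (err_z i k.+1) <= (1 - s * mu / 8) * Ex (err_z i k) +
  2 * (s * kap_s c * Ex (err_y i k)) +
  2 * s ^+ 2 * (4 * sigma_g2 c ^+ 2 * kap_r c ^+ 2 + 2 * sigma_f2 c ^+ 2) +
  (1 + 4 / mu) / s * (kap_z c ^+ 2 * alpha ^+ 2 * Ex (move_sq k)).
Proof. by case: (rec_z_both i). Qed.

Definition move_l w := enorm (cand_l k w - l k w) ^+ 2.

Lemma cand_l_dist w : enorm (cand_l k w - opt_l k w) ^+ 2 <= m ^- 2 * err_hl k w.
Proof. exact: dual_step_dist. Qed.

Lemma move_l_le w : move_l w <= 2 * (m ^- 2 * err_hl k w + err_l k w).
Proof.
rewrite /move_l -(subrKA (opt_l k w)); apply: le_trans (enorm_sqrD_le _ _) _.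
rewrite mulrDr (enormBC (opt_l k w) (l k w)); apply: lerD; last exact: lexx.
by apply: ler_wpM2l => //; exact: cand_l_dist.
Qed.

Lemma L1_err_hx : L1 (err_hx k).
Proof. by apply: VL2_sqr; apply: VL2B => //; exact: VL2_grad_x. Qed.

Lemma L1_err_hl : L1 (err_hl k).
Proof. by apply: VL2_sqr; apply: VL2B => //; exact: VL2_grad_l. Qed.

Lemma L1_err_l : L1 (err_l k).
Proof. by apply: VL2_sqr; apply: VL2B => //; exact: VL2_opt_l. Qed.

Definition gap_bound w := m ^- 2 * err_hl k w + err_l k w.

Lemma L1_gap_bound : L1 gap_bound.
Proof. by apply: L1D; [apply: L1Z; exact: L1_err_hl | exact: L1_err_l]. Qed.

Lemma move_l_next w : enorm (l k w - l k.+1 w) ^+ 2 = alpha ^+ 2 * move_l w.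
Proof.
rewrite run_l opprD addrA subrr sub0r enormN enormZ exprMn.
by rewrite real_normK ?num_real.
Qed.

(** A move of [x] with frozen weights costs no factor [n], by Jensen's inequality; the move of the
    weights does, and it is bounded through the errors of [h_lambda] and [lambda]. *)
Lemma drift_grad_x w : enorm (grad_x k w - grad_x k.+1 w) ^+ 2 <=
  2 * (kap_G c ^+ 2 * (alpha ^+ 2 * move_sq k w)) +
  4 * (n%:R * LP ^+ 2 * (alpha ^+ 2 * gap_bound w)).
Proof.
have -> : grad_x k w - grad_x k.+1 w =
    (mix_grad G (x k w) (l k w) - mix_grad G (x k.+1 w) (l k w)) +
    (mix_grad G (x k.+1 w) (l k w) - mix_grad G (x k.+1 w) (l k.+1 w)).
  by rewrite subrKA.
apply: le_trans (enorm_sqrD_le _ _) _; apply: lerD.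
  rewrite ler_pM2l// -move_x.
  exact: (mix_grad_lipl (kap_G_ge0 hc) G_lip _ _ (run_simplex k w)).
have -> : 4 * (n%:R * LP ^+ 2 * (alpha ^+ 2 * gap_bound w)) =
  2 * (n%:R * LP ^+ 2 * (alpha ^+ 2 * (2 * gap_bound w))) by ring.
rewrite ler_pM2l//; apply: le_trans (mix_grad_lipr LP0 G_le _ _ _) _.
apply: ler_wpM2l; first by apply: mulr_ge0; [exact: ler0n | exact: sqr_ge0].
by rewrite move_l_next; apply: ler_wpM2l; [exact: sqr_ge0 | exact: move_l_le].
Qed.

Lemma drift_grad_l w : enorm (grad_l k w - grad_l k.+1 w) ^+ 2 <=
  2 * (n%:R * LP ^+ 2 * (alpha ^+ 2 * move_sq k w)) +
  4 * (m ^+ 2 * (alpha ^+ 2 * gap_bound w)).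
Proof.
have -> : grad_l k w - grad_l k.+1 w =
    (obj_vec Ph (x k w) - obj_vec Ph (x k.+1 w)) + - (m *: (l k w - l k.+1 w)).
  rewrite /grad_l; move: (obj_vec _ _) (obj_vec _ _) (unif R n) => a b u.
  by apply/rowP => j; rewrite !mxE; ring.
apply: le_trans (enorm_sqrD_le _ _) _; apply: lerD.
  by rewrite ler_pM2l// -move_x; exact: (obj_vec_lip LP0 Ph_lip).
have -> : 4 * (m ^+ 2 * (alpha ^+ 2 * gap_bound w)) =
  2 * (m ^+ 2 * (alpha ^+ 2 * (2 * gap_bound w))) by ring.
rewrite ler_pM2l// enormN enormZ exprMn real_normK ?num_real// move_l_next.
apply: ler_wpM2l; first exact: sqr_ge0.
by apply: ler_wpM2l; [exact: sqr_ge0 | exact: move_l_le].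
Qed.

(** The part of the sample for [h_x] that survives conditioning but is not in [grad_x]: it is due to
    [y] and [z] not being at their targets. [hx_next] separates target, bias and noise. *)
Definition bias_x w := \sum_i l k w 0 i *:
  (hyper (x k w) (y i k w) (z i k w) - G i (x k w)).

Definition noise_x := mixed_noise (it_l e k) (fun i => or_ux e i k.+1) mean_ux
  (fun i => or_J e i k.+1) mean_J (fun i => it_z e i k).

Lemma hx_next w : hx k.+1 w = (1 - s) *: hx k w +
  s *: (grad_x k w + bias_x w + noise_x w).
Proof.
rewrite (step_hx (hstep k w)); congr (_ + s *: _).
rewrite /grad_x /mix_grad /bias_x /noise_x /mixed_noise -!big_split /=.
apply: eq_bigr => i _; rewrite -!scalerDr; congr (_ *: _).
rewrite /hyper mxappBl /mean_ux /mean_J; move: (hypergrad _ _) => g.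
move: (mxapp _ _) (mxapp _ _) (upper_d1 _ _) => a b u.
by apply/rowP => j; rewrite !mxE; ring.
Qed.

Lemma hist_bias_x : hist_vec U bias_x.
Proof.
apply: (@vec_meas_sum _ TU) => i; apply: (@vec_measZ _ TU); first exact: hist_l.
apply: (@vec_measB _ TU); last by apply: (@meas_G i _ TU); exact: hist_x.
apply: (@vec_measB _ TU); first exact: hist_mean_ux.
by apply: (@mxapp_meas _ TU); [exact: hist_mean_J | exact: hist_z].
Qed.

Lemma VL2_bias_x : VL2 bias_x.
Proof.
apply: VL2_sum => i.
apply: (@VL2_scale _ _ _ P _ (fun w => l k w 0 i) _ 1).
- exact: VL2_meas sl i.
- apply: VL2B.
    apply: VL2B; first exact: VL2_mean_ux.
    apply: (@VL2_mxapp _ _ _ P _ _ (mean_J i) _ Lg _ _ (sz i)).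
      by move=> a b; exact: (hist_meas_meas UT (@hist_mean_J i a b)).
    by move=> w v; exact: lower_d12_le.
  apply: (VL2_dom (meas_G i (VL2_meas sx)) (L1_cst P (LP ^+ 2))) => w.
  by rewrite ler_pXn2r ?nnegrE ?enorm_ge0.
- by move=> w; have /andP[a b] := run_l01 k w i; rewrite ger0_norm.
Qed.

Lemma bias_x_le w : enorm (bias_x w) ^+ 2 <=
  kap_b c * \sum_i (err_y i k w + err_z i k w).
Proof.
apply: le_trans (enorm_sqr_simplex _ (run_simplex k w)) _.
rewrite mulr_sumr; apply: ler_sum => i _.
have /andP[a b] := run_l01 k w i.
apply: le_trans (_ : enorm (hyper (x k w) (y i k w) (z i k w) - G i (x k w)) ^+ 2 <= _).
  by apply: ler_piMl => //; exact: sqr_ge0.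
exact: (hyper_bias hc ha).
Qed.

Lemma noise_x_facts : [/\ VL2 noise_x,
  (forall A, hist_vec U A -> VL2 A -> Ex (fun w => dot (A w) (noise_x w)) = 0) &
  Ex (fun w => enorm (noise_x w) ^+ 2) <= 2 * sigma_f1 c ^+ 2 +
    2 * sigma_g2 c ^+ 2 * \sum_i Ex (fun w => l k w 0 i * enorm (z i k w) ^+ 2)].
Proof.
have ls w := run_simplex k w.
have vX i := ux_var (horacle k) i; have vJ i := J_var (horacle k) i.
have uX i := ux_unbiased (horacle k) i; have uJ i := J_unbiased (horacle k) (i:=i).
split.
- exact: (mixed_noise_VL2 UT hist_l ls m_ux hist_mean_ux m_J hist_mean_J hist_z sz vX vJ).
- move=> A; exact: (mixed_noise_orthogonal UT hist_l ls m_ux hist_mean_ux m_J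
    hist_mean_J hist_z sz uX uJ vX vJ).
- exact: (mixed_noise_le UT hist_l ls m_ux hist_mean_ux m_J hist_mean_J hist_z sz vX vJ).
Qed.

Lemma VL2_next_hx : VL2 (it_hx e k.+1).
Proof.
have [h _ _] := noise_x_facts.
have hg := VL2_grad_x sx sl; have hb := VL2_bias_x.
apply: VL2_ext (VL2D (VL2Z (1 - s) shx) (VL2Z s (VL2D (VL2D hg hb) h))) => w.
by rewrite hx_next.
Qed.

Definition sum_err_y := \sum_i Ex (err_y i k).
Definition sum_err_z := \sum_i Ex (err_z i k).

Lemma hist_grad_x : hist_vec U (grad_x k).
Proof. by apply: (@meas_grad_x _ TU); [exact: hist_x | exact: hist_l]. Qed.

(** The weights sum to 1, so the bound on the adjoint states enters once instead of [n] times. *)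
Lemma Ex_weighted_z : \sum_i Ex (fun w => l k w 0 i * enorm (z i k w) ^+ 2) <=
  2 * sum_err_z + 2 * kap_r c ^+ 2.
Proof.
have ml i : measurable_fun setT (fun w => l k w 0 i) by exact: VL2_meas sl i.
have l1 i : L1 (fun w => l k w 0 i).
  apply: (L1_dom (ml i) (L1_cst P 1)) => w.
  by have /andP[a b] := run_l01 k w i; rewrite ger0_norm.
have E : 2 * kap_r c ^+ 2 = \sum_i 2 * kap_r c ^+ 2 * Ex (fun w => l k w 0 i).
  rewrite -mulr_sumr -Ex_sum//.
  rewrite (@Ex_ext _ _ _ P _ (fun=> 1)) ?Ex_cst ?mulr1// => w.
  by case: (run_simplex k w).
rewrite E mulr_sumr -big_split; apply: ler_sum => i _ /=.
have r1 := L1Z (2 * kap_r c ^+ 2) (l1 i); have r2 := L1Z 2 (L1_err_z i).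
rewrite -!ExZ//; last exact: L1_err_z.
rewrite -ExD//; apply: Ex_le; last 1 first.
- move=> w; have /andP[a b] := run_l01 k w i.
  apply: le_trans (_ : l k w 0 i * (2 * err_z i k w + 2 * kap_r c ^+ 2) <= _).
    apply: ler_wpM2l => //; have := enorm_sqrD_le (z i k w - zstar i (x k w)) (zstar i (x k w)).
    rewrite subrK => /le_trans; apply; apply: lerD; first exact: lexx.
    rewrite ler_pM2l// ler_pXn2r ?nnegrE ?enorm_ge0//; first exact: zstar_le hc ha i _.
    exact: kap_r_ge0.
  rewrite mulrDr; apply: lerD; last by rewrite mulrC.
  by apply: ler_piMl => //; apply: mulr_ge0 => //; exact: sqr_ge0.
- apply: (L1_dom _ (VL2_sqr (sz i))).
    by apply: measurable_funM => //; exact: L1_meas (VL2_sqr (sz i)).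
  move=> w; have /andP[a b] := run_l01 k w i.
  rewrite normrM !ger0_norm ?sqr_ge0//.
  by apply: ler_piMl => //; exact: sqr_ge0.
- exact: L1D.
Qed.

Lemma rec_hx : Ex (err_hx k.+1) <= (1 - s / 2) * Ex (err_hx k) +
  2 * (s * (kap_b c * (sum_err_y + sum_err_z))) +
  2 * s ^+ 2 * (2 * sigma_f1 c ^+ 2 +
     2 * sigma_g2 c ^+ 2 * (2 * sum_err_z + 2 * kap_r c ^+ 2)) +
  3 / s * (2 * (kap_G c ^+ 2 * (alpha ^+ 2 * Ex (move_sq k))) +
    4 * (n%:R * LP ^+ 2 * (alpha ^+ 2 * Ex gap_bound))).
Proof.
have [h1 h2 h3] := noise_x_facts.
have L1ey i : L1 (fun w => err_y i k w + err_z i k w).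
  by apply: L1D; [exact: L1_err_y | exact: L1_err_z].
have hB : L1 (fun w => kap_b c * \sum_i (err_y i k w + err_z i k w)).
  by apply: L1Z; exact: L1_sum.
have hQ1 : L1 (fun w => 2 * (kap_G c ^+ 2 * (alpha ^+ 2 * move_sq k w))).
  by do 3 apply: L1Z; exact: L1_move.
have hQ2 : L1 (fun w => 4 * (n%:R * LP ^+ 2 * (alpha ^+ 2 * gap_bound w))).
  by do 3 apply: L1Z; exact: L1_gap_bound.
have hN : Ex (fun w => enorm (noise_x w) ^+ 2) <= 2 * sigma_f1 c ^+ 2 +
    2 * sigma_g2 c ^+ 2 * (2 * sum_err_z + 2 * kap_r c ^+ 2).
  apply: le_trans h3 _; apply: lerD; first exact: lexx.
  apply: ler_wpM2l; first by apply: mulr_ge0 => //; exact: sqr_ge0.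
  exact: Ex_weighted_z.
have := averaging_step s0 s1 shx (VL2_grad_x sx sl)
  (VL2_grad_x VL2_next_x VL2_next_l) VL2_bias_x h1 hist_hx hist_grad_x hist_bias_x
  h2 hN hB (L1D hQ1 hQ2) bias_x_le drift_grad_x.
rewrite (ExD hQ1 hQ2) ExZ; last exact: L1_sum.
rewrite Ex_sum; last exact: L1ey.
have -> : \sum_i Ex (fun w => err_y i k w + err_z i k w) = sum_err_y + sum_err_z.
  rewrite -big_split; apply: eq_bigr => i _.
  by rewrite ExD; [|exact: L1_err_y | exact: L1_err_z].
have e1 : Ex (fun w => 2 * (kap_G c ^+ 2 * (alpha ^+ 2 * move_sq k w))) =
    2 * (kap_G c ^+ 2 * (alpha ^+ 2 * Ex (move_sq k))).
  by rewrite !ExZ; try do ?apply: L1Z; try exact: L1_move.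
have e2 : Ex (fun w => 4 * (n%:R * LP ^+ 2 * (alpha ^+ 2 * gap_bound w))) =
    4 * (n%:R * LP ^+ 2 * (alpha ^+ 2 * Ex gap_bound)).
  by rewrite !ExZ; try do ?apply: L1Z; try exact: L1_gap_bound.
rewrite e1 e2 => h.
have E : Ex (err_hx k.+1) = Ex (fun w => enorm ((1 - s) *: hx k w +
    s *: (grad_x k w + bias_x w + noise_x w) - grad_x k.+1 w) ^+ 2).
  by apply: Ex_ext => w; rewrite /err_hx hx_next.
exact: le_trans (le_of_eq E) h.
Qed.

Definition bias_l w := mean_s w - obj_vec Ph (x k w).

Lemma hist_mean_s : hist_vec U mean_s.
Proof.
move=> j; rewrite (_ : (fun w => _) = (fun w => upper pb j (xy j w))).
  apply: (@continuous_comp_meas _ TU R _ _ _ _ (@hist_xy j)) => p.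
  by apply: differentiable_continuous; exact: (@upper_diff _ _ _ _ ha j p).
by apply/funext => w; rewrite mxE.
Qed.

Lemma bias_l_le w : enorm (bias_l w) ^+ 2 <= L_f c ^+ 2 * \sum_i err_y i k w.
Proof.
rewrite enorm_sqr_sum mulr_sumr; apply: ler_sum => i _; rewrite !mxE.
rewrite -real_normK ?num_real// /err_y -exprMn ler_pXn2r ?nnegrE//.
  exact: (upper_Phi_dist ha).
by apply: mulr_ge0; [exact: (Lf_ge0 hc) | exact: enorm_ge0].
Qed.

Lemma VL2_bias_l : VL2 bias_l.
Proof.
apply: (VL2_dom _ (L1Z (L_f c ^+ 2) (L1_sum (index_enum 'I_n) L1_err_y)) bias_l_le).
apply: vec_measB; first exact: (hist_vec_meas UT hist_mean_s).
by apply: meas_obj; exact: VL2_meas sx.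
Qed.

Definition noise_l w := or_s e k.+1 w - mean_s w.

Lemma noise_l_facts : VL2 noise_l /\
  Ex (fun w => enorm (noise_l w) ^+ 2) <= n%:R * sigma_f0 c ^+ 2.
Proof.
have h i := noise_sqr_le UT (s_var (horacle k) i).
have E i w : noise_l w 0 i = or_s e k.+1 w 0 i - upper pb i (row_mx (x k w) (y i k w)).
  by rewrite !mxE.
have hi i : L1 (fun w => noise_l w 0 i ^+ 2).
  by apply: L1_ext (proj1 (h i)) => w; rewrite E.
have mN : vec_meas noise_l.
  by apply: vec_measB => //; exact: (hist_vec_meas UT hist_mean_s).
split; first by apply: VL2_of_coord => i; split; [exact: mN | exact: hi].
rewrite (@Ex_ext _ _ _ P _ (fun w => \sum_i noise_l w 0 i ^+ 2)); last first.
  by move=> w; rewrite enorm_sqr_sum.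
rewrite Ex_sum//; have -> : n%:R * sigma_f0 c ^+ 2 = \sum_(i < n) sigma_f0 c ^+ 2.
  by rewrite sumr_const card_ord -[RHS]mulr_natl.
apply: ler_sum => i _; apply: le_trans (proj2 (h i)).
by apply: le_of_eq; apply: Ex_ext => w; rewrite E.
Qed.

Lemma hl_next w : hl k.+1 w = (1 - s) *: hl k w +
  s *: (grad_l k w + bias_l w + noise_l w).
Proof.
rewrite (step_hl (hstep k w)); congr (_ + s *: _).
rewrite /grad_l /bias_l /noise_l.
move: (or_s _ _ _) (mean_s w) (obj_vec _ _) (unif R n) => a b u v.
by apply/rowP => j; rewrite !mxE; ring.
Qed.

Lemma VL2_next_hl : VL2 (it_hl e k.+1).
Proof.
have [h _] := noise_l_facts.
have hg := VL2_grad_l sx sl; have hb := VL2_bias_l.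
apply: VL2_ext (VL2D (VL2Z (1 - s) shl) (VL2Z s (VL2D (VL2D hg hb) h))) => w.
by rewrite hl_next.
Qed.

Lemma hist_obj : hist_vec U (fun w => obj_vec Ph (x k w)).
Proof. by apply: (@meas_obj _ TU); exact: hist_x. Qed.

Lemma hist_grad_l : hist_vec U (grad_l k).
Proof.
apply: (@vec_measB _ TU); first exact: hist_obj.
apply: (@vec_measZ _ TU); first exact: measurable_cst.
by apply: (@vec_measB _ TU); [exact: hist_l | exact: vec_meas_cst].
Qed.

Lemma rec_hl : Ex (err_hl k.+1) <= (1 - s / 2) * Ex (err_hl k) +
  2 * (s * (L_f c ^+ 2 * sum_err_y)) + 2 * s ^+ 2 * (n%:R * sigma_f0 c ^+ 2) +
  3 / s * (2 * (n%:R * LP ^+ 2 * (alpha ^+ 2 * Ex (move_sq k))) +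
    4 * (m ^+ 2 * (alpha ^+ 2 * Ex gap_bound))).
Proof.
have [h1 hN] := noise_l_facts.
have hB : L1 (fun w => L_f c ^+ 2 * \sum_i err_y i k w).
  by apply: L1Z; apply: L1_sum; exact: L1_err_y.
have hQ1 : L1 (fun w => 2 * (n%:R * LP ^+ 2 * (alpha ^+ 2 * move_sq k w))).
  by do 3 apply: L1Z; exact: L1_move.
have hQ2 : L1 (fun w => 4 * (m ^+ 2 * (alpha ^+ 2 * gap_bound w))).
  by do 3 apply: L1Z; exact: L1_gap_bound.
have gb : hist_vec U bias_l.
  by apply: (@vec_measB _ TU); [exact: hist_mean_s | exact: hist_obj].
have h2 A (gA : hist_vec U A) (hA : VL2 A) := noise_orthogonal UT (s_unbiased (horacle k)) gA hA h1.
have := averaging_step s0 s1 shl (VL2_grad_l sx sl)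
  (VL2_grad_l VL2_next_x VL2_next_l) VL2_bias_l h1 hist_hl hist_grad_l gb
  h2 hN hB (L1D hQ1 hQ2) bias_l_le drift_grad_l.
rewrite (ExD hQ1 hQ2) ExZ; last by apply: L1_sum; exact: L1_err_y.
rewrite Ex_sum -/sum_err_y; last exact: L1_err_y.
have e1 : Ex (fun w => 2 * (n%:R * LP ^+ 2 * (alpha ^+ 2 * move_sq k w))) =
    2 * (n%:R * LP ^+ 2 * (alpha ^+ 2 * Ex (move_sq k))).
  by rewrite !ExZ; try do ?apply: L1Z; try exact: L1_move.
have e2 : Ex (fun w => 4 * (m ^+ 2 * (alpha ^+ 2 * gap_bound w))) =
    4 * (m ^+ 2 * (alpha ^+ 2 * Ex gap_bound)).
  by rewrite !ExZ; try do ?apply: L1Z; try exact: L1_gap_bound.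
rewrite e1 e2 => h.
have E : Ex (err_hl k.+1) = Ex (fun w => enorm ((1 - s) *: hl k w +
    s *: (grad_l k w + bias_l w + noise_l w) - grad_l k.+1 w) ^+ 2).
  by apply: Ex_ext => w; rewrite /err_hl hl_next.
exact: le_trans (le_of_eq E) h.
Qed.

(** No noise enters: the new [x] and [lambda] are functions of the state at step [k], so the
    recursion holds pointwise. The new [lambda] is a convex combination of the old one and [cand_l],
    each compared with [lstar]. *)
Lemma err_l_next w : err_l k.+1 w <= (1 - alpha / 2) * err_l k w +
  2 * (alpha * (m ^- 2 * err_hl k w)) +
  3 / alpha * (n%:R * LP ^+ 2 / m ^+ 2 * (alpha ^+ 2 * move_sq k w)).
Proof.
rewrite /err_l; set a := l k w - opt_l k w.
have E : l k.+1 w - opt_l k.+1 w = ((1 - alpha) *: a + alpha *: (cand_l k w - opt_l k w))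
    + (opt_l k w - opt_l k.+1 w).
  rewrite run_l /a; move: (opt_l k w) (opt_l k.+1 w) => u v.
  by apply/rowP => j; rewrite !mxE; ring.
have a20 : 0 < alpha / 2 by apply: divr_gt0.
rewrite E; apply: le_trans (enorm_sqr_young _ _ a20) _; apply: lerD.
  have A0 : 0 <= m ^- 2 * err_hl k w.
    by apply: mulr_ge0; [rewrite invr_ge0; exact: sqr_ge0 | exact: sqr_ge0].
  have hA : enorm ((1 - alpha) *: a + alpha *: (cand_l k w - opt_l k w)) ^+ 2 <=
      (1 - alpha) * enorm a ^+ 2 + alpha * (m ^- 2 * err_hl k w).
    apply: le_trans (enorm_sqr_convex _ _ _) _; first by rewrite (ltW al0) al1.
    apply: lerD; first exact: lexx.
    by apply: ler_wpM2l; [exact: ltW | exact: cand_l_dist].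
  have := averaging_arith al0 al1 (sqr_ge0 (enorm a)) A0 (lexx 0) hA.
  by rewrite !mulr0 !addr0.
apply: ler_pM; [|exact: sqr_ge0|exact: inv_half_le|].
  by apply: addr_ge0 => //; rewrite invr_ge0 ltW.
by rewrite -move_x; exact: (lstar_lip m n0 LP0 Ph_lip).
Qed.

Lemma rec_l : Ex (err_l k.+1) <= (1 - alpha / 2) * Ex (err_l k) +
  2 * (alpha * (m ^- 2 * Ex (err_hl k))) +
  3 / alpha * (n%:R * LP ^+ 2 / m ^+ 2 * (alpha ^+ 2 * Ex (move_sq k))).
Proof.
have l1 := L1_err_l; have l2 := L1_err_hl; have l3 := L1_move.
have l4 : L1 (err_l k.+1).
  apply: VL2_sqr; apply: VL2B; first exact: VL2_next_l.
  by apply: VL2_opt_l; exact: VL2_next_x.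
rewrite -!ExZ; try (do ?apply: L1Z; assumption).
rewrite -!ExD; try (do ?apply: L1D; do ?apply: L1Z; assumption).
by apply: Ex_le; [|do ?apply: L1D; do ?apply: L1Z|exact: err_l_next].
Qed.

Hypothesis small : @kap_Psi R n m LP (kap_Q c) * (alpha * tau) <= 4^-1.

Lemma grad_gap w : enorm (hx k w - reg_grad Ph G m (x k w)) ^+ 2 <=
  2 * err_hx k w + 2 * (n%:R * LP ^+ 2 * err_l k w).
Proof.
rewrite -(subrKA (grad_x k w)); apply: le_trans (enorm_sqrD_le _ _) _.
apply: lerD; first exact: lexx.
by rewrite ler_pM2l//; exact: (mix_grad_lipr LP0 G_le).
Qed.

(** The quadratic upper bound along the step, [prox_descent] for the direction [h_x], and Young's
    inequality with parameter [2 tau] for the gradient error. *)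
Lemma value_next w : value k.+1 w <= value k w - alpha / (2 * tau) * move_sq k w +
  alpha * tau * (2 * err_hx k w + 2 * (n%:R * LP ^+ 2 * err_l k w)).
Proof.
set v := cand_x k w - x k w.
have q := reg_max_quadratic n0 m0 LP0 Ph_quad G_le Ph_lip (x k w) (alpha *: v).
rewrite -run_x in q.
have ds := prox_descent tau0 fconv fnear (hx k w) (run_feas k w).
have gg := grad_gap w.
have t20 : 0 < 2 * tau by apply: mulr_gt0.
have yg := dot_young (reg_grad Ph G m (x k w) - hx k w) v t20.
rewrite enormBC dotBl in yg.
have q' := le_trans (ler_norm _) q.
rewrite dotZr enormZ exprMn real_normK ?num_real// in q'.
rewrite -/(cand_x k w) -/v in ds.
rewrite -/(value k w) -/(value k.+1 w) in q'.
rewrite -/(move_sq k w).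
have mE : move_sq k w = enorm v ^+ 2 by [].
rewrite -mE in q' ds yg.
have M0 : 0 <= move_sq k w by exact: sqr_ge0.
move: q' ds yg gg M0.
move: (value k.+1 w) (value k w) (dot (reg_grad Ph G m (x k w)) v)
  (dot (hx k w) v) (move_sq k w) (enorm (hx k w - reg_grad Ph G m (x k w)) ^+ 2)
  (2 * err_hx k w + 2 * (n%:R * LP ^+ 2 * err_l k w)).
exact: value_arith.
Qed.

Lemma L1_value : L1 (value k).
Proof.
apply: (L1_dom _ (L1_cst P (b_Phi c + 2))).
  have cV : continuous (reg_max Ph m).
    apply: (@lipschitz_continuous _ _ _ LP) => p q.
    have H1 := reg_max_quadratic n0 m0 LP0 Ph_quad G_le Ph_lip.
    have H2 u : enorm (reg_grad Ph G m u) <= LP by exact: reg_grad_le.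
    exact (lipschitz_quadratic H1 H2 p q).
  exact: (continuous_comp_meas cV (VL2_meas sx)).
by move=> w; exact: (reg_max_bound n0 m0 Ph_le).
Qed.

End AtStep.

(** * Expectations along the whole run *)

Hypothesis smu : s * mu <= 1.
Hypothesis sLg : s * Lg ^+ 2 <= mu.
Hypothesis sH : s * (64 * sigma_g2 c ^+ 2) <= mu.
Hypothesis small : @kap_Psi R n m LP (kap_Q c) * (alpha * tau) <= 4^-1.

(** All earlier iterates are needed at once, because the history at [k] contains them; hence the
    induction on the bounded statement. *)
Lemma square_integrable_run k : square_integrable k.
Proof.
suff h j : (j <= k)%N -> square_integrable j by exact: h.
elim: k j => [|k IH] j.
  rewrite leqn0 => /eqP ->; split; first split.
  - by apply: VL2_ext (VL2_cst P x0) => w; rewrite (init_x hinit).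
  - by apply: VL2_ext (VL2_cst P l0) => w; rewrite (init_l hinit).
  - by move=> i; apply: VL2_ext (VL2_cst P (y0 i)) => w; rewrite (init_y hinit).
  - by move=> i; apply: VL2_ext (VL2_cst P (z0 i)) => w; rewrite (init_z hinit).
  split.
  - by apply: VL2_ext (VL2_cst P 0) => w; rewrite (init_hx hinit).
  - by apply: VL2_ext (VL2_cst P 0) => w; rewrite (init_hl hinit).
rewrite leq_eqVlt => /orP[/eqP ->|]; last exact: IH.
have UT := hist_gen_sub IH; have sq := IH k (leqnn k).
split; first split.
- by apply: VL2_next_x.
- by apply: VL2_next_l.
- by move=> i; apply: VL2_next_y.
- by move=> i; apply: VL2_next_z.
split; first by apply: VL2_next_hx.
by apply: VL2_next_hl.
Qed.

Lemma hist_measurable k : <<s hist_gen k >> `<=` measurable.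
Proof. by apply: hist_gen_sub => j _; exact: square_integrable_run. Qed.

Local Notation M := (run_const c).
Let M1 : 1 <= M := run_const_ge1 hc.
(** The numerals to which [Mi] is applied below are positions in [run_terms], counted from 0. *)
Let Mi i := run_const_ge hc i.
Let M0 : 0 <= M. Proof. exact: le_trans ler01 M1. Qed.
Let n1 : 1 <= n%:R :> R. Proof. by rewrite ler1n. Qed.
Let LP2M : 6 * LP ^+ 2 <= M.
Proof. by apply: le_trans (Mi 9); rewrite /= ler_wpM2r ?sqr_ge0// ler_nat. Qed.
Let UT := hist_measurable.
Let sq := square_integrable_run.

Local Notation sU k := (Ex (move_sq k)).
Local Notation sV k := (Ex (value k)).
Local Notation sY k := (sum_err_y k).
Local Notation sZ k := (sum_err_z k).
Local Notation sp k := (Ex (err_hx k)).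
Local Notation sq' k := (Ex (err_hl k)).
Local Notation sd k := (Ex (err_l k)).

Let sU0 k : 0 <= sU k. Proof. by apply: Ex_ge0 => w; exact: sqr_ge0. Qed.
Let sp0 k : 0 <= sp k. Proof. by apply: Ex_ge0 => w; exact: sqr_ge0. Qed.
Let sq0 k : 0 <= sq' k. Proof. by apply: Ex_ge0 => w; exact: sqr_ge0. Qed.
Let sd0 k : 0 <= sd k. Proof. by apply: Ex_ge0 => w; exact: sqr_ge0. Qed.
Let sY0 k : 0 <= sY k.
Proof. by apply: sumr_ge0 => i _; apply: Ex_ge0 => w; exact: sqr_ge0. Qed.
Let sZ0 k : 0 <= sZ k.
Proof. by apply: sumr_ge0 => i _; apply: Ex_ge0 => w; exact: sqr_ge0. Qed.

Let sum_cst (a : R) : \sum_(i < n) a = n%:R * a.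
Proof. by rewrite sumr_const card_ord mulr_natl. Qed.

(** Sums a recursion over the objectives; the terms that are the same for all of them acquire the
    factor [n]. *)
Let sum_affine (F' F E : 'I_n -> R) (u v a : R) :
  (forall i, F' i <= u * F i + v * E i + a) ->
  \sum_i F' i <= u * \sum_i F i + v * \sum_i E i + n%:R * a.
Proof.
move=> h; apply: le_trans (ler_sum _ (fun i _ => h i)) _.
by rewrite !big_split/= -!mulr_sumr sum_cst.
Qed.

Lemma run_V k : sV k.+1 <= sV k - alpha / (2 * tau) * sU k +
  alpha * tau * (2 * sp k + 2 * (n%:R * M * sd k)).
Proof.
have l1 : L1 (move_sq k) by exact: L1_move (sq k).
have l2 : L1 (err_hx k) by exact: L1_err_hx (sq k).
have l3 : L1 (err_l k) by exact: L1_err_l (sq k).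
have l4 : L1 (value k) by exact: L1_value (sq k).
have l5 : L1 (value k.+1) by exact: L1_value (sq k.+1).
have l6 := L1Z (n%:R * LP ^+ 2) l3.
have l7 := L1D (L1Z 2 l2) (L1Z 2 l6).
have l8 := L1B l4 (L1Z (alpha / (2 * tau)) l1).
have h := Ex_le l5 (L1D l8 (L1Z (alpha * tau) l7)) (value_next k small).
apply: le_trans h _; rewrite ExD//; last exact: L1Z.
rewrite ExB//; last exact: L1Z.
rewrite (ExZ _ l1) (ExZ _ l7) (ExD (L1Z 2 l2) (L1Z 2 l6)) (ExZ _ l2) (ExZ _ l6) (ExZ _ l3).
have hM : 12 * LP ^+ 2 <= M := Mi 9.
rewrite lerD2l ler_pM2l ?mulr_gt0// lerD2l ler_pM2l//.
apply: ler_wpM2r => //; apply: ler_wpM2l; first exact: ler0n.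
by have := sqr_ge0 LP; lra.
Qed.

Let si0 : 0 <= s^-1. Proof. by rewrite invr_ge0 ltW. Qed.
Let na0 u : 0 <= u -> 0 <= s^-1 * (n%:R * alpha ^+ 2 * u).
Proof.
move=> u0; apply: mulr_ge0 => //; apply: mulr_ge0 => //.
by apply: mulr_ge0; [exact: ler0n|exact: sqr_ge0].
Qed.
Let s2n0 : 0 <= s ^+ 2 * n%:R. Proof. by apply: mulr_ge0; [exact: sqr_ge0|exact: ler0n]. Qed.

Lemma run_Y k : sY k.+1 <= (1 - s * mu / 2) * sY k +
  M / s * (n%:R * alpha ^+ 2 * sU k) + s ^+ 2 * n%:R * M.
Proof.
(* The summand [0 * 0] gives the shape of [sum_affine]: no second error occurs in this recursion. *)
have h i : Ex (err_y i k.+1) <= (1 - s * mu / 2) * Ex (err_y i k) + 0 * 0 +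
    (2 * s ^+ 2 * sigma_g1 c ^+ 2 + (1 + 2 / mu) / s * (kap_y c ^+ 2 * alpha ^+ 2 * sU k)).
  by rewrite mulr0 addr0 addrA; exact: rec_y (@UT k) (sq k) _ _ _.
have {}h : sY k.+1 <= _ := sum_affine h.
apply: le_trans h _; rewrite mul0r addr0 -/(sY k).
have k1 := ler_wpM2r s2n0 (Mi 0).
have k2 := ler_wpM2r (na0 (sU0 k)) (Mi 3).
move: k1 k2; rewrite /=; move: (1 + 2 / mu) (s^-1) (Ex (move_sq k)) (sum_err_y k) (run_const c).
by move: (sigma_g1 c) (kap_y c) => a1 a2 a3 a4 a5 a6 a7; lra.
Qed.

Lemma run_Z k : sZ k.+1 <= (1 - s * mu / 8) * sZ k + s * M * sY k +
  M / s * (n%:R * alpha ^+ 2 * sU k) + s ^+ 2 * n%:R * M.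
Proof.
have h i : Ex (err_z i k.+1) <= (1 - s * mu / 8) * Ex (err_z i k) +
    2 * (s * kap_s c) * Ex (err_y i k) +
    (2 * s ^+ 2 * (4 * sigma_g2 c ^+ 2 * kap_r c ^+ 2 + 2 * sigma_f2 c ^+ 2) +
    (1 + 4 / mu) / s * (kap_z c ^+ 2 * alpha ^+ 2 * sU k)).
  by rewrite addrA -[2 * _ * Ex _]mulrA; exact: rec_z (@UT k) (sq k) _ _ _ _.
have {}h : sZ k.+1 <= (1 - s * mu / 8) * sZ k + 2 * (s * kap_s c) * sY k + n%:R *
  (2 * s ^+ 2 * (4 * sigma_g2 c ^+ 2 * kap_r c ^+ 2 + 2 * sigma_f2 c ^+ 2) +
    (1 + 4 / mu) / s * (kap_z c ^+ 2 * alpha ^+ 2 * sU k)) := sum_affine h.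
apply: le_trans h _.
have k0 := ler_wpM2r (mulr_ge0 (ltW s0) (sY0 k)) (Mi 2).
have k1 := ler_wpM2r s2n0 (Mi 1).
have k2 := ler_wpM2r (na0 (sU0 k)) (Mi 4).
move: k0 k1 k2; rewrite /=; move: (1 + 4 / mu) (s^-1) (Ex (move_sq k)) (sum_err_y k) (sum_err_z k).
move: (run_const c) (kap_s c) (kap_z c) (kap_r c) (sigma_g2 c) (sigma_f2 c).
by move=> a1 a2 a3 a4 a5 a6 a7 a8 a9 b1 b2; lra.
Qed.

Let gapE k : Ex (gap_bound k) = m ^- 2 * sq' k + sd k.
Proof.
have l1 : L1 (err_hl k) by exact: L1_err_hl (sq k).
have l2 : L1 (err_l k) by exact: L1_err_l (sq k).
by rewrite /gap_bound ExD ?ExZ//; exact: L1Z.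
Qed.

Let gap0 k : 0 <= m ^- 2 * sq' k + sd k.
Proof. by apply: addr_ge0 => //; apply: mulr_ge0 => //; rewrite invr_ge0 exprn_ge0// ltW. Qed.

Lemma run_p k : sp k.+1 <= (1 - s / 2) * sp k + s * M * (sY k + sZ k) +
  s ^+ 2 * M * (1 + sZ k) + M / s * (n%:R * alpha ^+ 2 * (sU k + (m ^- 2 * sq' k + sd k))).
Proof.
have h : sp k.+1 <= _ := rec_hx (@UT k) (sq k).
apply: le_trans h _; rewrite gapE -!addrA lerD2l.
have g0 := gap0 k.
move: (m ^- 2 * sq' k + sd k) g0 => g g0.
have k0 := ler_wpM2r (mulr_ge0 (ltW s0) (addr_ge0 (sY0 k) (sZ0 k))) (Mi 5).
have k1 := ler_wpM2r (sqr_ge0 s) (Mi 6).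
have k2 := ler_wpM2r (mulr_ge0 (sqr_ge0 s) (sZ0 k)) (Mi 7).
have k3 := ler_wpM2r (na0 (sU0 k)) (Mi 8).
have k4 := ler_wpM2r (na0 g0) (Mi 9).
have k5 : 6 * kap_G c ^+ 2 * (s^-1 * (alpha ^+ 2 * sU k)) <=
    6 * kap_G c ^+ 2 * (s^-1 * (n%:R * alpha ^+ 2 * sU k)).
  apply: ler_wpM2l; first by apply: mulr_ge0 => //; exact: sqr_ge0.
  apply: ler_wpM2l => //; apply: ler_wpM2r => //.
  by rewrite ler_peMl// sqr_ge0.
move: k0 k1 k2 k3 k4 k5; rewrite /=; move: (kap_b c) (kap_G c) (kap_r c) => a1 a2 a3.
move: (sum_err_y k) (sum_err_z k) (Ex (move_sq k)) (s^-1) => b1 b2 b3 v.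
move: (run_const c) (L_Phi c) (sigma_f1 c) (sigma_g2 c) => b4 b5 b6 b7; lra.
Qed.

Lemma run_q k : sq' k.+1 <= (1 - s / 2) * sq' k + s * M * sY k + s ^+ 2 * n%:R * M +
  M / s * (n%:R * alpha ^+ 2 * (sU k + m ^+ 2 * (m ^- 2 * sq' k + sd k))).
Proof.
have h : sq' k.+1 <= _ := rec_hl (@UT k) (sq k).
apply: le_trans h _; rewrite gapE -!addrA lerD2l.
have g0 : 0 <= m ^+ 2 * (m ^- 2 * sq' k + sd k).
  by apply: mulr_ge0; [exact: sqr_ge0|exact: gap0].
have k0 := ler_wpM2r (mulr_ge0 (ltW s0) (sY0 k)) (Mi 10).
have k1 := ler_wpM2r s2n0 (Mi 11).
have k3 : 6 * LP ^+ 2 * (s^-1 * (n%:R * alpha ^+ 2 * sU k)) <=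
    M * (s^-1 * (n%:R * alpha ^+ 2 * sU k)).
  apply: ler_wpM2r; first exact: na0.
  exact: LP2M.
have k4 := ler_wpM2r (na0 g0) (Mi 12).
have k5 : 12 * (s^-1 * (alpha ^+ 2 * (m ^+ 2 * (m ^- 2 * sq' k + sd k)))) <=
    12 * (s^-1 * (n%:R * alpha ^+ 2 * (m ^+ 2 * (m ^- 2 * sq' k + sd k)))).
  apply: ler_wpM2l => //.
  apply: ler_wpM2l => //; apply: ler_wpM2r => //.
  by rewrite ler_peMl// sqr_ge0.
move: k0 k1 k3 k4 k5; rewrite /=.
move: (m ^- 2 * sq' k + sd k) => g.
move: (sum_err_y k) (Ex (move_sq k)) (s^-1) => b1 b3 v.
move: (run_const c) (L_Phi c) (sigma_f0 c) (L_f c) => b4 b5 b6 b7; lra.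
Qed.

Lemma run_d k : sd k.+1 <= (1 - alpha / 2) * sd k + 2 * (alpha * (m ^- 2 * sq' k)) +
  3 * alpha * n%:R * M * m ^- 2 * sU k.
Proof.
have h : sd k.+1 <= _ := rec_l (sq k).
apply: le_trans h _; rewrite lerD2l.
have i0 : 0 <= m ^- 2 by rewrite invr_ge0 exprn_ge0// ltW.
have -> : 3 / alpha * (n%:R * LP ^+ 2 / m ^+ 2 * (alpha ^+ 2 * sU k)) =
    LP ^+ 2 * (3 * alpha * n%:R * m ^- 2 * sU k).
  by move: (m ^- 2) => v; field; rewrite gt_eqF.
have -> : 3 * alpha * n%:R * M * m ^- 2 * sU k = M * (3 * alpha * n%:R * m ^- 2 * sU k).
  by move: (m ^- 2) (run_const c) => u v; ring.
apply: ler_wpM2r.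
  by do 3 (apply: mulr_ge0 => //); apply: mulr_ge0 => //; exact: ltW.
by have := LP2M; have := sqr_ge0 LP; move: (run_const c) => a; lra.
Qed.

Variable D : R.
Hypothesis hD : forall i, enorm (y0 i - ystar i x0) <= D /\ enorm (z0 i) <= D.

Let D2 (i : 'I_n) : 0 <= D. Proof. by case: (hD i) => h _; apply: le_trans h; exact: enorm_ge0. Qed.

Lemma start_p : sp 0 <= M.
Proof.
(* The start is deterministic, so any outcome can represent it; [point] is a convenient one. *)
have E : sp 0 = Ex (fun=> enorm (grad_x 0 point) ^+ 2).
  apply: (Ex_ext P) => w; rewrite /err_hx (init_hx hinit) sub0r enormN /grad_x.
  by rewrite !(init_x hinit) !(init_l hinit).
rewrite E Ex_cst.
have hM : 12 * LP ^+ 2 <= M := Mi 9.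
have h : enorm (grad_x 0 point) ^+ 2 <= LP ^+ 2.
  rewrite ler_pXn2r ?nnegrE ?enorm_ge0//.
  exact: (mix_grad_le LP0 G_le _ (run_simplex 0 point)).
by have := sqr_ge0 LP; lra.
Qed.

Lemma start_d : sd 0 <= 4.
Proof.
rewrite -(Ex_cst P 4); apply: Ex_le; [exact: L1_err_l (sq 0)|exact: L1_cst|move=> w].
by apply: simplex_dist; [exact: run_simplex|exact: opt_l_simplex].
Qed.

Lemma start_q : sq' 0 <= n%:R * M.
Proof.
rewrite -(Ex_cst P (n%:R * M)).
apply: Ex_le; [exact: L1_err_hl (sq 0)|exact: L1_cst|move=> w].
rewrite /err_hl (init_hl hinit) sub0r enormN /grad_l.
apply: le_trans (enorm_sqrD_le _ _) _; rewrite enormN enormZ exprMn real_normK ?num_real//.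
have h1 := obj_vec_le (n := n) Ph_le (x 0 w).
have h2 := simplex_dist (run_simplex 0 w) (@simplex_unif R n n0).
have hM : 2 * b_Phi c ^+ 2 + 8 <= M := Mi 14.
have h3 : m ^+ 2 * enorm (l 0 w - unif R n) ^+ 2 <= 4.
  rewrite -[4]mul1r; apply: ler_pM => //; try exact: sqr_ge0.
  by rewrite expr_le1// ltW.
have h4 := ler_wpM2l (ler0n R n) hM; have := n1; lra.
Qed.

Lemma start_Y : sY 0 <= n%:R * (M + 2 * D ^+ 2).
Proof.
rewrite -sum_cst; apply: ler_sum => i _.
rewrite -(Ex_cst P (M + 2 * D ^+ 2)).
apply: Ex_le; [exact: L1_err_y (sq 0) i|exact: L1_cst|move=> w].
rewrite /err_y (init_y hinit) (init_x hinit).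
have [h _] := hD i.
have h2 : enorm (y0 i - ystar i x0) ^+ 2 <= D ^+ 2.
  by rewrite ler_pXn2r ?nnegrE ?enorm_ge0//; exact: D2 i.
have hD2 := sqr_ge0 D; have hM := M0.
by apply: le_trans h2 _; lra.
Qed.

Lemma start_Z : sZ 0 <= n%:R * (M + 2 * D ^+ 2).
Proof.
rewrite -sum_cst; apply: ler_sum => i _.
rewrite -(Ex_cst P (M + 2 * D ^+ 2)).
apply: Ex_le; [exact: L1_err_z (sq 0) i|exact: L1_cst|move=> w].
rewrite /err_z (init_z hinit) (init_x hinit).
have [_ h] := hD i.
apply: le_trans (enorm_sqrD_le _ _) _; rewrite enormN addrC.
apply: lerD; last by rewrite ler_pM2l// ler_pXn2r ?nnegrE ?enorm_ge0//; exact: D2 i.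
apply: le_trans (Mi 16); rewrite /= ler_pM2l// ler_pXn2r ?nnegrE ?enorm_ge0//.
  exact: zstar_le hc ha i _.
exact: kap_r_ge0.
Qed.

Lemma run_V_le k : `|sV k| <= M.
Proof.
have h w : `|value k w| <= M.
  apply: le_trans (Mi 15); exact: (reg_max_bound n0 m0 Ph_le).
have l4 : L1 (value k) by exact: L1_value (sq k).
rewrite ler_norml -{1}(Ex_cst P (- M)) -{2}(Ex_cst P M); apply/andP; split.
  by apply: Ex_le => // [|w]; [exact: L1_cst | have := h w; rewrite ler_norml => /andP[]].
by apply: Ex_le => // [|w]; [exact: L1_cst | have := h w; rewrite ler_norml => /andP[]].
Qed.

Local Notation gm k w := (enorm (prox_map (feas pb) (reg_grad Ph G m) tau (x k w)) ^+ 2).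

Lemma gm_le k w : gm k w <= LP ^+ 2.
Proof.
rewrite ler_pXn2r ?nnegrE ?enorm_ge0//.
apply: le_trans (prox_map_le _ tau0 fconv fnear (run_feas k w)) _.
exact: reg_grad_le.
Qed.

Lemma prox_continuous : continuous (fun p => enorm (prox_map (feas pb) (reg_grad Ph G m) tau p) ^+ 2).
Proof.
have h : continuous (fun p => enorm (prox_map (feas pb) (reg_grad Ph G m) tau p)).
  exact: (prox_map_continuous tau0 fconv fnear (reg_grad_lip n0 m0 LP0 (kap_G_ge0 hc) G_le Ph_lip G_lip)).
by move=> p; exact: (continuousM (h p) (h p)).
Qed.

Lemma L1_gm k : L1 (fun w => gm k w).
Proof.
apply: (L1_dom _ (L1_cst P (LP ^+ 2))).
  apply: (continuous_comp_meas prox_continuous).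
  by case: (sq k) => -[[]].
by move=> w; rewrite ger0_norm ?sqr_ge0//; exact: gm_le.
Qed.

Lemma grad_mapE p :
  grad_map m tau p = prox_map (feas pb) (reg_grad Ph G m) tau p.
Proof.
rewrite /prox_map -(@grad_reg_max _ _ _ Ph G m LP (kap_Q c) n0 m0 LP0 Ph_quad G_le Ph_lip).
by [].
Qed.

(** For the random index, which is independent of the history up to [K]. *)
Lemma gm_hist K k : (k <= K)%N -> hist_meas (hist_gen K) (fun w => gm k w).
Proof.
move=> kK.
apply: (@continuous_comp_meas _ (g_sigma_algebraType (hist_gen K)) R _ _ _ prox_continuous).
apply/(@vec_meas_mx R _ (g_sigma_algebraType (hist_gen K))).
apply: (@sigma_mx_sub R _ (g_sigma_algebraType (hist_gen K))) => A hA.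
by apply: sub_sigma_algebra; exists k => //; do 4 left.
Qed.

(** [prox_map_inexact] in expectation; the factor 8 comes from [2 / tau^2 = 8 (4 tau^2)^-1]. *)
Lemma run_gm k : Ex (fun w => gm k w) <=
  8 * (sp k + n%:R * M * sd k + (4 * tau ^+ 2)^-1 * sU k).
Proof.
have l1 : L1 (move_sq k) by exact: L1_move (sq k).
have l2 : L1 (err_hx k) by exact: L1_err_hx (sq k).
have l3 : L1 (err_l k) by exact: L1_err_l (sq k).
have l6 := L1Z (n%:R * M) l3.
have l7 := L1D (L1D l2 l6) (L1Z ((4 * tau ^+ 2)^-1) l1).
rewrite -(ExZ _ l1) -(ExZ _ l3) -(ExD l2 l6) -(ExD (L1D l2 l6)) ?ExZ -?ExZ//; try exact: L1Z.
apply: Ex_le; [exact: L1_gm|exact: L1Z|move=> w].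
apply: le_trans (prox_map_inexact _ tau0 fconv fnear (x k w) (hx k w)) _.
have gg := grad_gap k w.
have hM : 12 * LP ^+ 2 <= M := Mi 9.
have e0 : 0 <= n%:R * err_l k w by apply: mulr_ge0; [exact: ler0n|exact: sqr_ge0].
have k1 := ler_wpM2r e0 hM.
have E : (4 * tau ^+ 2)^-1 = (tau ^+ 2)^-1 / 4 by rewrite invfM mulrC.
have p0 : 0 <= err_hx k w by exact: sqr_ge0.
have e1 : 0 <= LP ^+ 2 * (n%:R * err_l k w) by apply: mulr_ge0 => //; exact: sqr_ge0.
rewrite E -/(move_sq k w).
move: gg k1 p0 e1 e0; move: (err_hx k w) (err_l k w) (move_sq k w) (tau ^+ 2)^-1 (run_const c).
by move: (enorm _ ^+ 2) => a1 a2 a3 a4 a5 a6; lra.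
Qed.

Lemma run_bound K : s = 8 * M * Num.sqrt n%:R * alpha ->
  tau = step_const M mu * m / n%:R ->
  alpha * \sum_(0 <= k < K) Ex (fun w => gm k w) <=
  8 * (start_const M mu D * (n%:R * Num.sqrt n%:R * m ^- 2) +
  K%:R * (8 * M ^+ 2 * weight_const M mu * (n%:R ^+ 2 * Num.sqrt n%:R * m ^- 2 * alpha ^+ 2))).
Proof.
move=> hs ht.
have nu1 : 1 <= Num.sqrt n%:R :> R by have := ler_wsqrtr n1; rewrite sqrtr1.
have nuE : n%:R = Num.sqrt n%:R ^+ 2 :> R by rewrite sqr_sqrtr// ler0n.
have i20 : 0 < m ^- 2 by rewrite invr_gt0 exprn_gt0.
have i2E : m ^+ 2 * m ^- 2 = 1 by rewrite divff// gt_eqF// exprn_gt0.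
have W := weighted_bound M1 (mu_gt0 hc) nu1 nuE m0 m1 i20 i2E al0 hs s1 ht
  sU0 sY0 sZ0 sp0 sq0 sd0 run_V run_Y run_Z run_p run_q run_d run_V_le
  start_Y start_Z start_p start_q start_d K.
apply: le_trans (_ : alpha * (8 * \sum_(0 <= k < K)
  (sp k + n%:R * M * sd k + (4 * tau ^+ 2)^-1 * sU k)) <= _); last first.
  by rewrite mulrCA ler_pM2l.
rewrite ler_pM2l// mulr_sumr; apply: ler_sum => k _; exact: run_gm.
Qed.

End Run.

(** * A random index *)

Section RandomIndex.
Context {R : realType} {n : nat} {pb : bilevel R n} {d0 : measure_display}
  {T : measurableType d0}.
Variables (P : probability T R) (e : execution pb T) (K : nat) (r : T -> nat).
Hypothesis UT : <<s hist_gen e K >> `<=` measurable.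
Hypothesis hr : uniform_index P e K r.
Variables (f : nat -> T -> R) (b : R).
Hypothesis fm : forall k, measurable_fun setT (f k).
Hypothesis f0 : forall k w, 0 <= f k w.
Hypothesis fb : forall k w, f k w <= b.
Hypothesis fh : forall k, (k <= K)%N -> hist_meas (hist_gen e K) (f k).

Let E k := [set w | r w = k].
Let mE k : measurable (E k). Proof. by have [] := hr k. Qed.

Let L1f k : L1 P (f k).
Proof. by apply: (L1_dom _ (L1_cst P b)) => // w; rewrite ger0_norm. Qed.

Let Ex_ind B : measurable B -> (P B = (Ex P \1_B)%:E)%E.
Proof.
move=> mB; have l1 : L1 P (fun w => \1_B w * 1) by apply: indic_dom => //; exact: L1_cst.
have := Ex_indic mB (L1_cst P 1); rewrite integral_cst// mul1e => ->.
by congr EFin; apply: Ex_ext => w; rewrite mulr1.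
Qed.

(** Independence is given for events of the history. [hist_pair_eq0], applied to the centred
    indicator of [r w = k], extends it to the history-measurable [f k]. *)
Let Ex_on k : (1 <= k <= K)%N -> Ex P (fun w => \1_(E k) w * f k w) = K%:R^-1 * Ex P (f k).
Proof.
move=> hk; have [mEk PE indep] := hr k.
have lI B : measurable B -> L1 P \1_B.
  move=> mB; apply: L1_ext (_ : L1 P (fun w => \1_B w * 1)).
    by move=> w; rewrite mulr1.
  by apply: indic_dom => //; exact: L1_cst.
have lD : L1 P (fun w => \1_(E k) w - K%:R^-1) by apply: L1B; [exact: lI|exact: L1_cst].
have l1 : L1 P (fun w => \1_(E k) w * f k w) by exact: indic_dom.
have l2 := L1Z K%:R^-1 (L1f k).
have h : Ex P (fun w => f k w * (\1_(E k) w - K%:R^-1)) = 0.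
  apply: (hist_pair_eq0 UT lD) => [B GB||]; last first.
  - by apply: L1_ext (L1B l1 l2) => w; ring.
  - by apply: fh; case/andP: hk.
  have mB := UT GB; have := indep B GB; rewrite PE hk.
  rewrite !Ex_ind//; last exact: measurableI.
  rewrite -EFinM => -[PBE].
  rewrite (@Ex_ext _ _ _ P _ (fun w => \1_(B `&` E k) w - K%:R^-1 * \1_B w)).
    have a1 := lI _ (measurableI B (E k) mB mEk); have a2 := lI _ mB.
    by rewrite (ExB a1 (L1Z K%:R^-1 a2)) (ExZ _ a2) PBE; ring.
  by move=> w; rewrite indicI /=; ring.
apply/eqP; rewrite -subr_eq0 -(ExZ _ (L1f k)) -ExB// -h; apply/eqP.
by apply: Ex_ext => w; ring.
Qed.

Let r_ae : {ae P, forall w, (1 <= r w <= K)%N}.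
Proof.
apply: (@negligibleS _ _ _ P (\bigcup_k (if (1 <= k <= K)%N then set0 else E k))).
  by move=> w /= h; exists (r w) => //; move/negP/negbTE: h => ->.
apply: negligible_bigcup => k; have [mEk PE _] := hr k.
case: ifP PE => // _ PE; first exact: negligible_set0.
by exists (E k); split.
Qed.

Lemma random_index_integral : (\int[P]_w (f (r w) w)%:E)%E =
  (K%:R^-1 * \sum_(1 <= k < K.+1) Ex P (f k))%:E.
Proof.
pose g w := \sum_(1 <= k < K.+1) \1_(E k) w * f k w.
have l1 k : L1 P (fun w => \1_(E k) w * f k w) by exact: indic_dom.
have lg : L1 P g by exact: L1_sum.
have mf : measurable_fun setT (fun w => f (r w) w).
  move=> _ B mB; rewrite setTI.
  rewrite (_ : _ @^-1` B = \bigcup_k (E k `&` f k @^-1` B)).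
    apply: bigcup_measurable => k _; apply: measurableI => //.
    by rewrite -[_ @^-1` _]setTI; exact: fm.
  by apply/seteqP; split => [w h|w [k _ [<-]]//]; exists (r w).
(* Outside a negligible set [r w] lies in the range of the sum, and exactly one indicator is 1. *)
have fg : {ae P, forall w, f (r w) w = g w}.
  apply: filterS r_ae => w hw; rewrite /g.
  rewrite (big_rem (r w)) /=; last by rewrite mem_index_iota.
  rewrite indicE mem_set// mul1r big_seq big1 ?addr0// => k.
  rewrite mem_rem_uniq ?iota_uniq// inE => /andP[/eqP kr _].
  by rewrite indicE memNset ?mul0r// => rk; apply: kr.
have -> : (\int[P]_w (f (r w) w)%:E = \int[P]_w (g w)%:E)%E.
  apply: ae_eq_integral => //; first exact/measurable_EFinP.
    exact: measurable_int lg.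
  by apply: filterS fg => w /= -> _.
rewrite (ExE lg) /g Ex_sum// mulr_sumr; congr EFin.
by rewrite !big_nat; apply: eq_bigr => k; exact: Ex_on.
Qed.

End RandomIndex.

(* A step size below the inverse of this constant makes all one-step recursions
   contractive. *)
Definition size_const (R : realType) (c : constants R) : R :=
  1 + mu_g c + L_dg c ^+ 2 / mu_g c + 64 * sigma_g2 c ^+ 2 / mu_g c.

Definition noise_const (R : realType) (c : constants R) : R :=
  8 * run_const c ^+ 2 * weight_const (run_const c) (mu_g c).

(** * Facts about a run with an admissible step size *)

Section Summary.
Context {R : realType} (c : constants R).
Hypothesis hc : valid_constants c.
Local Notation M := (run_const c).
Local Notation mu := (mu_g c).

Let mu0 : 0 < mu := mu_gt0 hc.
Let M1 : 1 <= M := run_const_ge1 hc.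
Let M0 : 0 < M. Proof. exact: lt_le_trans ltr01 M1. Qed.

Lemma weight_const_ge1 : 1 <= weight_const M mu.
Proof.
have h a : 0 <= a -> 0 <= a / mu by move=> a0; apply: divr_ge0 => //; exact: ltW.
have h1 : 1 <= 1 + 2 * M / mu by rewrite lerDl; apply/h/mulr_ge0 => //; exact: ltW.
have h2 : 1 <= 6 + 64 * (M + 1) + 96 * M / mu.
  by have := h (96 * M); have := M0; move: (96 * M / mu) => v k /(_ _); lra.
by rewrite -[1]mulr1; apply: ler_pM.
Qed.

Lemma step_const_gt0 : 0 < step_const M mu.
Proof.
have h := weight_const_ge1; rewrite invr_gt0 mulr_gt0// addr_gt0//.
  exact: lt_le_trans ltr01 h.
by rewrite !mulr_gt0// addr_gt0.
Qed.

Lemma noise_const_ge0 : 0 <= noise_const c.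
Proof.
have h := weight_const_ge1; apply: mulr_ge0; last exact: le_trans ler01 h.
by apply: mulr_ge0 => //; exact: sqr_ge0.
Qed.

Lemma start_const_ge0 D : 0 <= start_const M mu D.
Proof.
have h := weight_const_ge1; have t0 := step_const_gt0.
apply: addr_ge0; last by apply: mulr_ge0 => //; apply: addr_ge0 => //; exact: ltW.
apply: addr_ge0.
  by apply: divr_ge0; [apply: mulr_ge0 => //|]; exact: ltW.
apply: mulr_ge0; first exact: le_trans ler01 h.
by apply: addr_ge0; [exact: ltW | apply: mulr_ge0 => //; exact: sqr_ge0].
Qed.

Lemma size_const_ge1 : 1 <= size_const c.
Proof.
have h a : 0 <= a -> 0 <= a / mu by move=> a0; apply: divr_ge0 => //; exact: ltW.
have h1 := h _ (sqr_ge0 (L_dg c)); have h2 := h _ (mulr_ge0 (ler0n R 64) (sqr_ge0 (sigma_g2 c))).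
by rewrite /size_const; move: h1 h2 (mu0); move: (_ / mu) (_ / mu) => u v; lra.
Qed.

Lemma size_constP s : 0 < s -> s * size_const c <= 1 ->
  [/\ s <= 1, s * mu <= 1, s * L_dg c ^+ 2 <= mu &
      s * (64 * sigma_g2 c ^+ 2) <= mu].
Proof.
move=> s0 hs.
have h a : 0 <= a -> 0 <= a / mu by move=> a0; apply: divr_ge0 => //; exact: ltW.
have h1 := h _ (sqr_ge0 (L_dg c)); have h2 := h _ (mulr_ge0 (ler0n R 64) (sqr_ge0 (sigma_g2 c))).
have key v : v <= size_const c -> s * v <= 1.
  by move=> hv; apply: le_trans hs; rewrite ler_pM2l.
have div v : v / mu <= size_const c -> s * v <= mu.
  by move=> /key; rewrite mulrA ler_pdivrMr// mul1r.
have m0 := mu0; split; [rewrite -[s]mulr1; apply: key | apply: key | apply: div | apply: div];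
  rewrite /size_const; move: h1 h2; move: (_ / mu) (_ / mu) => u v; lra.
Qed.

Context {n : nat} {pb : bilevel R n} {d0 : measure_display} {T : measurableType d0}.
Variables (P : probability T R) (e : execution pb T) (m alpha D : R).
Hypothesis n0 : (0 < n)%N.
Hypothesis m0 : 0 < m.
Hypothesis m1 : m <= 1.
Local Notation tau := (step_const M mu * m / n%:R).
Local Notation s := (8 * M * Num.sqrt n%:R * alpha).
Hypothesis al0 : 0 < alpha.
Hypothesis hs : s * size_const c <= 1.
Hypothesis hv : valid_execution P e c D m tau m^-1 (fun=> alpha) (fun=> s)
  (fun=> s) (fun=> s).

Definition stat_sq k w := enorm (grad_map m tau (it_x e k w)) ^+ 2.

Let n1 : 1 <= n%:R :> R. Proof. by rewrite ler1n. Qed.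
Let tau0 : 0 < tau.
Proof. by rewrite divr_gt0 ?ltr0n// mulr_gt0// step_const_gt0. Qed.
Let nu1 : 1 <= Num.sqrt n%:R :> R.
Proof. by have := ler_wsqrtr n1; rewrite sqrtr1. Qed.
Let al_s : alpha <= s.
Proof.
rewrite ler_peMl//; first exact: ltW.
have h : 1 <= 8 * M by have := M1; lra.
by have := ler_pM ler01 ler01 h nu1; rewrite mulr1.
Qed.
Let s0 : 0 < s. Proof. exact: lt_le_trans al_s. Qed.

(** The curvature of the regularized max is at most [2 M n / m], and [tau] carries the inverse
    factor [m / n]; [step_const] supplies the remaining smallness. *)
Let small : @kap_Psi R n m (L_Phi c) (kap_Q c) * (alpha * tau) <= 4^-1.
Proof.
have [s1 _ _ _] := size_constP s0 hs; have al1 := le_trans al_s s1.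
have hQ : kap_Q c <= M := run_const_ge hc 13.
have hL : L_Phi c ^+ 2 <= M.
  by apply: le_trans (run_const_ge hc 9); rewrite /= ler_peMl ?sqr_ge0// ler1n.
have hk : @kap_Psi R n m (L_Phi c) (kap_Q c) <= 2 * M * (n%:R / m).
  have nm : 1 <= n%:R / m by rewrite ler_pdivlMr// mul1r; apply: le_trans m1 n1.
  have nm0 : 0 <= n%:R / m by exact: le_trans nm.
  have h1 := ler_wpM2r nm0 hL; have h2 := ler_wpM2l (ltW M0) nm.
  rewrite /kap_Psi; have -> : n%:R * L_Phi c ^+ 2 / m = L_Phi c ^+ 2 * (n%:R / m) by ring.
  by move: h1 h2; move: (n%:R / m) => v; lra.
have at0 : 0 <= alpha * tau by apply: mulr_ge0; exact: ltW.
apply: le_trans (ler_wpM2r at0 hk) _.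
have -> : 2 * M * (n%:R / m) * (alpha * tau) = alpha * (2 * M * step_const M mu).
  by field; rewrite !gt_eqF ?ltr0n.
have ht : 2 * M * step_const M mu <= 4^-1.
  rewrite /step_const ler_pdivrMr; last first.
    by have := step_const_gt0; rewrite /step_const invr_gt0.
  have hW := weight_const_ge1; have := mulr_ge0 (ltW M0) (ltW M0).
  by have := M1; move: (weight_const M mu) hW => v; lra.
have t0 : 0 <= 2 * M * step_const M mu.
  by apply: mulr_ge0; [apply: mulr_ge0 => //|]; apply: ltW => //; exact: step_const_gt0.
by apply: le_trans ht; rewrite ler_piMl.
Qed.

Lemma stat_sq_facts : [/\ forall k w, stat_sq k w <= L_Phi c ^+ 2,
  forall k, L1 P (stat_sq k),
  forall K k, (k <= K)%N -> hist_meas (hist_gen e K) (stat_sq k),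
  forall K, <<s hist_gen e K >> `<=` measurable &
  forall K, alpha * \sum_(0 <= k < K) Ex P (stat_sq k) <=
    8 * (start_const M mu D * (n%:R * Num.sqrt n%:R * m ^- 2) +
    K%:R * (noise_const c * (n%:R ^+ 2 * Num.sqrt n%:R * m ^- 2 * alpha ^+ 2)))].
Proof.
have [s1 smu sLg sH] := size_constP s0 hs; have al1 := le_trans al_s s1.
have [[hok ha] [x0 [l0 [y0 [z0 [hinit hD]]]]] _ hstep horacle] := hv.
have E k : stat_sq k = fun w =>
    enorm (prox_map (feas pb) (reg_grad (@Phi R n pb) (@hypergrad R n pb) m) tau (it_x e k w)) ^+ 2.
  by apply/funext => w; rewrite /stat_sq (grad_mapE tau hc ha n0 m0).
split=> [k w|k|K k kK|K|K].
- rewrite E; exact: (gm_le hc hok ha n0 tau0 al0 al1 hinit hstep).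
- rewrite E; exact: (L1_gm hc hok ha n0 m0 tau0 al0 al1 s0 s1 hinit hstep horacle smu sLg sH).
- rewrite E; exact: (gm_hist hc hok ha n0 m0 tau0 kK).
- exact: (hist_measurable hc hok ha n0 al0 al1 s0 s1 hinit hstep horacle smu sLg sH).
under eq_bigr do rewrite E.
exact: (run_bound hc hok ha n0 m0 m1 tau0 al0 al1 s0 s1 hinit hstep horacle smu sLg sH small hD K erefl erefl).
Qed.

End Summary.

(** * The rate *)

(** The lower bound on [alpha] divides the starting error by [a], the upper bound multiplies the
    noise by [b], and the factor 2 pays for [K + 1] noise terms averaged over [K]. *)
Definition rate_const (R : realType) (c : constants R) (a b D : R) : R :=
  8 * (start_const (run_const c) (mu_g c) D / a + 2 * noise_const c * b).

(** From this [K] on, [s * size_const c <= 1]. It does not involve [n], because the factor [sqrt n]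
    of [s] cancels against that of [alpha]. *)
Definition horizon (R : realType) (c : constants R) (b : R) : nat :=
  Num.bound ((8 * run_const c * b * size_const c) ^+ 2).

(** Here [nu] and [kp] stand for [sqrt n] and [sqrt K]. The two terms, [n sqrt n / alpha] and
    [n^2 sqrt n K alpha], balance for [alpha] of order [1 / (nu kp)]. *)
Lemma rate_arith (R : realFieldType) (C1 C2 a b nu kp m al S : R) :
  0 <= C1 -> 0 <= C2 -> 0 < a -> 0 < nu -> 1 <= kp -> 0 < m -> 0 < al ->
  a / (nu * kp) <= al -> al <= b / (nu * kp) ->
  al * S <= 8 * (C1 * (nu ^+ 2 * nu * m ^- 2) +
    (kp ^+ 2 + 1) * (C2 * (nu ^+ 2 ^+ 2 * nu * m ^- 2 * al ^+ 2))) ->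
  S / kp ^+ 2 <= 8 * (C1 / a + 2 * C2 * b) * (nu ^+ 2 ^+ 2 / (m ^+ 2 * kp)).
Proof.
move=> C10 C20 a0 nu0 k1 m0 al0 ha hb hS.
have k0 : 0 < kp by exact: lt_le_trans k1.
have nk : 0 < nu * kp by exact: mulr_gt0.
have i2 : 0 < m ^- 2 by rewrite invr_gt0 exprn_gt0.
have -> : nu ^+ 2 ^+ 2 / (m ^+ 2 * kp) = nu ^+ 2 ^+ 2 * m ^- 2 / kp by rewrite invfM mulrA.
move: (m ^- 2) i2 hS => i i0 hS.
have h1 : al^-1 <= nu * kp / a.
  by rewrite invf_ple ?posrE ?divr_gt0// invf_div.
have h2 : al * (nu * kp) <= b by rewrite -ler_pdivlMr.
have hS' : S <= 8 * (C1 * (nu ^+ 2 * nu * i) * al^-1 +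
    (kp ^+ 2 + 1) * (C2 * (nu ^+ 2 ^+ 2 * nu * i * al))).
  rewrite -(ler_pM2l al0); apply: le_trans hS _; apply: le_of_eq.
  by field; rewrite gt_eqF.
have w0 : 0 <= C1 * (nu ^+ 2 * nu * i).
  by do !apply: mulr_ge0 => //; rewrite ?exprn_ge0//; exact: ltW.
have t1 := ler_wpM2l w0 h1.
have w1 : 0 <= 2 * kp * (C2 * (nu ^+ 2 ^+ 2 * i)).
  by do !apply: mulr_ge0 => //; rewrite ?exprn_ge0//; exact: ltW.
have t2 := ler_wpM2l w1 h2.
have w2 : 0 <= C2 * (nu ^+ 2 ^+ 2 * nu * i * al).
  by do !apply: mulr_ge0 => //; rewrite ?exprn_ge0//; exact: ltW.
have k2 : kp ^+ 2 + 1 <= 2 * kp ^+ 2.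
  have : 1 <= kp ^+ 2 by apply: exprn_ege1.
  by lra.
have t3 := ler_wpM2r w2 k2.
have hS2 : S <= 8 * (C1 / a + 2 * C2 * b) * (nu ^+ 2 ^+ 2 * i) * kp.
  apply: le_trans hS' _.
  have -> : 8 * (C1 / a + 2 * C2 * b) * (nu ^+ 2 ^+ 2 * i) * kp =
     8 * (C1 * (nu ^+ 2 * nu * i) * (nu * kp / a) +
       2 * kp * (C2 * (nu ^+ 2 ^+ 2 * i)) * b) by field; rewrite gt_eqF.
  apply: ler_wpM2l => //; apply: lerD => //; apply: le_trans t3 _; apply: le_trans t2.
  by apply: le_of_eq; ring.
rewrite ler_pdivrMr ?exprn_gt0//; apply: le_trans hS2 _; apply: le_of_eq.
by field; rewrite !gt_eqF.
Qed.

Section Rate.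
Context {R : realType} (c : constants R).
Hypothesis hc : valid_constants c.
Variables (a b D : R).
Hypothesis a0 : 0 < a.
Hypothesis ab : a <= b.
Local Notation M := (run_const c).

Lemma rate_const_ge0 : 0 <= rate_const c a b D.
Proof.
have h1 := start_const_ge0 hc D; have h2 := noise_const_ge0 hc.
have b0 : 0 <= b by apply: le_trans ab; exact: ltW.
apply: mulr_ge0 => //; apply: addr_ge0; first by apply: divr_ge0 => //; exact: ltW.
by apply: mulr_ge0 => //; exact: mulr_ge0.
Qed.

Lemma horizonP K : (horizon c b <= K)%N -> 8 * M * b * size_const c <= Num.sqrt K%:R.
Proof.
move=> hK; apply: ler_of_sqr; first exact: sqrtr_ge0.
rewrite [X in _ <= X]sqr_sqrtr ?ler0n//.
have := archi_boundP (sqr_ge0 (8 * M * b * size_const c)).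
by move=> /ltW /le_trans; apply; rewrite ler_nat.
Qed.

Context {n : nat} {pb : bilevel R n} {d0 : measure_display} {T : measurableType d0}.
Variables (P : probability T R) (e : execution pb T) (m alpha : R) (K : nat).
Hypothesis n0 : (0 < n)%N.
Hypothesis m01 : 0 < m < 1.
Hypothesis K0 : (0 < K)%N.
Hypothesis hK : (horizon c b <= K)%N.
Hypothesis ha : a / Num.sqrt (n * K)%:R <= alpha <= b / Num.sqrt (n * K)%:R.
Local Notation tau := (step_const M (mu_g c) * m / n%:R).
Local Notation s := (8 * M * Num.sqrt n%:R * alpha).
Hypothesis hv : valid_execution P e c D m tau m^-1 (fun=> alpha) (fun=> s)
  (fun=> s) (fun=> s).

Let m0 : 0 < m. Proof. by case/andP: m01. Qed.
Let m1 : m <= 1. Proof. by case/andP: m01 => _ /ltW. Qed.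
Let nu0 : 0 < Num.sqrt n%:R :> R. Proof. by rewrite sqrtr_gt0 ltr0n. Qed.
Let kp1 : 1 <= Num.sqrt K%:R :> R.
Proof.
have h : 1 <= K%:R :> R by rewrite ler1n.
by have := ler_wsqrtr h; rewrite sqrtr1.
Qed.
Let kp0 : 0 < Num.sqrt K%:R :> R. Proof. exact: lt_le_trans kp1. Qed.
Let nkE : Num.sqrt (n * K)%:R = Num.sqrt n%:R * Num.sqrt K%:R :> R.
Proof. by rewrite natrM sqrtrM// ler0n. Qed.
Let al_ge : a / (Num.sqrt n%:R * Num.sqrt K%:R) <= alpha.
Proof. by rewrite -nkE; case/andP: ha. Qed.
Let al_le : alpha <= b / (Num.sqrt n%:R * Num.sqrt K%:R).
Proof. by rewrite -nkE; case/andP: ha. Qed.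
Let al0 : 0 < alpha.
Proof. by apply: lt_le_trans al_ge; rewrite divr_gt0// mulr_gt0. Qed.

Let hs : s * size_const c <= 1.
Proof.
have h1 : Num.sqrt n%:R * Num.sqrt K%:R * alpha <= b.
  by rewrite mulrC -ler_pdivlMr// mulr_gt0.
have N1 := size_const_ge1 hc; have M1 := run_const_ge1 hc.
have w : 0 <= 8 * M * size_const c.
  by apply: mulr_ge0; [apply: mulr_ge0 => //|]; exact: le_trans ler01 _.
rewrite -(ler_pM2l kp0) mulr1; apply: le_trans (horizonP hK).
have := ler_wpM2l w h1; move: (size_const c) => N; lra.
Qed.

Let facts := stat_sq_facts hc n0 m0 m1 al0 hs hv.

Let Ex0 k : 0 <= Ex P (stat_sq c e m k).
Proof. by apply: Ex_ge0 => w; exact: sqr_ge0. Qed.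

Lemma stat_sq_avg : K%:R^-1 * \sum_(0 <= k < K.+1) Ex P (stat_sq c e m k) <=
  rate_const c a b D * (n%:R ^+ 2 / (m ^+ 2 * Num.sqrt K%:R)).
Proof.
have [_ _ _ _ h] := facts; have {}h := h K.+1.
have nE : n%:R = Num.sqrt n%:R ^+ 2 :> R by rewrite sqr_sqrtr// ler0n.
have KE : K%:R = Num.sqrt K%:R ^+ 2 :> R by rewrite sqr_sqrtr// ler0n.
have KS : K.+1%:R = K%:R + 1 :> R by rewrite natr1.
rewrite KS in h; rewrite mulrC {1}KE nE.
apply: (@rate_arith _ _ _ a b (Num.sqrt n%:R) (Num.sqrt K%:R) m alpha) => //; last 1 first.
- by rewrite -nE -KE.
- exact: start_const_ge0 hc D.
- exact: noise_const_ge0 hc.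
Qed.

Lemma stat_sq_integral k : ('E_P[stat_sq c e m k] = (Ex P (stat_sq c e m k))%:E)%E.
Proof. by have [_ h _ _ _] := facts; rewrite unlock; exact: ExE. Qed.

Lemma stat_sq_index (r : T -> nat) : uniform_index P e K r ->
  ('E_P[fun w => stat_sq c e m (r w) w] <=
  (rate_const c a b D * (n%:R ^+ 2 / (m ^+ 2 * Num.sqrt K%:R)))%:E)%E.
Proof.
move=> hr; have [hb hL hh hU _] := facts.
rewrite unlock; rewrite (@random_index_integral _ _ _ _ _ _ _ _ _ (hU K) hr
  (stat_sq c e m) (L_Phi c ^+ 2)).
- rewrite lee_fin; apply: le_trans stat_sq_avg; apply: ler_wpM2l.
    by rewrite invr_ge0 ler0n.
  (* The random index ranges over 1, ..., [K]; the term [k = 0] of the rate is nonnegative and is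
     dropped. *)
  by rewrite [X in _ <= X]big_nat_recl// big_add1 /= lerDr.
- by move=> k; exact: L1_meas (hL k).
- by move=> k w; exact: sqr_ge0.
- exact: hb.
- exact: hh.
Qed.

End Rate.

Lemma oracle_callsE n K : oracle_calls n K = (6 * n * K)%N.
Proof.
by rewrite /oracle_calls sum_nat_const_nat subn0 big_const_ord iter_addn_0 mulnC.
Qed.

Lemma iteration_count (R : realType) (C n m eps : R) (N : nat) :
  0 <= C -> 1 <= n -> 0 < m -> m < 1 -> 0 < eps <= 1 ->
  exists K : nat, [/\ (0 < K)%N, (N <= K)%N,
    C * (n ^+ 2 / (m ^+ 2 * Num.sqrt K%:R)) <= eps &
    6 * n * K%:R <= 6 * (C ^+ 2 + 1 + N%:R) * (n ^+ 5 * m ^- 4 * eps ^- 2)].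
Proof.
move=> C0 n1 m0 m1 /andP[e0 e1].
have n0 : 0 < n by exact: lt_le_trans n1.
(* the value of [sqrt K] at which the rate equals [eps] *)
pose q := C * (n ^+ 2 / (m ^+ 2 * eps)).
have q0 : 0 <= q.
  apply: mulr_ge0 => //; apply: divr_ge0; first exact: sqr_ge0.
  by apply: mulr_ge0; [exact: sqr_ge0 | exact: ltW].
have q20 := sqr_ge0 q.
have /andP[t1 t2] := truncn_itv q20.
exists ((Num.truncn (q ^+ 2)).+1 + N)%N; split => //; first exact: leq_addl.
  set K := (_ + N)%N.
  have qK : q <= Num.sqrt K%:R.
    apply: ler_of_sqr; first exact: sqrtr_ge0.
    rewrite [X in _ <= X]sqr_sqrtr ?ler0n//; apply: le_trans (ltW t2) _.
    by rewrite ler_nat leq_addr.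
  have K0 : 0 < Num.sqrt K%:R :> R by rewrite sqrtr_gt0 ltr0n.
  have -> : C * (n ^+ 2 / (m ^+ 2 * Num.sqrt K%:R)) = q * eps / Num.sqrt K%:R.
    by rewrite /q; field; rewrite !gt_eqF.
  by rewrite ler_pdivrMr// mulrC ler_pM2l.
(* The target order is at least 1, because [n >= 1], [m < 1] and [eps <= 1]; it therefore absorbs
   the rounding of [K] and the horizon [N]. *)
have p1 : 1 <= n ^+ 4 * m ^- 4 * eps ^- 2.
  have a1 : 1 <= n ^+ 4 by exact: exprn_ege1.
  have a2 : 1 <= m ^- 4 by rewrite invf_ge1 ?exprn_gt0// exprn_ile1// ltW.
  have a3 : 1 <= eps ^- 2 by rewrite invf_ge1 ?exprn_gt0// exprn_ile1// ltW.
  have := ler_pM ler01 ler01 a1 a2; rewrite mulr1 => a4.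
  by have := ler_pM ler01 ler01 a4 a3; rewrite mulr1.
have qE : q ^+ 2 = C ^+ 2 * (n ^+ 4 * m ^- 4 * eps ^- 2).
  by rewrite /q; field; rewrite !gt_eqF.
have hK : ((Num.truncn (q ^+ 2)).+1 + N)%:R <= q ^+ 2 + 1 + N%:R.
  by rewrite natrD -natr1 !lerD2r.
have -> : n ^+ 5 * m ^- 4 * eps ^- 2 = n * (n ^+ 4 * m ^- 4 * eps ^- 2).
  by rewrite exprS -!mulrA.
move: (n ^+ 4 * m ^- 4 * eps ^- 2) p1 qE => v v1 qE.
have n60 : 0 <= 6 * n by apply: mulr_ge0 => //; exact: ltW.
apply: le_trans (ler_wpM2l n60 hK) _; rewrite qE.
have k : C ^+ 2 * v + 1 + N%:R <= (C ^+ 2 + 1 + N%:R) * v.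
  by have := ler_wpM2l (ler0n R N) v1; lra.
by have := ler_wpM2l n60 k; lra.
Qed.

Theorem theorem2 (R : realType) (c : constants R) (hc : valid_constants c) :
  (* c_1, c_2, c_3, tau_x, tau_lambda, as functions of n and mu_lambda *)
  exists c1 c2 c3 tau_x tau_l : nat -> R -> R,
  (forall (n : nat) (mu : R), (0 < n)%N -> 0 < mu < 1 ->
     [/\ 0 < c1 n mu, 0 < c2 n mu, 0 < c3 n mu, 0 < tau_x n mu
       & 0 < tau_l n mu]) /\
  (* a, b: the constants hidden in Theta; D: bound on the initial errors *)
  forall a b D : R, 0 < a -> a <= b -> 0 <= D ->
  (* C, K0: the constants hidden in O *)
  exists (C : R) (K0 : nat), 0 < C /\
  forall (n : nat) (mu : R), (0 < n)%N -> 0 < mu < 1 ->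
  (forall (K : nat), (0 < K)%N -> (K0 <= K)%N ->
   forall (alpha : R),
     a / Num.sqrt (n * K)%:R <= alpha <= b / Num.sqrt (n * K)%:R ->
   forall (d : measure_display) (T : measurableType d) (P : probability T R)
     (pb : bilevel R n) (e : execution pb T),
     valid_execution P e c D mu (tau_x n mu) (tau_l n mu)
       (fun=> alpha) (fun=> c1 n mu * alpha) (fun=> c2 n mu * alpha)
       (fun=> c3 n mu * alpha) ->
   ((K%:R^-1)%:E * \sum_(0 <= k < K.+1)
      'E_P[fun w => (enorm (grad_map mu (tau_x n mu) (it_x e k w)) ^+ 2)%R]
    <= (C * (n%:R ^+ 2 / (mu ^+ 2 * Num.sqrt K%:R)))%:E)%E) /\
  (forall eps : R, 0 < eps <= 1 ->
   exists K : nat, (0 < K)%N /\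
   (oracle_calls n K)%:R <= C * (n%:R ^+ 5 * mu ^- 4 * eps ^- 2) /\
   forall (alpha : R),
     a / Num.sqrt (n * K)%:R <= alpha <= b / Num.sqrt (n * K)%:R ->
   forall (d : measure_display) (T : measurableType d) (P : probability T R)
     (pb : bilevel R n) (e : execution pb T),
     valid_execution P e c D mu (tau_x n mu) (tau_l n mu)
       (fun=> alpha) (fun=> c1 n mu * alpha) (fun=> c2 n mu * alpha)
       (fun=> c3 n mu * alpha) ->
   forall r : T -> nat, uniform_index P e K r ->
   ('E_P[fun w => (enorm (grad_map mu (tau_x n mu) (it_x e (r w) w)) ^+ 2)%R]
    <= eps%:E)%E).
Proof.
pose M := run_const c.
have mu0 := mu_gt0 hc.
have M0 : 0 < M by apply: lt_le_trans (run_const_ge1 hc).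
(* All three rates equal [8 M sqrt n]. The size of [tau_x] comes from [weights_U], and [tau_l] is
   the inverse of [mu_lambda], as [dual_step_dist] requires. *)
exists (fun n _ => 8 * M * Num.sqrt n%:R), (fun n _ => 8 * M * Num.sqrt n%:R),
  (fun n _ => 8 * M * Num.sqrt n%:R),
  (fun n m => step_const M (mu_g c) * m / n%:R), (fun _ m => m^-1).
split.
  move=> n m n0 /andP[m0 _].
  have h : 0 < 8 * M * Num.sqrt n%:R by rewrite !mulr_gt0// sqrtr_gt0 ltr0n.
  split => //; last by rewrite invr_gt0.
  by rewrite divr_gt0 ?ltr0n// mulr_gt0// step_const_gt0.
move=> a b D a0 ab _.
have C0 := rate_const_ge0 hc D a0 ab.
set C := rate_const c a b D in C0 *.
have N0 := ler0n R (horizon c b); have S0 := sqr_ge0 C.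
(* One constant for both claims: the first summand covers the rate, the second the oracle count and,
   being positive, the case where [C] vanishes. *)
exists (C + 6 * (C ^+ 2 + 1 + (horizon c b)%:R)), (horizon c b); split; first by lra.
move=> n m n0 m01; have [m0 m1] := andP m01; split.
  move=> K K0 hK alpha ha d T P pb e hv.
  under eq_bigr do rewrite (stat_sq_integral hc a0 n0 m01 K0 hK ha hv).
  rewrite sumEFin -EFinM lee_fin.
  apply: le_trans (stat_sq_avg hc a0 n0 m01 K0 hK ha hv) _.
  apply: ler_wpM2r; last by rewrite -/C; lra.
  apply: divr_ge0; first exact: sqr_ge0.
  by apply: mulr_ge0; [exact: sqr_ge0 | exact: sqrtr_ge0].
move=> eps eps01.
have n1 : 1 <= n%:R :> R by rewrite ler1n.
have [K [K0 hK hrate hcalls]] := iteration_count (horizon c b) C0 n1 m0 m1 eps01.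
exists K; split => //; split.
  rewrite oracle_callsE !natrM; apply: le_trans hcalls _.
  apply: ler_wpM2r; last by lra.
  have /andP[e0 _] := eps01.
  apply: mulr_ge0; last by rewrite invr_ge0 exprn_ge0// ltW.
  by apply: mulr_ge0; [rewrite exprn_ge0 | rewrite invr_ge0 exprn_ge0// ltW].
move=> alpha ha d T P pb e hv r hr.
apply: le_trans (stat_sq_index hc a0 n0 m01 K0 hK ha hv hr) _.
by rewrite lee_fin.
Qed.
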